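(* Let $n\ge 2$ and let $u$ be a positive solution of $4\Delta_b u=n^2u^{\frac{n+2}{n}}$ in $\mathbb{H}^n$. Assume that there exists a constant $C>0$ such that $$u(z,t)\le C\left(|z|^2+|t|\right)^{-\frac{n-2}{2}}\qquad\forall (z,t)\in\mathbb{H}^n\setminus\{(0,0)\}.$$ Then there exist $\mu\in\mathbb{C}^n$ and $\lambda\in\mathbb{C}$ with $|\mu|^2<4\operatorname{Im}\lambda$ such that $$u(z,t)=\frac{\left(4\operatorname{Im}\lambda-|\mu|^2\right)^{n/2}}{\left|t+\sqrt{-1}\,|z|^2+\langle\mu,z\rangle+\lambda\right|^n}\qquad\forall (z,t)\in\mathbb{H}^n.$$
   Context: $\mathbb{H}^n=\mathbb{C}^n\times\mathbb{R}$ is the Heisenberg group, with points $(z,t)$, $z=(z_1,\dots,z_n)$. For a smooth function $u$ on $\mathbb{H}^n$ and $\alpha\in\{1,\dots,n\}$, put $Z_\alpha u=\partial_{z_\alpha}u+\sqrt{-1}\,\overline{z_\alpha}\,\partial_t u$ and $Z_{\overline\alpha}u=\partial_{\overline{z_\alpha}}u-\sqrt{-1}\,z_\alpha\,\partial_t u$, where $\partial_{z_\alpha}=\frac12(\partial_{x_\alpha}-\sqrt{-1}\,\partial_{y_\alpha})$ and $\partial_{\overline{z_\alpha}}=\frac12(\partial_{x_\alpha}+\sqrt{-1}\,\partial_{y_\alpha})$ for $z_\alpha=x_\alpha+\sqrt{-1}\,y_\alpha$. The sub-Laplacian is $\Delta_b u=-\operatorname{Re}\sum_{\alpha=1}^n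 Z_{\overline\alpha}(Z_\alpha u)$. Solutions are understood to be smooth (classical) real-valued functions on all of $\mathbb{H}^n$. Here $|z|^2=\sum_\alpha|z_\alpha|^2$, and $\langle\mu,z\rangle=\sum_{\alpha=1}^n\mu_\alpha z_\alpha$ (complex-linear in $z$). *)

(* Defs.v *)
From HB Require Import structures.
From mathcomp Require Import all_boot all_order all_algebra.
From mathcomp Require Import all_classical all_reals all_analysis.
From mathcomp Require Import complex.

Set Implicit Arguments.
Unset Strict Implicit.
Unset Printing Implicit Defensive.

Import Order.TTheory GRing.Theory Num.Theory.
Import numFieldNormedType.Exports.

Local Open Scope classical_set_scope.
Local Open Scope ring_scope.

(* C^n x R in real coordinates: ((x, y), t) stands for (z, t) with
   z = x + i y, so that the normed R-module structure of the product is the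
   usual one of R^(2n+1). *)
Notation heis R n := ('rV[R]_n * 'rV[R]_n * R)%type.

Section Heisenberg.
Variables (R : realType) (n : nat).
Implicit Types (p : heis R n) (a : 'I_n) (f : heis R n -> R[i]).

Definition zcoord p : 'rV[R[i]]_n :=
  \row_a Complex (p.1.1 0 a) (p.1.2 0 a).

Definition tcoord p : R := p.2.

Definition csqnorm (v : 'rV[R[i]]_n) : R := \sum_a Normc.normc (v 0 a) ^+ 2.

(* Complex-linear in both arguments: no conjugation. *)
Definition cpairing (mu v : 'rV[R[i]]_n) : R[i] := \sum_a mu 0 a * v 0 a.

(* C^oo: every iterated directional derivative, u itself included (s = [::]),
   is Frechet differentiable, hence continuous, at every point. *)
Definition smooth (u : heis R n -> R) : Prop :=
  forall (s : seq (heis R n)) p,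
    differentiable (foldr (fun v g => 'D_v g) u s) p.

(* R[i] carries no real normed module structure in the library, so real
   derivatives of complex-valued functions are taken componentwise. *)
Definition cderive (v : heis R n) f p : R[i] :=
  Complex ('D_v (fun q => complex.Re (f q)) p)
          ('D_v (fun q => complex.Im (f q)) p).

Definition dx a f : heis R n -> R[i] := cderive (delta_mx 0 a, 0, 0) f.
Definition dy a f : heis R n -> R[i] := cderive (0, delta_mx 0 a, 0) f.
Definition dt f : heis R n -> R[i] := cderive (0, 0, 1) f.

Definition dz a f p : R[i] := 2^-1 * (dx a f p - 'i%C * dy a f p).
Definition dzbar a f p : R[i] := 2^-1 * (dx a f p + 'i%C * dy a f p).

Definition Z a f p : R[i] :=
  dz a f p + 'i%C * (zcoord p 0 a)^*%C * dt f p.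
Definition Zbar a f p : R[i] :=
  dzbar a f p - 'i%C * zcoord p 0 a * dt f p.

Definition subLaplacian (u : heis R n -> R) p : R :=
  - complex.Re (\sum_a Zbar a (Z a (fun q => (u q)%:C%C)) p).

End Heisenberg.

(* Main.v *)
(* Write u = (2 e^f)^n, P = e^(2f), q = sum_a |f_a|^2 with f_a = Z_a f, f_0 = d_t f and
   g = q + P - i f_0.  The equation says sum_a Zbar_a f_a = -n g, and the tensors
     D_ab = Z_b f_a - 2 f_a f_b,  E_ab = Zbar_b f_a + g delta_ab,  G_a = i d_t f_a + g f_a
   vanish identically only on the bubbles.  The Jerison-Lee identity exhibits a vector field
   X = O(|g|) (D, E, G), contracted with grad f, such that Re div (e^((2n-2)f) X) = e^((2n-2)f) M
   with M >= 0 a sum of squares that dominates |D|^2 + |E|^2 + |G|^2.  Integrating against a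
   cutoff at scale L, and absorbing the lower order divergences of e^(jf) grad f,
   e^((2n-2)f) q grad f and e^((2n-2)f) gbar grad f, bounds the mass F(L) of M by
   K M_L / tau + K tau (K' + delta M_L) for every tau > 0, where M_L <= F(L) and
   M_L <= K (F(2L) - F(L)); the decay hypothesis enters only in the critical integral of
   e^(2n+2)f.  So F is bounded, and if F were positive somewhere then every doubling of L would
   increase it by a fixed amount.  Hence M = 0, the three tensors vanish, and i/g is a CR function
   with affine horizontal gradient, that is t + i|z|^2 + <mu,z> + lambda.

   No integration theory is needed: integrals are replaced by Riemann sums on finer and finer cyclic grids, and
   integration by parts holds up to an arbitrarily small error by shift invariance of the sums. *)

Require Import Defs.
From HB Require Import structures.
From mathcomp Require Import all_boot all_order all_algebra.
From mathcomp Require Import all_classical all_reals all_analysis.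
From mathcomp Require Import complex ring lra.

Set Implicit Arguments.
Unset Strict Implicit.
Unset Printing Implicit Defensive.

Import Order.TTheory GRing.Theory Num.Theory.
Import numFieldNormedType.Exports.

Local Open Scope classical_set_scope.
Local Open Scope ring_scope.

(** * Smooth real functions *)

(** The decay rate is exactly borderline. It bounds the critical integral at scale [L] by a multiple
    of [L ^ 2], while the squared gradient of a cutoff is of order [L ^ (-2)]: the two cancel
    without leaving a small factor, and letting [L] tend to infinity proves nothing by itself. Hence
    the mass inequality is used twice: with a large fixed [tau] it bounds the mass, with [tau]
    proportional to a putative mass it bounds the mass of an annulus from below. The annulus comes
    from the cutoff [s (1 - s)], where [s] is the fourth power of the gauge over [L ^ 4]. It
    vanishes at the origin too, where the decay bound may be singular, and its powers are dominated
    by the growth of those of the outer cutoff [1 - s ^ N] from [L] to [2 L]; conversely, the factor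
    [s ^ (N - 1)] in the gradient of the outer cutoff lets the inner one control the flux. Cutoffs
    are powers of positive parts of polynomials, hence continuously differentiable with explicit
    derivatives. An inequality between integrals becomes one valid on all fine enough grids, with
    constants independent of the grid. *)

Section Smooth.
Variables (R : realType) (V : normedModType R).
Implicit Types (f g : V -> R) (v : V) (k : nat).

(** Level 0 already means differentiability, and level [k] reaches the derivatives of order [k].
    With this index, closure under products, inverses and exponentials goes by induction: the
    derivative at level [k.+1] only calls for the same statement at level [k]. *)
Fixpoint Ck k f : Prop :=
  (forall p, differentiable f p) /\
  (if k is k'.+1 then forall v, Ck k' ('D_v f) else True).

Lemma Ck_diff k f p : Ck k f -> differentiable f p.
Proof. by case: k => [|k] [h _]. Qed.

Lemma CkW k f : Ck k.+1 f -> Ck k f.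
Proof.
elim: k f => [|k IH] f [d h]; split=> // v; exact/IH/h.
Qed.

Definition smth f := forall k, Ck k f.

Lemma smth_diff f p : smth f -> differentiable f p.
Proof. by move=> sf; exact: Ck_diff (sf 0%N). Qed.

Lemma smth_derivable f p v : smth f -> derivable f p v.
Proof. by move=> ?; apply: diff_derivable; exact: smth_diff. Qed.

Lemma smth_continuous f : smth f -> continuous f.
Proof. by move=> sf p; apply: differentiable_continuous; exact: smth_diff. Qed.

Lemma smthD1 f v : smth f -> smth ('D_v f).
Proof. by move=> sf k; have [_ h] := sf k.+1; exact: h. Qed.

Lemma smthP f : smth f <->
  (forall p, differentiable f p) /\ (forall v, smth ('D_v f)).
Proof.
split=> [sf|[df sf] [|k]].
- by split=> [p|v]; [exact: smth_diff|exact: smthD1].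
- by split.
- by split=> // v; exact: sf.
Qed.

Lemma Ck_iter f : smth f <->
  (forall (s : seq V) p, differentiable (foldr (fun v g => 'D_v g) f s) p).
Proof.
split=> [sf s|h k].
- suff: smth (foldr (fun v g => 'D_v g) f s) by move=> ? p; exact: smth_diff.
  by elim: s => //= v s; exact: smthD1.
- elim: k f h => [|k IH] f h; first by split=> // p; exact: (h [::]).
  split=> [p|v]; first exact: (h [::]).
  (* [Ck] peels off the innermost derivative, which in the [foldr] belongs to the last entry of the
     list. *)
  by apply: IH => s p; have := h (rcons s v) p; rewrite foldr_rcons.
Qed.

Lemma deriv_cst (c : R) v : 'D_v (cst c : V -> R) = cst 0.
Proof. by apply/funext => p; rewrite derive_cst. Qed.

Lemma Ck_cst k (c : R) : Ck k (cst c : V -> R).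
Proof.
elim: k c => [|k IH] c; split=> // v; rewrite deriv_cst; exact: IH.
Qed.

Lemma Ck_add k f g : Ck k f -> Ck k g -> Ck k (f + g).
Proof.
elim: k f g => [|k IH] f g cf cg;
  have d p : differentiable (f + g) p by
    apply: differentiableD; [exact: Ck_diff cf|exact: Ck_diff cg].
  by [].
split=> // v.
have -> : 'D_v (f + g) = 'D_v f + 'D_v g.
  apply/funext => p; rewrite deriveD //; apply: diff_derivable;
  [exact: Ck_diff cf|exact: Ck_diff cg].
by apply: IH; [have [_ h] := cf; exact: h|have [_ h] := cg; exact: h].
Qed.

Lemma Ck_mul k f g : Ck k f -> Ck k g -> Ck k (f * g).
Proof.
elim: k f g => [|k IH] f g cf cg;
  have d p : differentiable (f * g) p by
    apply: differentiableM; [exact: Ck_diff cf|exact: Ck_diff cg].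
  by [].
split=> // v.
have -> : 'D_v (f * g) = f * 'D_v g + g * 'D_v f.
  apply/funext => p; rewrite deriveM //; apply: diff_derivable;
  [exact: Ck_diff cf|exact: Ck_diff cg].
by apply: Ck_add; (apply: IH; first exact: CkW);
  [have [_ h] := cg; exact: h|have [_ h] := cf; exact: h].
Qed.

Lemma smth_cst (c : R) : smth (cst c).
Proof. by move=> k; exact: Ck_cst. Qed.

Lemma smth_add f g : smth f -> smth g -> smth (f + g).
Proof. by move=> sf sg k; exact: Ck_add. Qed.

Lemma smth_mul f g : smth f -> smth g -> smth (f * g).
Proof. by move=> sf sg k; exact: Ck_mul. Qed.

Lemma smth_opp f : smth f -> smth (- f).
Proof.
move=> sf; have -> : - f = cst (-1) * f by apply/funext => p /=; rewrite mulN1r.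
by apply: smth_mul => //; exact: smth_cst.
Qed.

Lemma smth_lin (f : {linear V -> R}) : continuous f -> smth f.
Proof.
move=> cf; apply/smthP; split=> [p|v]; first exact: linear_differentiable.
have -> : 'D_v f = cst (f v); last exact: smth_cst.
apply/funext => p; rewrite deriveE; last exact: linear_differentiable.
by rewrite diff_lin.
Qed.

(* A solution of [D f = h * D u] with [h] as regular as [f] is smooth: the
   common pattern behind inverses, logarithms and exponentials. *)
Lemma smth_chain f h u : smth u -> (forall p, differentiable f p) ->
  (forall v, 'D_v f = h * 'D_v u) -> (forall k, Ck k f -> Ck k h) -> smth f.
Proof.
move=> su df Df hh; elim=> [|k IH]; first by split.
split=> // v; rewrite Df; apply: Ck_mul; first exact: hh.
exact: smthD1.
Qed.

Lemma deriv_comp1 (F : R -> R) (u : V -> R) p v : derivable F (u p) 1 ->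
  differentiable u p ->
  differentiable (F \o u) p /\ 'D_v (F \o u) p = derive1 F (u p) * 'D_v u p.
Proof.
move=> /derivable1_diffP dF du.
have d := differentiable_comp du dF.
split=> //; rewrite deriveE // diff_comp //= (deriveE _ du).
by rewrite [in LHS]diff1E // mulrC.
Qed.

Lemma smth_inv f : smth f -> (forall p, f p != 0) -> smth (fun p => (f p)^-1).
Proof.
move=> sf f0.
have e p v : 'D_v (fun p => (f p)^-1) p = - (f p) ^- 2 * 'D_v f p.
  have := @deriveV _ _ f p v (f0 p) (@smth_derivable f p v sf).
  by [].
apply: (@smth_chain _ (- ((fun p => (f p)^-1) * (fun p => (f p)^-1))) f) => //.
- by move=> p; apply: differentiableV => //; exact: smth_diff.
- move=> v; apply/funext => p; rewrite e /=; congr (_ * _).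
  by rewrite !fctE /= expr2 invfM.
- move=> k h.
  have -> : - ((fun p => (f p)^-1) * (fun p => (f p)^-1)) =
    cst (-1) * ((fun p => (f p)^-1) * (fun p => (f p)^-1)).
    by apply/funext => p; rewrite !fctE mulN1r.
  by apply: Ck_mul; [exact: Ck_cst|exact: Ck_mul].
Qed.

Lemma deriv_ln f p v : differentiable f p -> 0 < f p ->
  differentiable (fun p => ln (f p)) p /\
  'D_v (fun p => ln (f p)) p = (f p)^-1 * 'D_v f p.
Proof.
move=> df fp.
have h := is_derive1_ln fp.
have [d ->] := @deriv_comp1 (@ln R) f p v (@ex_derive _ _ _ _ _ _ _ h) df.
by split=> //; rewrite derive1E (@derive_val _ _ _ _ _ _ _ h).
Qed.

Lemma deriv_exp f p v : differentiable f p ->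
  differentiable (fun p => expR (f p)) p /\
  'D_v (fun p => expR (f p)) p = expR (f p) * 'D_v f p.
Proof.
move=> df.
have h := is_derive_expR (f p).
have [d ->] := @deriv_comp1 (@expR R) f p v (@ex_derive _ _ _ _ _ _ _ h) df.
by split=> //; rewrite derive1E (@derive_val _ _ _ _ _ _ _ h).
Qed.

Lemma smth_ln f : smth f -> (forall p, 0 < f p) -> smth (fun p => ln (f p)).
Proof.
move=> sf f0; apply: (@smth_chain _ (fun p => (f p)^-1) f) => //.
- by move=> p; have [] := @deriv_ln f p 0 (@smth_diff f p sf) (f0 p).
- by move=> v; apply/funext => p; have [] := @deriv_ln f p v (@smth_diff f p sf) (f0 p).
- by move=> k _; apply: smth_inv => // p; rewrite gt_eqF.
Qed.

Lemma smth_exp f : smth f -> smth (fun p => expR (f p)).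
Proof.
move=> sf; apply: (@smth_chain _ (fun p => expR (f p)) f) => //.
- by move=> p; have [] := @deriv_exp f p 0 (@smth_diff f p sf).
- by move=> v; apply/funext => p; have [] := @deriv_exp f p v (@smth_diff f p sf).
Qed.

End Smooth.

(** * Mean value theorem along lines and symmetry of second derivatives *)

Section Lines.
Variables (R : realType) (V : normedModType R).
Implicit Types (f g : V -> R) (v w p : V) (t h : R).

Lemma is_derive_line f p v t : differentiable f (p + t *: v) ->
  is_derive t 1 (fun s : R => f (p + s *: v)) ('D_v f (p + t *: v)).
Proof.
move=> df; have dv : derivable f (p + t *: v) v by exact: diff_derivable.
have e : (fun h : R => h^-1 *: (((fun s : R => f (p + s *: v)) \o shift t) (h *: 1) - f (p + t *: v)))
       = (fun h : R => h^-1 *: ((f \o shift (p + t *: v)) (h *: v) - f (p + t *: v))).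
  by apply/funext => h /=; rewrite [h *: 1]mulr1 scalerDl addrCA.
apply: DeriveDef; first by move: dv; rewrite /derivable -e.
by rewrite /derive e.
Qed.

Lemma derive_shiftv f c v : 'D_v (fun x => f (x + c)) = fun x => 'D_v f (x + c).
Proof.
apply/funext => x; rewrite /derive.
suff -> : (fun h : R => h^-1 *: (((fun x => f (x + c)) \o shift x) (h *: v) - f (x + c)))
        = (fun h : R => h^-1 *: ((f \o shift (x + c)) (h *: v) - f (x + c))) by [].
by apply/funext => h /=; rewrite addrA.
Qed.

Lemma smth_shift f c : smth f -> smth (fun x => f (x + c)).
Proof.
move=> sf k; elim: k f sf => [|k IH] f sf;
  have d x : differentiable (fun x => f (x + c)) x by
    apply: (@differentiable_comp _ _ _ _ (fun x => x + c) f);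
    [exact: differentiableD|exact: smth_diff].
  by [].
by split=> // v; rewrite derive_shiftv; exact: (IH ('D_v f) (smthD1 v sf)).
Qed.

Lemma mvt_line f p v h : (forall p, differentiable f p) -> 0 <= h ->
  exists2 t, 0 <= t <= h & f (p + h *: v) - f p = h * 'D_v f (p + t *: v).
Proof.
move=> sf h0.
have d t : is_derive t 1 (fun s : R => f (p + s *: v)) ('D_v f (p + t *: v)).
  by apply: is_derive_line; exact: sf.
have := @MVT_segment R (fun s : R => f (p + s *: v)) (fun t => 'D_v f (p + t *: v)) 0 h h0 (fun t _ => d t).
case.
  apply: continuous_subspaceT => t; apply: differentiable_continuous; apply/derivable1_diffP.
  exact: (@ex_derive _ _ _ _ _ _ _ (d t)).
move=> t; rewrite in_itv /= scale0r addr0 subr0 mulrC => t01 e.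
by exists t.
Qed.

(* Two applications of the mean value theorem; exchanging [v] and [w] leaves the second
   difference on the left unchanged, whence the symmetry of second derivatives. *)
Lemma schwarz_quotient f p v w h : smth f -> 0 <= h ->
  exists a b, [/\ 0 <= a <= h, 0 <= b <= h &
   f (p + h *: v + h *: w) - f (p + h *: v) - (f (p + h *: w) - f p) =
   h ^+ 2 * 'D_w ('D_v f) (p + (a *: v + b *: w))].
Proof.
move=> sf h0.
pose g := (fun x => f (x + h *: w)) - f.
have sg : smth g by apply: smth_add; [exact: smth_shift|exact: smth_opp].
have [a ha e1] := mvt_line p v (fun p => smth_diff p sg) h0.
have [b hb e2] := mvt_line (p + a *: v) w (fun p => smth_diff p (smthD1 v sf)) h0.
exists a, b; split; [exact: ha|exact: hb|].
rewrite [LHS]e1 deriveB; last 2 first.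
- exact/smth_derivable/smth_shift.
- exact: smth_derivable.
have := congr1 (fun F => F (p + a *: v)) (derive_shiftv f (h *: w) v).
move=> /= ->; rewrite e2 mulrA -expr2 -(addrA p); reflexivity.
Qed.

Lemma near_both (g1 g2 : V -> R) p e : 0 < e -> continuous g1 -> continuous g2 ->
  exists2 d, 0 < d & forall z, `|z| < d ->
    `|g1 (p + z) - g1 p| < e /\ `|g2 (p + z) - g2 p| < e.
Proof.
move=> e0 c1 c2.
have c g : continuous g -> \forall x \near p, `|g p - g x| < e.
  by move=> /(_ p) /cvgrPdist_lt; apply.
have /nbhs_normP [d d0 hd] : nbhs p (fun x => `|g1 p - g1 x| < e /\ `|g2 p - g2 x| < e).
  by apply: filterS2 (c _ c1) (c _ c2) => x h1 h2; split.
exists d => // z zd; rewrite distrC [X in _ /\ X < _]distrC; apply: hd.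
by rewrite /ball_ /= opprD addNKr normrN.
Qed.

(** Replaces a passage to the limit: mean value points depend on the step in an uncontrolled way, so
    that only coincidences of values at nearby points are available. *)
Lemma eq_near_values (g1 g2 : V -> R) p : continuous g1 -> continuous g2 ->
  (forall d, 0 < d -> exists z1 z2,
     [/\ `|z1| < d, `|z2| < d & g1 (p + z1) = g2 (p + z2)]) ->
  g1 p = g2 p.
Proof.
move=> c1 c2 h; apply/eqP; rewrite -subr_eq0 -normr_le0.
apply/ler_addgt0Pl => e e0; rewrite addr0.
have [d d0 hd] := near_both p (divr_gt0 e0 (ltr0Sn R 1)) c1 c2.
have [z1 [z2 [/hd[h1 _] /hd[_ h2] e12]]] := h d d0.
move: h1 h2; rewrite e12; set x := g2 (p + _) => h1 h2.
rewrite (_ : _ - _ = (x - g2 p) - (x - g1 p)); last by ring.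
by rewrite (le_trans (ler_normB _ _)) // [e]splitr lerD // ltW.
Qed.

Lemma schwarz f v w : smth f -> 'D_w ('D_v f) = 'D_v ('D_w f).
Proof.
move=> sf; apply/funext => p.
apply: (@eq_near_values ('D_w ('D_v f)) ('D_v ('D_w f))).
- exact: smth_continuous (smthD1 w (smthD1 v sf)).
- exact: smth_continuous (smthD1 v (smthD1 w sf)).
move=> d d0.
(* With this step every [a *: v + b *: w] with [a] and [b] between 0 and [h] has norm below [d]; the
   summand 1 keeps the denominator positive. *)
pose h := d / (1 + `|v| + `|w|).
have k0 : 0 < 1 + `|v| + `|w| by rewrite -addrA ltr_pwDl // addr_ge0.
have h0 : 0 < h by rewrite divr_gt0.
have small a b : 0 <= a <= h -> 0 <= b <= h -> `|a *: v + b *: w| < d.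
  move=> /andP[a0 ah] /andP[b0 bh].
  apply: (@le_lt_trans _ _ (h * (`|v| + `|w|))).
    rewrite (le_trans (ler_normD _ _)) // !normrZ !ger0_norm //.
    by rewrite mulrDr lerD // ler_wpM2r.
  by rewrite /h mulrAC ltr_pdivrMr // ltr_pM2l // -addrA ltrDr.
have [a [b [ha hb e1]]] := schwarz_quotient p v w sf (ltW h0).
have [a' [b' [ha' hb' e2]]] := schwarz_quotient p w v sf (ltW h0).
exists (a *: v + b *: w), (a' *: w + b' *: v); split; first exact: small.
  by rewrite addrC; apply: small.
have hh : h ^+ 2 != 0 by rewrite expf_neq0 // gt_eqF.
move: e1 e2; rewrite (addrAC p (h *: w)).
move: ('D_w _ _) ('D_v _ _) => x y e1 e2; apply: (mulfI hh).
rewrite -e1 -e2; ring.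
Qed.

End Lines.

(** * The ring of smooth complex functions *)

Section CSmooth.
Variables (R : realType) (V : normedModType R).

Definition csmooth (F : V -> R[i]) :=
  smth (fun p => complex.Re (F p)) /\ smth (fun p => complex.Im (F p)).

(** As a boolean predicate closed under the ring operations it makes smooth complex functions a
    commutative ring, to which the abstract calculus of [JL] and the tactic [ring] apply. *)
Definition csmooth_pred : {pred V -> R[i]} := fun F => `[< csmooth F >].

Lemma csmoothP F : reflect (csmooth F) (F \in csmooth_pred).
Proof. exact: asboolP. Qed.

Lemma csmooth_subring : subring_closed csmooth_pred.
Proof.
split=> [|F G /csmoothP[aF bF] /csmoothP[aG bG]|F G /csmoothP[aF bF] /csmoothP[aG bG]];
  apply/csmoothP; split.
- exact: (smth_cst V 1).
- exact: (smth_cst V 0).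
- rewrite (_ : (fun p => _) = (fun p => complex.Re (F p)) + - (fun p => complex.Re (G p))).
    by apply: smth_add => //; exact: smth_opp.
  by apply/funext => p; rewrite !fctE; case: (F p) (G p) => ? ? [].
- rewrite (_ : (fun p => _) = (fun p => complex.Im (F p)) + - (fun p => complex.Im (G p))).
    by apply: smth_add => //; exact: smth_opp.
  by apply/funext => p; rewrite !fctE; case: (F p) (G p) => ? ? [].
- rewrite (_ : (fun p => _) = (fun p => complex.Re (F p)) * (fun p => complex.Re (G p))
    + - ((fun p => complex.Im (F p)) * (fun p => complex.Im (G p)))).
    by apply: smth_add; [|apply: smth_opp]; exact: smth_mul.
  by apply/funext => p; rewrite !fctE; case: (F p) (G p) => ? ? [].
- rewrite (_ : (fun p => _) = (fun p => complex.Re (F p)) * (fun p => complex.Im (G p))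
    + (fun p => complex.Im (F p)) * (fun p => complex.Re (G p))).
    by apply: smth_add; exact: smth_mul.
  by apply/funext => p; rewrite !fctE; case: (F p) (G p) => ? ? [].
Qed.

HB.instance Definition _ := GRing.isSubringClosed.Build (V -> R[i]) csmooth_pred csmooth_subring.

Record csm := Csm { cfun :> V -> R[i]; _ : cfun \in csmooth_pred }.
HB.instance Definition _ := [isSub for cfun].
HB.instance Definition _ := [Choice of csm by <:].
HB.instance Definition _ := [SubChoice_isSubComNzRing of csm by <:].

Lemma csm_smooth (F : csm) : csmooth F.
Proof. by case: F => F h; apply/csmoothP. Qed.

Lemma csm_eq (F G : csm) : (forall p, F p = G p) -> F = G.
Proof. by move=> h; apply/val_inj/funext. Qed.

Definition mkcsm F (h : csmooth F) : csm := Csm (introT (csmoothP F) h).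

Lemma csmooth_DD v (F : csm) : csmooth (fun p =>
  Complex ('D_v (fun q => complex.Re (F q)) p) ('D_v (fun q => complex.Im (F q)) p)).
Proof. by have [a b] := csm_smooth F; split; exact: smthD1. Qed.

Definition DD v F := mkcsm (csmooth_DD v F).

Lemma csmooth_conj (F : csm) : csmooth (fun p => (F p)^*%C).
Proof.
have [a b] := csm_smooth F; split.
- by rewrite (_ : (fun p => _) = (fun p => complex.Re (F p))) //; apply/funext => p; case: (F p).
- rewrite (_ : (fun p => _) = - (fun p => complex.Im (F p))); first exact: smth_opp.
  by apply/funext => p; rewrite !fctE; case: (F p).
Qed.

Definition cconj F := mkcsm (csmooth_conj F).

Definition ccst (c : R[i]) : csm :=
  @mkcsm (fun _ => c) (conj (smth_cst V (complex.Re c)) (smth_cst V (complex.Im c))).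

Lemma csmooth_real (f : V -> R) : smth f -> csmooth (fun p => (f p)%:C%C).
Proof. by move=> sf; split=> //; exact: (smth_cst V 0). Qed.

Definition creal f (sf : smth f) := mkcsm (csmooth_real sf).

Definition cRe (F : csm) (q : V) : R := complex.Re (F q).
Definition cIm (F : csm) (q : V) : R := complex.Im (F q).

Lemma DDE v F p : DD v F p = Complex ('D_v (cRe F) p) ('D_v (cIm F) p).
Proof. by []. Qed.

Lemma smth_cRe F : smth (cRe F). Proof. by have [] := csm_smooth F. Qed.
Lemma smth_cIm F : smth (cIm F). Proof. by have [] := csm_smooth F. Qed.

Lemma cReB F G : cRe (F - G) = cRe F - cRe G.
Proof.
apply/funext => q; rewrite /cRe !fctE [(F - G) q]/(F q - G q).
by case: (F q) (G q) => ? ? [].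
Qed.

Lemma cImB F G : cIm (F - G) = cIm F - cIm G.
Proof.
apply/funext => q; rewrite /cIm !fctE [(F - G) q]/(F q - G q).
by case: (F q) (G q) => ? ? [].
Qed.

Lemma cReM F G : cRe (F * G) = cRe F * cRe G - cIm F * cIm G.
Proof.
apply/funext => q; rewrite /cRe /cIm !fctE [(F * G) q]/(F q * G q).
by case: (F q) (G q) => ? ? [].
Qed.

Lemma cImM F G : cIm (F * G) = cRe F * cIm G + cIm F * cRe G.
Proof.
apply/funext => q; rewrite /cRe /cIm !fctE [(F * G) q]/(F q * G q).
by case: (F q) (G q) => ? ? [].
Qed.

Lemma DD_is_additive v : additive (DD v).
Proof.
have d f p : smth f -> derivable f p v by exact: smth_derivable.
move=> F G; apply: csm_eq => p; rewrite [RHS]/(DD v F p - DD v G p) !DDE.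
rewrite cReB cImB (deriveB (d _ _ (smth_cRe F)) (d _ _ (smth_cRe G))).
by rewrite (deriveB (d _ _ (smth_cIm F)) (d _ _ (smth_cIm G))).
Qed.
HB.instance Definition _ v := GRing.isAdditive.Build csm csm (DD v) (DD_is_additive v).

Lemma DDM v F G : DD v (F * G) = DD v F * G + F * DD v G.
Proof.
apply: csm_eq => p.
have [aF bF] := csm_smooth F; have [aG bG] := csm_smooth G.
have d f : smth f -> derivable f p v by exact: smth_derivable.
rewrite [RHS]/(DD v F p * G p + F p * DD v G p) !DDE cReM cImM.
rewrite (deriveB (d _ (smth_mul aF aG)) (d _ (smth_mul bF bG))).
rewrite (deriveD (d _ (smth_mul aF bG)) (d _ (smth_mul bF aG))).
rewrite (deriveM (d _ aF) (d _ aG)) (deriveM (d _ bF) (d _ bG)).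
rewrite (deriveM (d _ aF) (d _ bG)) (deriveM (d _ bF) (d _ aG)).
rewrite /cRe /cIm; move: ('D_v _ p) ('D_v _ p) ('D_v _ p) ('D_v _ p) => x y z t.
case: (F p) (G p) => a b [c e].
have sE (k r : R) : k *: r = k * r by [].
by apply/eqP; rewrite eq_complex /= !sE; apply/andP; split; apply/eqP; ring.
Qed.

Lemma cRe_DD v F : cRe (DD v F) = 'D_v (cRe F).
Proof. by []. Qed.
Lemma cIm_DD v F : cIm (DD v F) = 'D_v (cIm F).
Proof. by []. Qed.

Lemma csm_eqRI F G : cRe F = cRe G -> cIm F = cIm G -> F = G.
Proof.
move=> eR eI; apply: csm_eq => p; apply/eqP; rewrite eq_complex.
by rewrite -!/(cRe _ p) -!/(cIm _ p) eR eI !eqxx.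
Qed.

Lemma DD_comm v w F : DD v (DD w F) = DD w (DD v F).
Proof.
apply: csm_eqRI.
- by rewrite !cRe_DD; exact: schwarz (smth_cRe F).
- by rewrite !cIm_DD; exact: schwarz (smth_cIm F).
Qed.

Lemma DD_ccst v c : DD v (ccst c) = 0.
Proof. by apply: csm_eq => p /=; rewrite !derive_cst. Qed.

Lemma cconj_DD v F : cconj (DD v F) = DD v (cconj F).
Proof.
have [aF bF] := csm_smooth F.
apply: csm_eq => p /=.
have ReJ : (fun q => complex.Re (F q)^*%C) = (fun q => complex.Re (F q)).
  by apply/funext => q; case: (F q).
have ImJ : (fun q => complex.Im (F q)^*%C) = - (fun q => complex.Im (F q)).
  by apply/funext => q; rewrite !fctE; case: (F q).
rewrite ReJ ImJ deriveN //; exact: smth_derivable.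
Qed.

Lemma cconj_is_additive : additive cconj.
Proof. by move=> F G; apply: csm_eq => p; exact: (rmorphB _ (F p) (G p)). Qed.
HB.instance Definition _ := GRing.isAdditive.Build csm csm cconj cconj_is_additive.
Lemma cconj_is_multiplicative : multiplicative cconj.
Proof.
split=> [F G|]; apply: csm_eq => p; first exact: (rmorphM _ (F p) (G p)).
exact: rmorph1.
Qed.
HB.instance Definition _ := GRing.isMultiplicative.Build csm csm cconj cconj_is_multiplicative.

Lemma ccst_is_additive : additive ccst.
Proof. by move=> F G; apply: csm_eq. Qed.
HB.instance Definition _ := GRing.isAdditive.Build R[i] csm ccst ccst_is_additive.
Lemma ccst_is_multiplicative : multiplicative ccst.
Proof. by split=> [F G|]; apply: csm_eq. Qed.
HB.instance Definition _ := GRing.isMultiplicative.Build R[i] csm ccst ccst_is_multiplicative.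

Lemma cconjK F : cconj (cconj F) = F.
Proof. by apply: csm_eq => p /=; rewrite conjcK. Qed.

Lemma cconj_ccst c : cconj (ccst c) = ccst (c^*)%C.
Proof. exact: csm_eq. Qed.

Lemma cconj_creal f (sf : smth f) : cconj (creal sf) = creal sf.
Proof. by apply: csm_eq => p; exact: conjc_real. Qed.

Lemma csm_sumE I (r : seq I) P (F : I -> csm) p :
  (\sum_(i <- r | P i) F i) p = \sum_(i <- r | P i) F i p.
Proof.
elim/big_rec2: _ => // i x y _ e.
by rewrite -e.
Qed.

Lemma DD_creal v f (sf : smth f) : DD v (creal sf) = creal (smthD1 v sf).
Proof. by apply: csm_eq => p /=; rewrite derive_cst. Qed.

End CSmooth.

(** * The Jerison-Lee identity *)

(* Only the commutation relations of the Z_a, Zbar_a and d_t are used, so that all identities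
   live in a commutative ring with additive derivations, where [ring] applies. *)
Module JL.

Section JerisonLee.
Variables (A : comNzRingType) (n : nat).
Variables (Z Zb : 'I_n -> {additive A -> A}) (T : {additive A -> A}).
Variables (cj : {rmorphism A -> A}) (ii : A).
Hypothesis ZM : forall a x y, Z a (x * y) = Z a x * y + x * Z a y.
Hypothesis ZbM : forall a x y, Zb a (x * y) = Zb a x * y + x * Zb a y.
Hypothesis TM : forall x y, T (x * y) = T x * y + x * T y.
Hypothesis ii2 : ii * ii = -1.
Hypothesis cj_ii : cj ii = - ii.
Hypothesis Zii : forall a, Z a ii = 0.
Hypothesis Zbii : forall a, Zb a ii = 0.
Hypothesis cjK : forall x, cj (cj x) = x.
Hypothesis cjZ : forall a x, cj (Z a x) = Zb a (cj x).
Hypothesis cjT : forall x, cj (T x) = T (cj x).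
Hypothesis ZZ : forall a b x, Z a (Z b x) = Z b (Z a x).
Hypothesis ZT : forall a x, Z a (T x) = T (Z a x).
Hypothesis ZZb : forall a b x,
  Z a (Zb b x) = Zb b (Z a x) - (a == b)%:R * (2 * ii * T x).
Variables (f v : A).
Hypothesis cj_f : cj f = f.
Hypothesis cj_v : cj v = v.
Hypothesis Zv : forall a, Z a v = v * Z a f.
Hypothesis Tv : T v = v * T f.

Local Notation N := (n%:R : A).
Definition fa a := Z a f.
Definition fb a := Zb a f.
Definition f0 := T f.
Definition P := v * v.
Definition q := \sum_a fa a * fb a.
Definition g := q + P - ii * f0.
Definition gb := q + P + ii * f0.

Hypothesis feq : \sum_a Zb a (fa a) = - (N * g).

Definition Dm a b := Z b (fa a) - 2 * fa a * fa b.
Definition Em a b := Zb b (fa a) + (a == b)%:R * g.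
Definition Dv a := \sum_b Dm a b * fb b.
Definition Ev a := \sum_b Em a b * fa b.
Definition Gv a := ii * T (fa a) + g * fa a.
Definition Vv a := Dv a + Ev a + Gv a.

Lemma faE a : fa a = Z a f. Proof. by []. Qed.
Lemma fbE a : fb a = Zb a f. Proof. by []. Qed.
Lemma f0E : f0 = T f. Proof. by []. Qed.
Lemma PE : P = v * v. Proof. by []. Qed.
Lemma qE : q = \sum_a fa a * fb a. Proof. by []. Qed.
Lemma gE : g = q + P - ii * f0. Proof. by []. Qed.
Lemma gbE : gb = q + P + ii * f0. Proof. by []. Qed.
Lemma DmE a b : Dm a b = Z b (fa a) - 2 * fa a * fa b. Proof. by []. Qed.
Lemma EmE a b : Em a b = Zb b (fa a) + (a == b)%:R * g. Proof. by []. Qed.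
Lemma DvE a : Dv a = \sum_b Dm a b * fb b. Proof. by []. Qed.
Lemma EvE a : Ev a = \sum_b Em a b * fa b. Proof. by []. Qed.
Lemma GvE a : Gv a = ii * T (fa a) + g * fa a. Proof. by []. Qed.
Lemma VvE a : Vv a = Dv a + Ev a + Gv a. Proof. by []. Qed.
(* Unfolding these definitions during unification makes rewriting diverge. *)
Local Opaque fa fb f0 P q g gb Dm Em Dv Ev Gv Vv.

Lemma delta_sum a (x : 'I_n -> A) : \sum_b (a == b)%:R * x b = x a.
Proof.
rewrite (bigD1 a) //= eqxx mul1r big1 ?addr0 // => b; rewrite eq_sym => /negPf ->.
by rewrite mul0r.
Qed.

Lemma delta_sumr a (x : 'I_n -> A) : \sum_b (b == a)%:R * x b = x a.
Proof. by rewrite -(delta_sum a x); apply: eq_bigr => b _; rewrite eq_sym. Qed.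

Lemma cj_sum (x : 'I_n -> A) : cj (\sum_a x a) = \sum_a cj (x a).
Proof. exact: raddf_sum. Qed.

Lemma cj_delta (a b : 'I_n) : cj (a == b)%:R = (a == b)%:R.
Proof. exact: rmorph_nat. Qed.

Lemma cjZb a x : cj (Zb a x) = Z a (cj x).
Proof. by rewrite -{1}(cjK x) -cjZ cjK. Qed.

Lemma cj_fa a : cj (fa a) = fb a.
Proof. by rewrite faE cjZ cj_f. Qed.
Lemma cj_fb a : cj (fb a) = fa a.
Proof. by rewrite fbE cjZb cj_f. Qed.
Lemma cj_f0 : cj f0 = f0.
Proof. by rewrite f0E cjT cj_f. Qed.
Lemma cj_P : cj P = P.
Proof. by rewrite PE rmorphM cj_v. Qed.
Lemma cj_q : cj q = q.
Proof.
by rewrite qE cj_sum; apply: eq_bigr => a _; rewrite rmorphM cj_fa cj_fb mulrC.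
Qed.
Lemma cj_g : cj g = gb.
Proof. by rewrite gE gbE rmorphB rmorphD [cj (ii * _)]rmorphM cj_q cj_P cj_ii cj_f0; ring. Qed.
Lemma cj_gb : cj gb = g.
Proof. by rewrite -cj_g cjK. Qed.

Lemma Znat a k : Z a k%:R = 0.
Proof.
have h : Z a 1 = 0.
  by have /eqP := ZM a 1 1; rewrite !mulr1 mul1r -subr_eq0 opprD addNKr oppr_eq0 => /eqP.
by rewrite raddfMn /= h mul0rn.
Qed.
Lemma Zbnat a k : Zb a k%:R = 0.
Proof. by rewrite -(rmorph_nat cj) -cjZ Znat rmorph0. Qed.

Lemma Zb_fa a b : Zb b (fa a) = Em a b - (a == b)%:R * g.
Proof. by rewrite EmE addrK. Qed.

(** The commutator contributes [2 i f_0], which is [gb - g]: the imaginary part of [g] is chosen so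
    that one tensor [Em] serves both orders of differentiation. *)
Lemma Z_fb a b : Z a (fb b) = Em a b - (a == b)%:R * gb.
Proof.
rewrite fbE ZZb -faE Zb_fa gbE gE -f0E; ring.
Qed.

Lemma Z_fa a b : Z b (fa a) = Dm a b + 2 * fa a * fa b.
Proof. by rewrite DmE subrK. Qed.

Lemma Dm_sym a b : Dm a b = Dm b a.
Proof. by rewrite !DmE !faE ZZ; ring. Qed.

Lemma Em_herm a b : cj (Em a b) = Em b a.
Proof.
rewrite EmE rmorphD rmorphM cj_g cj_delta cjZb cj_fa Z_fb (eq_sym b a) !EmE (eq_sym b a).
ring.
Qed.

Lemma Em_tr : \sum_a Em a a = 0.
Proof.
under eq_bigr => a _ do rewrite EmE eqxx mul1r.
rewrite big_split /= feq.
by rewrite sumr_const card_ord mulr_natl addNr.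
Qed.

Lemma iT_fa a : ii * T (fa a) = Gv a - g * fa a.
Proof. by rewrite GvE addrK. Qed.

Lemma Z_P a : Z a P = 2 * P * fa a.
Proof. by rewrite PE ZM Zv -faE; ring. Qed.

Lemma Z_q a : Z a q = Dv a + Ev a + (2 * q - gb) * fa a.
Proof.
rewrite qE raddf_sum mulrBl.
have -> : gb * fa a = \sum_b (a == b)%:R * (gb * fa b) by rewrite delta_sum.
rewrite DvE EvE mulr_sumr mulr_suml addrA -!big_split /= -sumrB; apply: eq_bigr => b _.
rewrite ZM Z_fa Z_fb Dm_sym; ring.
Qed.

Lemma Z_if0 a : Z a (ii * f0) = Gv a - g * fa a.
Proof. by rewrite ZM Zii mul0r add0r f0E ZT iT_fa. Qed.

Lemma Z_g a : Z a g = Dv a + Ev a - Gv a + 2 * g * fa a.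
Proof. by rewrite {1}gE raddfB raddfD /= Z_q Z_P Z_if0 gbE gE; ring. Qed.

(** In contrast with [Z_g], the multiples of [fa a] cancel. By conjugation [Zb a g] vanishes with
    the tensors, so that [g] then becomes a CR function. *)
Lemma Z_gb a : Z a gb = Vv a.
Proof. by rewrite {1}gbE !raddfD /= Z_q Z_P Z_if0 VvE gbE gE; ring. Qed.

Lemma cj2 : cj 2 = 2.
Proof. exact: rmorph_nat. Qed.

Lemma Zb_g a : Zb a g = cj (Vv a).
Proof. by rewrite -Z_gb cjZ cj_gb. Qed.

Lemma Zb_q a : Zb a q = cj (Dv a) + cj (Ev a) + (2 * q - g) * fb a.
Proof.
by rewrite -{1}cj_q -cjZ Z_q rmorphD rmorphD rmorphM rmorphB rmorphM cj2 cj_q cj_gb cj_fa.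
Qed.

Lemma Zb_if0 a : Zb a (ii * f0) = - cj (Gv a) + gb * fb a.
Proof.
have -> : ii * f0 = - cj (ii * f0) by rewrite rmorphM cj_ii cj_f0; ring.
by rewrite raddfN /= -cjZ Z_if0 rmorphB rmorphM cj_g cj_fa; ring.
Qed.

Lemma Zb_gb a : Zb a gb = cj (Dv a) + cj (Ev a) - cj (Gv a) + 2 * gb * fb a.
Proof.
by rewrite -{1}cj_g -cjZ Z_g rmorphD rmorphB rmorphD rmorphM rmorphM cj2 cj_g cj_fa.
Qed.

Lemma Zb_Z a b x : Zb b (Z a x) = Z a (Zb b x) + (a == b)%:R * (2 * ii * T x).
Proof. by rewrite ZZb subrK. Qed.

Lemma Zdelta c (a b : 'I_n) x : Z c ((a == b)%:R * x) = (a == b)%:R * Z c x.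
Proof. by rewrite ZM Znat mul0r add0r. Qed.

(** Commuting [Zb c] past [Z b] produces [i T (fa a)]; expressing this derivative is the role of the
    third tensor [Gv]. *)
Lemma Zb_Dm a b c : Zb c (Dm a b) = Z b (Em a c)
  - (a == c)%:R * (Dv b + Ev b - Gv b) + (b == c)%:R * (2 * Gv a)
  - 2 * Em a c * fa b - 2 * fa a * Em b c.
Proof.
rewrite DmE raddfB /= !ZbM Zbnat Zb_Z !Zb_fa raddfB /= Zdelta Z_g.
have -> : 2 * ii * T (fa a) = 2 * (Gv a - g * fa a) by rewrite -iT_fa; ring.
ring.
Qed.

(** [Dm] is symmetric, so the two expressions that [Zb_Dm] gives for its derivative agree. The trace
    of the resulting Codazzi equation is the divergence of the trace-free tensor [Em]. *)
Lemma Em_codazzi a b c : Z b (Em a c) - Z a (Em b c) =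
  (a == c)%:R * Vv b - (b == c)%:R * Vv a.
Proof.
have e : Zb c (Dm a b) = Zb c (Dm b a) by rewrite Dm_sym.
rewrite !Zb_Dm in e; rewrite !VvE.
apply/eqP; rewrite -subr_eq0; move/eqP: e; rewrite -subr_eq0 => /eqP e.
by apply/eqP; rewrite -e; ring.
Qed.

Lemma div_Em b : \sum_a Z a (Em b a) = Vv b - N * Vv b.
Proof.
have e : \sum_a (Z b (Em a a) - Z a (Em b a)) = \sum_a ((a == a)%:R * Vv b - (b == a)%:R * Vv a).
  by apply: eq_bigr => a _; rewrite Em_codazzi.
move: e; rewrite !sumrB -raddf_sum Em_tr raddf0 delta_sum.
under [X in _ = X - _]eq_bigr => a _ do rewrite eqxx mul1r.
rewrite sumr_const card_ord -mulr_natl sub0r => e.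
by rewrite -[LHS]opprK e; ring.
Qed.

Lemma div_Emb b : \sum_a Zb a (Em a b) = cj (Vv b) - N * cj (Vv b).
Proof.
have -> : cj (Vv b) - N * cj (Vv b) = cj (Vv b - N * Vv b).
  by rewrite rmorphB rmorphM rmorph_nat.
by rewrite -div_Em cj_sum; apply: eq_bigr => a _; rewrite cjZ Em_herm.
Qed.

Lemma div_Dm a : \sum_b Zb b (Dm a b) = - (N * Dv a) - (N + 2) * (Ev a - Gv a).
Proof.
under eq_bigr => b _ do rewrite Zb_Dm eqxx mul1r.
rewrite !sumrB big_split /= sumrB div_Em delta_sum sumr_const card_ord -mulr_natl.
rewrite -mulr_sumr Em_tr mulr0 subr0.
have -> : \sum_b 2 * Em a b * fa b = 2 * Ev a.
  by rewrite EvE mulr_sumr; apply: eq_bigr => b _; rewrite mulrA.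
rewrite VvE; ring.
Qed.

(** * Divergences of the contracted tensors *)

Definition ND := \sum_a \sum_b Dm a b * cj (Dm a b).
Definition NE := \sum_a \sum_b Em a b * cj (Em a b).
Definition dd := \sum_a Dv a * fb a.
Definition ee := \sum_a Ev a * fb a.
Definition cc := \sum_a Gv a * fb a.

Lemma Zb_fb a b : Zb a (fb b) = cj (Dm a b) + 2 * fb a * fb b.
Proof. by rewrite -cj_fa -cjZ Z_fa Dm_sym rmorphD rmorphM rmorphM cj2 !cj_fa; ring. Qed.

Lemma div_Dv : \sum_a Zb a (Dv a) =
  ND - (N - 2) * dd - (N + 2) * (ee - cc).
Proof.
have -> : \sum_a Zb a (Dv a) = \sum_b (\sum_a Zb a (Dm b a)) * fb b +
   \sum_a \sum_b Dm a b * Zb a (fb b).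
  under [X in X + _]eq_bigr => b _ do rewrite mulr_suml.
  rewrite exchange_big /= -big_split /=; apply: eq_bigr => a _.
  rewrite raddf_sum -big_split /=; apply: eq_bigr => b _.
  by rewrite ZbM Dm_sym.
under eq_bigr => b _ do rewrite div_Dm.
have -> : \sum_a \sum_b Dm a b * Zb a (fb b) = ND + 2 * dd.
  rewrite /ND /dd mulr_sumr -big_split /=; apply: eq_bigr => a _.
  rewrite DvE mulr_suml mulr_sumr -big_split /=; apply: eq_bigr => b _.
  rewrite Zb_fb; ring.
have -> : \sum_b (- (N * Dv b) - (N + 2) * (Ev b - Gv b)) * fb b =
  - (N * dd) - (N + 2) * (ee - cc).
  rewrite /dd /ee /cc -sumrB !mulr_sumr -sumrN -sumrB; apply: eq_bigr => b _; ring.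
ring.
Qed.

Definition vf := \sum_a cj (Vv a) * fa a.

Lemma div_Ev : \sum_a Zb a (Ev a) = vf - N * vf + NE.
Proof.
have -> : \sum_a Zb a (Ev a) = \sum_b (\sum_a Zb a (Em a b)) * fa b +
   \sum_a \sum_b Em a b * Zb a (fa b).
  under [X in X + _]eq_bigr => b _ do rewrite mulr_suml.
  rewrite exchange_big /= -big_split /=; apply: eq_bigr => a _.
  rewrite raddf_sum -big_split /=; apply: eq_bigr => b _.
  by rewrite ZbM.
under eq_bigr => b _ do rewrite div_Emb.
congr (_ + _).
  rewrite /vf mulr_sumr -sumrB; apply: eq_bigr => b _; ring.
transitivity (NE - g * \sum_a Em a a); last by rewrite Em_tr mulr0 subr0.
rewrite /NE mulr_sumr -sumrB; apply: eq_bigr => a _.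
rewrite -[X in _ = _ - X](delta_sumr a (fun b => g * Em a b)) -sumrB.
apply: eq_bigr => b _; rewrite Zb_fa Em_herm; ring.
Qed.

Lemma iT_q : ii * T q = cc - cj cc + (gb - g) * q.
Proof.
rewrite qE /cc cj_sum -sumrB raddf_sum !mulr_sumr -big_split /=.
apply: eq_bigr => a _; rewrite TM mulrDr mulrA iT_fa.
have -> : ii * (fa a * T (fb a)) = fa a * (ii * T (fb a)) by ring.
have -> : ii * T (fb a) = - cj (Gv a) + gb * fb a.
  rewrite -(cj_fa a) -cjT.
  have -> : ii * cj (T (fa a)) = - cj (ii * T (fa a)) by rewrite rmorphM cj_ii; ring.
  by rewrite iT_fa rmorphB rmorphM cj_g; ring.
rewrite rmorphM cj_fb; ring.
Qed.

Definition divG := \sum_a Zb a (Gv a).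

Lemma T_nat k : T k%:R = 0.
Proof.
have h : T 1 = 0.
  by have /eqP := TM 1 1; rewrite !mulr1 mul1r -subr_eq0 opprD addNKr oppr_eq0 => /eqP.
by rewrite raddfMn /= h mul0rn.
Qed.

Lemma ZbT a x : Zb a (T x) = T (Zb a x).
Proof. by rewrite -{1}(cjK x) -cjT -cjZ ZT cjT cjZ cjK. Qed.

(** [divG] contains [T f0], a second derivative outside the three tensors. It cancels in the
    difference with the conjugate, because [i T g + i T gb = 2 i T (q + P)]. The difference is
    enough: [Gv] enters [XJ] with the purely imaginary factor [h]. *)
Lemma div_Gv : divG - cj divG = - (2 * N * (cc - cj cc)) + (vf - cj vf).
Proof.
have eG : divG = - (N * (ii * T g)) + vf - N * (g * g).
  transitivity (\sum_a (ii * T (Zb a (fa a)) + (cj (Vv a) * fa a + g * Zb a (fa a)))).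
    apply: eq_bigr => a _; rewrite GvE raddfD /= !ZbM Zbii mul0r add0r Zb_g.
    by rewrite ZbT.
  rewrite !big_split /= -!mulr_sumr -raddf_sum feq raddfN /= TM T_nat /vf; ring.
have eGb : cj divG = N * (ii * T gb) + cj vf - N * (gb * gb).
  rewrite eG rmorphB rmorphD rmorphN !rmorphM rmorph_nat cj_ii cjT cj_g; ring.
rewrite eGb eG.
have e : ii * T g + ii * T gb = 2 * (cc - cj cc + (gb - g) * q + (gb - g) * P).
  rewrite -iT_q gE gbE !(raddfB, raddfD) /= [T P]TM Tv -f0E PE; ring.
have -> : - (N * (ii * T g)) + vf - N * (g * g) - (N * (ii * T gb) + cj vf - N * (gb * gb))
  = - (N * (ii * T g + ii * T gb)) + (vf - cj vf) - N * (g * g - gb * gb) by ring.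
rewrite e gE gbE; ring.
Qed.

Lemma Zb_v a : Zb a v = v * fb a.
Proof. by rewrite -{1}cj_v -cjZ Zv rmorphM cj_v -faE cj_fa. Qed.

Lemma Zb_vX a j : Zb a (v ^+ j) = j%:R * v ^+ j * fb a.
Proof.
elim: j => [|j IH]; first by rewrite expr0 -[1]/(1%:R) Zbnat; ring.
by rewrite exprS ZbM IH Zb_v -[j.+1]addn1 natrD; ring.
Qed.

Lemma div_vf j : \sum_a Zb a (v ^+ j * fa a) = v ^+ j * (j%:R * q - N * g).
Proof.
transitivity (\sum_a v ^+ j * (j%:R * (fa a * fb a) + Zb a (fa a))).
  apply: eq_bigr => a _; rewrite ZbM Zb_vX; ring.
by rewrite -mulr_sumr big_split /= -mulr_sumr -qE feq.
Qed.

Lemma cj_dotfb (x : 'I_n -> A) : cj (\sum_a x a * fb a) = \sum_a cj (x a) * fa a.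
Proof. by rewrite cj_sum; apply: eq_bigr => a _; rewrite rmorphM cj_fb. Qed.

Lemma div_vqf j : \sum_a Zb a (v ^+ j * q * fa a) =
  v ^+ j * (j%:R * q * q + cj dd + cj ee + (2 * q - g) * q - N * q * g).
Proof.
transitivity (\sum_a (v ^+ j * (j%:R * q * (fa a * fb a) + cj (Dv a) * fa a + cj (Ev a) * fa a + (2 * q - g) * (fa a * fb a) + q * Zb a (fa a)))).
  apply: eq_bigr => a _; rewrite !ZbM Zb_vX Zb_q; ring.
rewrite -mulr_sumr !big_split /= -!mulr_sumr -qE feq /dd /ee !cj_dotfb; ring.
Qed.

Lemma div_vgf j : \sum_a Zb a (v ^+ j * gb * fa a) =
  v ^+ j * (j%:R * q * gb + cj dd + cj ee - cj cc
            + 2 * gb * q - N * g * gb).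
Proof.
transitivity (\sum_a (v ^+ j * (j%:R * gb * (fa a * fb a) + cj (Dv a) * fa a + cj (Ev a) * fa a - cj (Gv a) * fa a + 2 * gb * (fa a * fb a) + gb * Zb a (fa a)))).
  apply: eq_bigr => a _; rewrite !ZbM Zb_vX Zb_gb; ring.
rewrite -mulr_sumr !big_split /= sumrN -!mulr_sumr -qE feq /dd /ee /cc !cj_dotfb; ring.
Qed.

Definition h := ii * f0.

Lemma hE : h = ii * f0. Proof. by []. Qed.
Lemma Zb_h a : Zb a h = - cj (Gv a) + gb * fb a.
Proof. exact: Zb_if0. Qed.
Local Opaque h.

Lemma cj_h : cj h = - h.
Proof. by rewrite hE rmorphM cj_ii cj_f0; ring. Qed.

(* The Jerison-Lee vector field; [h] is [i f_0], so [gb + h = q + P + 2 i f_0]. *)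
Definition XJ a := (gb + h) * Ev a + (g - h) * Dv a - 3 * h * Gv a.
Definition sp (x y : 'I_n -> A) := \sum_a x a * cj (y a).

Lemma cj_sp x y : cj (sp x y) = sp y x.
Proof. by rewrite /sp cj_sum; apply: eq_bigr => a _; rewrite rmorphM cjK mulrC. Qed.

Lemma cj_ee : cj ee = ee.
Proof.
rewrite /ee cj_sum; under eq_bigr => a _ do rewrite EvE rmorphM cj_fb cj_sum mulr_suml.
rewrite exchange_big /=; apply: eq_bigr => a _.
rewrite EvE mulr_suml; apply: eq_bigr => b _; rewrite rmorphM Em_herm cj_fa; ring.
Qed.

Lemma cj_ND : cj ND = ND.
Proof.
rewrite /ND cj_sum; apply: eq_bigr => a _; rewrite cj_sum; apply: eq_bigr => b _.
by rewrite rmorphM cjK mulrC.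
Qed.

Lemma cj_NE : cj NE = NE.
Proof.
rewrite /NE cj_sum; apply: eq_bigr => a _; rewrite cj_sum; apply: eq_bigr => b _.
by rewrite rmorphM cjK mulrC.
Qed.

Lemma vf_cj : vf = cj dd + ee + cj cc.
Proof.
rewrite /vf -cj_ee /dd /ee /cc !cj_sum -!big_split /=; apply: eq_bigr => a _.
rewrite VvE rmorphD rmorphD ![cj (_ * fb a)]rmorphM cj_fb; ring.
Qed.

Lemma div_XJ j : \sum_a Zb a (v ^+ j * XJ a) = v ^+ j *
  (j%:R * ((gb + h) * ee + (g - h) * dd - 3 * h * cc)
   + (sp Ev Dv + sp Ev Ev - 2 * sp Ev Gv) + 3 * gb * ee
   + (sp Dv Dv + sp Dv Ev + 2 * sp Dv Gv) - gb * dd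
   + 3 * sp Gv Gv - 3 * gb * cc
   + (gb + h) * (vf - N * vf + NE)
   + (g - h) * (ND - (N - 2) * dd - (N + 2) * (ee - cc)) - 3 * h * divG).
Proof.
rewrite -div_Ev -div_Dv /divG.
transitivity (\sum_a (v ^+ j *
  (j%:R * ((gb + h) * (Ev a * fb a) + (g - h) * (Dv a * fb a) - 3 * h * (Gv a * fb a))
   + (Ev a * cj (Dv a) + Ev a * cj (Ev a) - 2 * (Ev a * cj (Gv a))) + 3 * gb * (Ev a * fb a)
   + (Dv a * cj (Dv a) + Dv a * cj (Ev a) + 2 * (Dv a * cj (Gv a))) - gb * (Dv a * fb a)
   + 3 * (Gv a * cj (Gv a)) - 3 * gb * (Gv a * fb a)
   + (gb + h) * Zb a (Ev a) + (g - h) * Zb a (Dv a) - 3 * h * Zb a (Gv a)))).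
  apply: eq_bigr => a _.
  rewrite /XJ ZbM Zb_vX raddfB raddfD /= [Zb a (_ * Ev a)]ZbM [Zb a (_ * Dv a)]ZbM.
  rewrite [Zb a (_ * Gv a)]ZbM [Zb a (3 * _)]ZbM Zbnat raddfD raddfB /= Zb_g Zb_gb.
  rewrite Zb_h VvE rmorphD rmorphD; ring.
rewrite -mulr_sumr !(big_split, sumrN) /= -!mulr_sumr !(big_split, sumrN) /=.
by rewrite -!mulr_sumr.
Qed.

Definition Tabc a b c := Dm a b * fb c + Em a c * fa b.

(** Read from right to left: the cross terms of [Dv] and [Ev] left over in the divergence of [XJ]
    complete [q * (ND + NE)] to a sum of squares. *)
Lemma sum_Tabc : \sum_a \sum_b \sum_c Tabc a b c * cj (Tabc a b c) =
  q * (ND + NE) + sp Dv Ev + sp Ev Dv.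
Proof.
transitivity (\sum_a ((\sum_b Dm a b * cj (Dm a b)) * q + (\sum_c Em a c * cj (Em a c)) * q
   + Dv a * cj (Ev a) + Ev a * cj (Dv a))).
  apply: eq_bigr => a _.
  have -> : \sum_b \sum_c Tabc a b c * cj (Tabc a b c) =
    \sum_b \sum_c ((Dm a b * cj (Dm a b)) * (fa c * fb c) + (Em a c * cj (Em a c)) * (fa b * fb b)
     + (Dm a b * fb b) * (fb c * cj (Em a c)) + (cj (Dm a b) * fa b) * (fa c * Em a c)).
    apply: eq_bigr => b _; apply: eq_bigr => c _.
    rewrite /Tabc rmorphD [cj (Dm a b * _)]rmorphM [cj (Em a c * _)]rmorphM cj_fb cj_fa; ring.
  under eq_bigr => b _ do rewrite !big_split /= -!mulr_sumr -mulr_suml -qE.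
  rewrite !big_split /= -!mulr_suml -!mulr_sumr -qE.
  have eE : \sum_b fa b * Em a b = Ev a by rewrite EvE; apply: eq_bigr => b _; rewrite mulrC.
  have eEc : \sum_b fb b * cj (Em a b) = cj (Ev a).
    by rewrite -eE cj_sum; apply: eq_bigr => b _; rewrite rmorphM cj_fa.
  have eDc : \sum_b cj (Dm a b) * fa b = cj (Dv a) by rewrite DvE cj_dotfb.
  by rewrite eE eEc eDc -DvE [cj (Dv a) * _]mulrC.
rewrite !big_split /= -!mulr_suml /ND /NE /sp; ring.
Qed.

(** The exponent is forced: once the conjugate is added, every term linear in [dd], [ee] or [cc]
    carries the factor [j - 2 (N - 1)]. What remains is quadratic in the tensors, and [ND] and [NE]
    both get the coefficient [q + P], the common real part of [g - h] and [gb + h]. *)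
Lemma jerison_lee j : (j%:R = 2 * (N - 1) :> A) ->
  \sum_a Zb a (v ^+ j * XJ a) + cj (\sum_a Zb a (v ^+ j * XJ a)) =
  2 * v ^+ j * (\sum_a ((Gv a + Dv a) * cj (Gv a + Dv a) + (Gv a - Ev a) * cj (Gv a - Ev a)
     + Gv a * cj (Gv a)) + P * (ND + NE)
     + \sum_a \sum_b \sum_c Tabc a b c * cj (Tabc a b c)).
Proof.
move=> jN; rewrite sum_Tabc div_XJ jN.
have -> : \sum_a ((Gv a + Dv a) * cj (Gv a + Dv a) + (Gv a - Ev a) * cj (Gv a - Ev a)
     + Gv a * cj (Gv a)) = 3 * sp Gv Gv + sp Dv Dv + sp Ev Ev + sp Gv Dv + sp Dv Gv - sp Gv Ev - sp Ev Gv.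
  rewrite /sp mulr_sumr -!big_split /= -!sumrB; apply: eq_bigr => a _.
  rewrite rmorphD rmorphB; ring.
have eG := div_Gv; have cv : cj (v ^+ j) = v ^+ j by rewrite rmorphXn cj_v.
have eGc : cj divG = divG + 2 * N * (cc - cj cc) - (vf - cj vf).
  have -> : cj divG = divG - (divG - cj divG) by ring.
  rewrite eG; ring.
rewrite [cj (v ^+ j * _)]rmorphM cv.
set Y := (X in v ^+ j * X + _).
have cY : cj Y = (2 * (N - 1)) * ((g - h) * ee + (gb + h) * cj dd + 3 * h * cj cc)
   + (sp Dv Ev + sp Ev Ev - 2 * sp Gv Ev) + 3 * g * ee
   + (sp Dv Dv + sp Ev Dv + 2 * sp Gv Dv) - g * cj dd
   + 3 * sp Gv Gv - 3 * g * cj cc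
   + (g - h) * (cj vf - N * cj vf + NE)
   + (gb + h) * (ND - (N - 2) * cj dd - (N + 2) * (ee - cj cc)) + 3 * h * cj divG.
  have cN : cj N = N by exact: rmorph_nat.
  have c1 : cj 1 = 1 by exact: rmorph1.
  have c3 : cj 3 = 3 by exact: rmorph_nat.
  have cD x y : cj (x + y) = cj x + cj y by exact: rmorphD.
  have cB x y : cj (x - y) = cj x - cj y by exact: rmorphB.
  have cO x : cj (- x) = - cj x by exact: rmorphN.
  have cM x y : cj (x * y) = cj x * cj y by exact: rmorphM.
  rewrite /Y; clear Y.
  rewrite !(cN, c1, cj2, c3, cj_ee, cj_ND, cj_NE, cj_g, cj_gb, cj_h, cj_sp, cB, cD, cO, cM).
  ring.
rewrite cY eGc /Y vf_cj !rmorphD cj_ee !cjK.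
rewrite hE gE gbE; ring.
Qed.

(* On the explicit solutions [Fr = i / g] is t + i|z|^2 + <mu,z> + lambda, and
   [kap = |g|^2 / P] is the constant 4 / (4 Im lambda - |mu|^2). *)
Section Rigidity.
Hypothesis Dm0 : forall a b, Dm a b = 0.
Hypothesis Em0 : forall a b, Em a b = 0.
Hypothesis Gv0 : forall a, Gv a = 0.

Lemma Dv0 a : Dv a = 0.
Proof. by rewrite DvE big1 // => b _; rewrite Dm0 mul0r. Qed.
Lemma Ev0 a : Ev a = 0.
Proof. by rewrite EvE big1 // => b _; rewrite Em0 mul0r. Qed.

Lemma Z_gb0 a : Z a gb = 0.
Proof. by rewrite Z_gb VvE Dv0 Ev0 Gv0 !addr0. Qed.
Lemma Zb_g0 a : Zb a g = 0.
Proof. by rewrite -cj_gb -cjZ Z_gb0 rmorph0. Qed.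
Lemma Z_g0 a : Z a g = 2 * g * fa a.
Proof. by rewrite Z_g Dv0 Ev0 Gv0 !addr0 subr0 add0r. Qed.

(** The commutator of [Z a] and [Zb a] applied to the CR function [g]. An index [a] must exist, and
    the factor 2 stays because 2 need not be invertible in [A]. *)
Lemma iT_g0 (a : 'I_n) : 2 * (ii * T g) = - (2 * g * g).
Proof.
have := ZZb a a g; rewrite Zb_g0 raddf0 Z_g0 !ZbM Zbnat Zb_g0 Zb_fa Em0 eqxx /= !mul1r => e.
move/esym/eqP: e; rewrite subr_eq0 => /eqP e.
rewrite mulrA -e; ring.
Qed.

Variable gi : A.
Hypothesis ggi : g * gi = 1.

Lemma div_by_g x y : g * x = y -> x = gi * y.
Proof. by move=> <-; rewrite mulrA (mulrC gi) ggi mul1r. Qed.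

Lemma Z_gi a : Z a gi = - (2 * fa a * gi).
Proof.
have e : Z a (g * gi) = 0 by rewrite ggi -[1]/(1%:R) Znat.
rewrite ZM Z_g0 in e.
have -> : Z a gi = gi * (0 - 2 * g * fa a * gi) by apply: div_by_g; rewrite -e; ring.
have -> : gi * (0 - 2 * g * fa a * gi) = - (2 * fa a * gi) * (g * gi) by ring.
by rewrite ggi mulr1.
Qed.

Lemma Zb_gi a : Zb a gi = 0.
Proof.
have e : Zb a (g * gi) = 0 by rewrite ggi -[1]/(1%:R) Zbnat.
by rewrite ZbM Zb_g0 mul0r add0r in e; rewrite (div_by_g e) mulr0.
Qed.

Definition Fr := ii * gi.

Lemma T_Fr (a : 'I_n) : T ii = 0 -> 2 * T Fr = 2.
Proof.
move=> Tii; have e : T (g * gi) = 0 by rewrite ggi -[1]/(1%:R) T_nat.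
rewrite TM in e.
have {}e : 2 * T Fr = gi * (- (2 * (ii * T g)) * gi).
  apply: div_by_g; rewrite /Fr TM Tii.
  have -> : g * (2 * (0 * gi + ii * T gi)) = 2 * ii * (T g * gi + g * T gi) - 2 * (ii * T g) * gi by ring.
  by rewrite e; ring.
rewrite e (iT_g0 a).
have -> : gi * (- - (2 * g * g) * gi) = 2 * (g * gi) * (g * gi) by ring.
by rewrite ggi; ring.
Qed.

Lemma Zb_Fr a : Zb a Fr = 0.
Proof. by rewrite /Fr ZbM Zbii Zb_gi mul0r mulr0 addr0. Qed.

Lemma Z_Fr a : Z a Fr = - (2 * ii * fa a * gi).
Proof. by rewrite /Fr ZM Zii Z_gi; ring. Qed.

Lemma ZZ_Fr a b : Z b (Z a Fr) = 0.
Proof.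
rewrite Z_Fr raddfN /= [Z b (_ * gi)]ZM Z_gi [Z b (_ * fa a)]ZM Z_fa Dm0.
rewrite [Z b (2 * ii)]ZM Znat Zii; ring.
Qed.

Lemma sqnorm_ZFr : \sum_a Z a Fr * cj (Z a Fr) = 4 * q * gi * cj gi.
Proof.
rewrite qE mulr_sumr !mulr_suml; apply: eq_bigr => a _.
rewrite Z_Fr rmorphN [cj (_ * gi)]rmorphM [cj (_ * fa a)]rmorphM [cj (2 * ii)]rmorphM cj2 cj_ii cj_fa.
have -> : - (2 * ii * fa a * gi) * - (2 * - ii * fb a * cj gi) =
  - (ii * ii) * (4 * (fa a * fb a) * gi * cj gi) by ring.
by rewrite ii2; ring.
Qed.

Variable Pi : A.
Hypothesis PPi : P * Pi = 1.

Lemma Z_Pi a : Z a Pi = - (2 * fa a * Pi).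
Proof.
have e : Z a (P * Pi) = 0 by rewrite PPi -[1]/(1%:R) Znat.
rewrite ZM Z_P in e.
have -> : Z a Pi = Pi * (P * Z a Pi) by rewrite mulrA (mulrC Pi) PPi mul1r.
have -> : Pi * (P * Z a Pi) = Pi * (2 * P * fa a * Pi + P * Z a Pi) - 2 * fa a * Pi * (P * Pi) by ring.
by rewrite e PPi; ring.
Qed.

Lemma cj_Pi : cj Pi = Pi.
Proof.
have e : P * cj Pi = 1 by rewrite -cj_P -rmorphM PPi rmorph1.
transitivity (Pi * (P * cj Pi)); last by rewrite e mulr1.
by rewrite mulrA (mulrC Pi) PPi mul1r.
Qed.

Definition kap := g * gb * Pi.

Lemma Z_kap a : Z a kap = 0.
Proof.
rewrite /kap ZM [Z a (g * gb)]ZM Z_g0 Z_gb0 Z_Pi; ring.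
Qed.

Lemma cj_kap : cj kap = kap.
Proof. by rewrite /kap rmorphM [cj (g * _)]rmorphM cj_g cj_gb cj_Pi; ring. Qed.

Lemma Zb_kap a : Zb a kap = 0.
Proof. by rewrite -cj_kap -cjZ Z_kap rmorph0. Qed.

Lemma iT_kap (a : 'I_n) : 2 * (ii * T kap) = 0.
Proof.
have := ZZb a a kap; rewrite Zb_kap Z_kap !raddf0 eqxx /= mul1r => e.
by move/esym/eqP: e; rewrite sub0r oppr_eq0 -mulrA => /eqP.
Qed.

End Rigidity.

End JerisonLee.
End JL.

(** * The Heisenberg vector fields *)

(* [xx], [xy], ..., [tt] stand for the second derivatives and [u] for the [t]-derivative; [d] is the
   Kronecker delta, [hf] is 1/2. *)
Lemma commutator_ZZ (A : comNzRingType) (d i hf za zb u xx xx' xy xy' yx yx' yy yy' xt xt' yt yt' tx tx' ty ty' tt : A) :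
  xx = xx' -> xy = yx' -> yx = xy' -> yy = yy' -> xt = tx -> yt = ty -> xt' = tx' -> yt' = ty' ->
  hf * (hf * (xx - i * xy) + i * (d * u + zb * xt)
    - i * (hf * (yx - i * yy) + i * (- (i * d) * u + zb * yt)))
  + i * za * (hf * (tx' - i * ty') + i * (0 * u + zb * tt)) =
  hf * (hf * (xx' - i * xy') + i * (d * u + za * xt')
    - i * (hf * (yx' - i * yy') + i * (- (i * d) * u + za * yt')))
  + i * zb * (hf * (tx - i * ty) + i * (0 * u + za * tt)).
Proof. by move=> -> -> -> -> -> -> -> ->; ring. Qed.

Lemma commutator_ZZb (A : comNzRingType) (d i hf za zb u xx xx' xy xy' yx yx' yy yy' xt xt' yt yt' tx tx' ty ty' tt : A) :
  i * i = -1 -> 2 * hf = 1 ->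
  xx = xx' -> xy = yx' -> yx = xy' -> yy = yy' -> xt = tx -> yt = ty -> xt' = tx' -> yt' = ty' ->
  hf * (hf * (xx + i * xy) - i * (d * u + zb * xt)
    - i * (hf * (yx + i * yy) - i * (i * d * u + zb * yt)))
  + i * za * (hf * (tx' + i * ty') - i * (0 * u + zb * tt)) =
  hf * (hf * (xx' - i * xy') + i * (d * u + za * xt')
    + i * (hf * (yx' - i * yy') + i * (- (i * d) * u + za * yt')))
  - i * zb * (hf * (tx - i * ty) + i * (0 * u + za * tt)) - d * (2 * i * u).
Proof.
move=> i2 h2 -> -> -> -> -> -> -> ->.
apply/eqP; rewrite -subr_eq0; apply/eqP.
transitivity ((i * i + 1) * (2 * hf) * i * d * u + (1 - 2 * hf) * (2 * i * d * u)); first ring.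
by rewrite i2 h2; ring.
Qed.

Section HeisenbergRing.
Variables (R : realType) (n : nat).
Local Notation V := (heis R n).
Local Notation A := (csm V).
Implicit Types (a b : 'I_n) (F G : A) (p : V).

Definition ex a : V := (delta_mx 0 a, 0, 0).
Definition ey a : V := (0, delta_mx 0 a, 0).
Definition et : V := (0, 0, 1).

Definition xlin a p : R := p.1.1 0 a.
Definition ylin a p : R := p.1.2 0 a.
Definition tlin p : R := p.2.

Lemma xlin_is_linear a : linear (xlin a).
Proof. by move=> k u v; rewrite /xlin /= !mxE. Qed.
Lemma ylin_is_linear a : linear (ylin a).
Proof. by move=> k u v; rewrite /ylin /= !mxE. Qed.
Lemma tlin_is_linear : linear tlin.
Proof. by []. Qed.
HB.instance Definition _ a := GRing.isLinear.Build R V R _ (xlin a) (xlin_is_linear a).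
HB.instance Definition _ a := GRing.isLinear.Build R V R _ (ylin a) (ylin_is_linear a).
HB.instance Definition _ := GRing.isLinear.Build R V R _ tlin tlin_is_linear.

Lemma xlin_continuous a : continuous (xlin a).
Proof.
move=> p; apply: (@continuous_comp _ _ _ (fun p : V => p.1.1) (fun M : 'rV[R]_n => M 0 a)).
  by apply: (@continuous_comp _ _ _ (@fst _ R) fst); exact: cvg_fst.
exact: coord_continuous.
Qed.
Lemma ylin_continuous a : continuous (ylin a).
Proof.
move=> p; apply: (@continuous_comp _ _ _ (fun p : V => p.1.2) (fun M : 'rV[R]_n => M 0 a)).
  by apply: (@continuous_comp _ _ _ (@fst _ R) snd); [exact: cvg_fst|exact: cvg_snd].
exact: coord_continuous.
Qed.
Lemma tlin_continuous : continuous tlin.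
Proof. by move=> p; exact: cvg_snd. Qed.

Lemma smth_x a : smth (xlin a). Proof. exact: (smth_lin (@xlin_continuous a)). Qed.
Lemma smth_y a : smth (ylin a). Proof. exact: (smth_lin (@ylin_continuous a)). Qed.
Lemma smth_t : smth tlin. Proof. exact: (smth_lin tlin_continuous). Qed.

Definition ci : A := ccst _ 'i%C.
Definition half : A := ccst _ 2^-1.
Definition cx a : A := creal (smth_x a).
Definition cy a : A := creal (smth_y a).
Definition ct : A := creal smth_t.
Definition zc a : A := cx a + ci * cy a.

Lemma DD_lin (f : {linear V -> R}) (cf : continuous f) (sf : smth f) v :
  DD v (creal sf) = ccst _ (f v)%:C%C.
Proof.
apply: csm_eq => p; rewrite DD_creal /= deriveE; last exact: linear_differentiable.
by rewrite diff_lin.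
Qed.

Lemma ccst_nat k : ccst V (k%:R)%:C%C = k%:R.
Proof. by rewrite -(rmorph_nat (ccst V)) -(rmorph_nat (real_complex R)). Qed.

Lemma DD_cx v a : DD v (cx a) = ccst _ (xlin a v)%:C%C.
Proof. exact: (@DD_lin (xlin a) (@xlin_continuous a)). Qed.
Lemma DD_cy v a : DD v (cy a) = ccst _ (ylin a v)%:C%C.
Proof. exact: (@DD_lin (ylin a) (@ylin_continuous a)). Qed.
Lemma DD_ct v : DD v ct = ccst _ (tlin v)%:C%C.
Proof. exact: (@DD_lin tlin tlin_continuous). Qed.

Lemma xlin_ex a b : xlin b (ex a) = (a == b)%:R.
Proof. by rewrite /xlin /= mxE eqxx eq_sym. Qed.
Lemma xlin_ey a b : xlin b (ey a) = 0.
Proof. by rewrite /xlin /= mxE. Qed.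
Lemma xlin_et b : xlin b et = 0.
Proof. by rewrite /xlin /= mxE. Qed.
Lemma ylin_ex a b : ylin b (ex a) = 0.
Proof. by rewrite /ylin /= mxE. Qed.
Lemma ylin_ey a b : ylin b (ey a) = (a == b)%:R.
Proof. by rewrite /ylin /= mxE eqxx eq_sym. Qed.
Lemma ylin_et b : ylin b et = 0.
Proof. by rewrite /ylin /= mxE. Qed.

Lemma ci2 : ci * ci = -1.
Proof. by rewrite /ci -rmorphM /= -expr2 sqr_i rmorphN rmorph1. Qed.
Lemma cj_ci : cconj ci = - ci.
Proof. by rewrite /ci cconj_ccst -rmorphN; congr (ccst _ _); apply/eqP; rewrite eq_complex /= oppr0 !eqxx. Qed.
Lemma DD_ci v : DD v ci = 0. Proof. exact: DD_ccst. Qed.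
Lemma DD_half v : DD v half = 0. Proof. exact: DD_ccst. Qed.
Lemma half2 : 2 * half = 1.
Proof.
rewrite /half -[2](rmorph_nat (ccst V)) -rmorphM /= mulfV ?rmorph1 //.

Qed.
Lemma cj_half : cconj half = half.
Proof.
rewrite /half cconj_ccst; congr (ccst _ _).
by rewrite conjc_inv conjc_nat.
Qed.

Definition ZA a F := half * (DD (ex a) F - ci * DD (ey a) F) + ci * cconj (zc a) * DD et F.
Definition ZbA a F := half * (DD (ex a) F + ci * DD (ey a) F) - ci * zc a * DD et F.

Lemma ZA_additive a : additive (ZA a).
Proof. move=> F G; rewrite /ZA !raddfB /=; ring. Qed.
Lemma ZbA_additive a : additive (ZbA a).
Proof. move=> F G; rewrite /ZbA !raddfB /=; ring. Qed.
HB.instance Definition _ a := GRing.isAdditive.Build A A (ZA a) (ZA_additive a).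
HB.instance Definition _ a := GRing.isAdditive.Build A A (ZbA a) (ZbA_additive a).

Lemma ZAM a F G : ZA a (F * G) = ZA a F * G + F * ZA a G.
Proof. rewrite /ZA !DDM; ring. Qed.
Lemma ZbAM a F G : ZbA a (F * G) = ZbA a F * G + F * ZbA a G.
Proof. rewrite /ZbA !DDM; ring. Qed.

Lemma cj_cx a : cconj (cx a) = cx a. Proof. exact: cconj_creal. Qed.
Lemma cj_cy a : cconj (cy a) = cy a. Proof. exact: cconj_creal. Qed.

Lemma cj_zc a : cconj (zc a) = cx a - ci * cy a.
Proof. by rewrite /zc rmorphD rmorphM /= cj_ci cj_cx cj_cy; ring. Qed.

Lemma cjZA a F : cconj (ZA a F) = ZbA a (cconj F).
Proof.
have cD (x y : A) : cconj (x + y) = cconj x + cconj y by exact: rmorphD.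
have cB (x y : A) : cconj (x - y) = cconj x - cconj y by exact: rmorphB.
have cM (x y : A) : cconj (x * y) = cconj x * cconj y by exact: rmorphM.
rewrite /ZA cD cM cB !cM cconjK !cconj_DD cj_half !cj_ci /ZbA; ring.
Qed.

Lemma ZA_ci a : ZA a ci = 0.
Proof. rewrite /ZA !DD_ci; ring. Qed.
Lemma ZbA_ci a : ZbA a ci = 0.
Proof. rewrite /ZbA !DD_ci; ring. Qed.

Lemma DD_zc v a : DD v (zc a) = ccst _ (xlin a v)%:C%C + ci * ccst _ (ylin a v)%:C%C.
Proof. by rewrite /zc raddfD /= DDM DD_ci DD_cx DD_cy mul0r add0r. Qed.
Lemma DD_cjzc v a : DD v (cconj (zc a)) = ccst _ (xlin a v)%:C%C - ci * ccst _ (ylin a v)%:C%C.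
Proof. by rewrite cj_zc raddfB /= DDM DD_ci DD_cx DD_cy mul0r add0r. Qed.

Lemma ccst0 : ccst V 0%:C%C = 0.
Proof. exact: (ccst_nat 0). Qed.

Lemma DD_zc_ex a b : DD (ex a) (zc b) = (a == b)%:R.
Proof. by rewrite DD_zc xlin_ex ylin_ex ccst_nat ccst0 mulr0 addr0. Qed.
Lemma DD_zc_ey a b : DD (ey a) (zc b) = ci * (a == b)%:R.
Proof. by rewrite DD_zc xlin_ey ylin_ey ccst_nat ccst0 add0r. Qed.
Lemma DD_zc_et b : DD et (zc b) = 0.
Proof. by rewrite DD_zc xlin_et ylin_et ccst0 mulr0 addr0. Qed.
Lemma DD_cjzc_ex a b : DD (ex a) (cconj (zc b)) = (a == b)%:R.
Proof. by rewrite DD_cjzc xlin_ex ylin_ex ccst_nat ccst0 mulr0 subr0. Qed.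
Lemma DD_cjzc_ey a b : DD (ey a) (cconj (zc b)) = - (ci * (a == b)%:R).
Proof. by rewrite DD_cjzc xlin_ey ylin_ey ccst_nat ccst0 sub0r. Qed.
Lemma DD_cjzc_et b : DD et (cconj (zc b)) = 0.
Proof. by rewrite DD_cjzc xlin_et ylin_et ccst0 mulr0 subr0. Qed.

Lemma DD_ZA v b F : DD v (ZA b F) =
  half * (DD v (DD (ex b) F) - ci * DD v (DD (ey b) F)) +
  ci * (DD v (cconj (zc b)) * DD et F + cconj (zc b) * DD v (DD et F)).
Proof.
rewrite /ZA raddfD /= [DD v (half * _)]DDM raddfB /= DD_half.
rewrite [DD v (ci * _ * _)]DDM [DD v (ci * cconj _)]DDM [DD v (ci * DD _ _)]DDM DD_ci; ring.
Qed.

Lemma DD_ZbA v b F : DD v (ZbA b F) =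
  half * (DD v (DD (ex b) F) + ci * DD v (DD (ey b) F)) -
  ci * (DD v (zc b) * DD et F + zc b * DD v (DD et F)).
Proof.
rewrite /ZbA raddfB /= [DD v (half * _)]DDM raddfD /= DD_half.
rewrite [DD v (ci * _ * _)]DDM [DD v (ci * zc _)]DDM [DD v (ci * DD _ _)]DDM DD_ci; ring.
Qed.

Lemma ZA_ZA a b F : ZA a (ZA b F) = ZA b (ZA a F).
Proof.
rewrite {1}/ZA !DD_ZA [RHS]/ZA !DD_ZA !DD_cjzc_ex !DD_cjzc_ey !DD_cjzc_et (eq_sym b a).
exact: commutator_ZZ (DD_comm _ _ _) (DD_comm _ _ _) (DD_comm _ _ _) (DD_comm _ _ _)
  (DD_comm _ _ _) (DD_comm _ _ _) (DD_comm _ _ _) (DD_comm _ _ _).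
Qed.

Lemma ZA_DDet a F : ZA a (DD et F) = DD et (ZA a F).
Proof.
have e1 := DD_comm (ex a) et F; have e2 := DD_comm (ey a) et F.
rewrite DD_ZA DD_cjzc_et /ZA e1 e2; ring.
Qed.

Lemma ZA_ZbA a b F : ZA a (ZbA b F) =
  ZbA b (ZA a F) - (a == b)%:R * (2 * ci * DD et F).
Proof.
rewrite {1}/ZA !DD_ZbA [X in _ = X - _]/ZbA !DD_ZA !DD_cjzc_ex !DD_cjzc_ey !DD_cjzc_et.
rewrite !DD_zc_ex !DD_zc_ey !DD_zc_et (eq_sym b a).
exact: commutator_ZZb ci2 half2 (DD_comm _ _ _) (DD_comm _ _ _) (DD_comm _ _ _) (DD_comm _ _ _)
  (DD_comm _ _ _) (DD_comm _ _ _) (DD_comm _ _ _) (DD_comm _ _ _).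
Qed.

Lemma zcE a p : zc a p = zcoord p 0 a.
Proof.
rewrite mxE [zc a p]/((p.1.1 0 a)%:C%C + 'i%C * (p.1.2 0 a)%:C%C).
by apply/eqP; rewrite eq_complex /=; apply/andP; split; apply/eqP; ring.
Qed.

Lemma ZA_Z a F p : Z a F p = ZA a F p.
Proof. by rewrite /Z -zcE. Qed.
Lemma ZbA_Zbar a F p : Zbar a F p = ZbA a F p.
Proof. by rewrite /Zbar -zcE. Qed.

End HeisenbergRing.

(** * The equation in terms of [f = ln u / n - ln 2] *)

Section RealParts.
Variables (R : realType) (V : normedModType R).
Implicit Types (F G : csm V) (p : V).

Lemma cRe_add F G p : cRe (F + G) p = cRe F p + cRe G p.
Proof. by rewrite /cRe [(F + G) p]/(F p + G p); case: (F p) (G p) => ? ? []. Qed.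
Lemma cIm_add F G p : cIm (F + G) p = cIm F p + cIm G p.
Proof. by rewrite /cIm [(F + G) p]/(F p + G p); case: (F p) (G p) => ? ? []. Qed.
Lemma cRe_opp F p : cRe (- F) p = - cRe F p.
Proof. by rewrite /cRe [(- F) p]/(- F p); case: (F p). Qed.
Lemma cIm_opp F p : cIm (- F) p = - cIm F p.
Proof. by rewrite /cIm [(- F) p]/(- F p); case: (F p). Qed.
Lemma cRe_sub F G p : cRe (F - G) p = cRe F p - cRe G p.
Proof. by rewrite cRe_add cRe_opp. Qed.
Lemma cRe_mul F G p : cRe (F * G) p = cRe F p * cRe G p - cIm F p * cIm G p.
Proof. by rewrite cReM. Qed.
Lemma cIm_mul F G p : cIm (F * G) p = cRe F p * cIm G p + cIm F p * cRe G p.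
Proof. by rewrite cImM. Qed.
Lemma cRe_conj F p : cRe (cconj F) p = cRe F p.
Proof. by rewrite /cRe [cconj F p]/((F p)^*%C); case: (F p). Qed.
Lemma cIm_conj F p : cIm (cconj F) p = - cIm F p.
Proof. by rewrite /cIm [cconj F p]/((F p)^*%C); case: (F p). Qed.

Lemma cIm_real F p : cconj F = F -> cIm F p = 0.
Proof. by move=> e; have := cIm_conj F p; rewrite e => h; lra. Qed.
Lemma cRe_mulr F G p : cconj F = F -> cRe (F * G) p = cRe F p * cRe G p.
Proof. by move=> e; rewrite cRe_mul (cIm_real p e) mul0r subr0. Qed.
Lemma cIm_mulr F G p : cconj F = F -> cIm (F * G) p = cRe F p * cIm G p.
Proof. by move=> e; rewrite cIm_mul (cIm_real p e) mul0r addr0. Qed.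

Lemma cRe_nat k p : cRe (k%:R : csm V) p = k%:R.
Proof.
have -> : (k%:R : csm V) = ccst V k%:R by rewrite rmorph_nat.
by rewrite /cRe /= -[k%:R]/(1%:R *+ k) (_ : (k%:R : R[i]) = (k%:R : R)%:C%C) // rmorph_nat.
Qed.
Lemma cj_nat k : cconj (k%:R : csm V) = k%:R.
Proof. exact: rmorph_nat. Qed.

Lemma cRe_exp F k p : cconj F = F -> cRe (F ^+ k) p = cRe F p ^+ k.
Proof.
move=> e; elim: k => [|k IH]; first by rewrite !expr0 (cRe_nat 1).
by rewrite !exprS cRe_mulr // IH.
Qed.
Lemma cj_exp F k : cconj F = F -> cconj (F ^+ k) = F ^+ k.
Proof. by move=> e; rewrite rmorphXn /= e. Qed.

Lemma cRe_sum (I : finType) (F : I -> csm V) p : cRe (\sum_i F i) p = \sum_i cRe (F i) p.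
Proof. by elim/big_rec2: _ => [|i x y _ <-]; [exact: (cRe_nat 0)|exact: cRe_add]. Qed.
Lemma cIm_sum (I : finType) (F : I -> csm V) p : cIm (\sum_i F i) p = \sum_i cIm (F i) p.
Proof. by elim/big_rec2: _ => [|i x y _ <-]; [exact: (cIm_real p (cj_nat 0))|exact: cIm_add]. Qed.

Lemma cRe_sqnorm F p : cRe (F * cconj F) p = cRe F p ^+ 2 + cIm F p ^+ 2.
Proof. by rewrite cRe_mul cRe_conj cIm_conj; ring. Qed.

Lemma cconjM F G : cconj (F * G) = cconj F * cconj G.
Proof. exact: rmorphM. Qed.
Lemma cconjD F G : cconj (F + G) = cconj F + cconj G.
Proof. exact: rmorphD. Qed.
Lemma cconjB F G : cconj (F - G) = cconj F - cconj G.
Proof. exact: rmorphB. Qed.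

Lemma csm_ext F G : (forall p, cRe F p = cRe G p) -> (forall p, cIm F p = cIm G p) -> F = G.
Proof. by move=> h1 h2; apply: csm_eqRI; apply/funext. Qed.

Lemma cRe_creal f (sf : smth f) p : cRe (creal sf) p = f p.
Proof. by []. Qed.

End RealParts.

Section Logarithm.
Variables (R : realType) (n : nat) (u : heis R n -> R).
Local Notation V := (heis R n).
Local Notation A := (csm V).
Hypothesis n_gt0 : (0 < n)%N.
Hypothesis u_smooth : smooth u.
Hypothesis u_pos : forall p, 0 < u p.
Hypothesis u_eq : forall p : V,
     4 * subLaplacian u p = n%:R ^+ 2 * u p `^ ((n%:R + 2) / n%:R).

Lemma su : smth u.
Proof. by apply/Ck_iter; exact: u_smooth. Qed.

Definition fR p : R := n%:R^-1 * ln (u p) - ln 2.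
Lemma smth_fR : smth fR.
Proof.
apply: (@smth_add _ _ (fun p => n%:R^-1 * ln (u p)) (cst (- ln 2))); last exact: smth_cst.
apply: (@smth_mul _ _ (cst n%:R^-1)); first exact: smth_cst.
exact: smth_ln su u_pos.
Qed.

Definition vR p : R := expR (fR p).
Lemma smth_vR : smth vR. Proof. exact: smth_exp smth_fR. Qed.
Lemma vR_gt0 p : 0 < vR p. Proof. exact: expR_gt0. Qed.

Definition fC : A := creal smth_fR.
Definition vC : A := creal smth_vR.

Lemma DD_vC w : DD w vC = vC * DD w fC.
Proof.
have e p : 'D_w vR p = vR p * 'D_w fR p.
  by have [_ ] := @deriv_exp R V fR p w (smth_diff p smth_fR).
apply: csm_ext => p.
  by rewrite cRe_mulr ?cconj_creal // /vC /fC !DD_creal !cRe_creal.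
by rewrite cIm_mulr ?cconj_creal // !cIm_real ?mulr0 // cconj_DD cconj_creal.
Qed.

Lemma ZA_vC a : ZA a vC = vC * ZA a fC.
Proof. rewrite /ZA !DD_vC; ring. Qed.

Lemma u_vR p : u p = (2 * vR p) ^+ n.
Proof.
have -> : 2 * vR p = expR (n%:R^-1 * ln (u p)).
  by rewrite /vR /fR expRD expRN lnK ?posrE // mulrCA mulfV ?mulr1.
rewrite -expRM_natl mulrA mulfV ?mul1r ?lnK ?posrE //.
by rewrite pnatr_eq0 -lt0n.
Qed.

Lemma u_powR p : u p `^ ((n%:R + 2) / n%:R) = u p * (4 * vR p ^+ 2).
Proof.
have n0 : n%:R != 0 :> R by rewrite pnatr_eq0 -lt0n.
have -> : (n%:R + 2) / n%:R = 1 + 2 / n%:R :> R by field.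
rewrite powRD; last by rewrite gt_eqF ?implybT.
rewrite powRr1 ?ltW //; congr (_ * _).
have v0 : 0 <= 2 * vR p by rewrite mulr_ge0 // ltW // vR_gt0.
by rewrite u_vR -powR_mulrn // -powRrM mulrCA mulfV // mulr1 powR_mulrn // exprMn; ring.
Qed.

Definition qC : A := \sum_a ZA a fC * ZbA a fC.

Lemma ZA_ccst a c : ZA a (ccst V c) = 0.
Proof. rewrite /ZA !DD_ccst; ring. Qed.
Lemma ZbA_ccst a c : ZbA a (ccst V c) = 0.
Proof. rewrite /ZbA !DD_ccst; ring. Qed.

Lemma ZA_vX a j : ZA a (vC ^+ j) = j%:R * vC ^+ j * ZA a fC.
Proof.
elim: j => [|j IH].
  by rewrite expr0 !mul0r -(rmorph1 (ccst V)) ZA_ccst.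
by rewrite exprS ZAM IH ZA_vC -[j.+1]addn1 natrD; ring.
Qed.

Lemma ZbA_vX a j : ZbA a (vC ^+ j) = j%:R * vC ^+ j * ZbA a fC.
Proof.
have cv : cconj vC = vC by exact: cconj_creal.
have cf : cconj fC = fC by exact: cconj_creal.
by rewrite -{1}(cj_exp j cv) -cjZA ZA_vX 2!cconjM cjZA cj_nat (cj_exp j cv) cf.
Qed.

(** The normalization of [f] is tuned for this: [u = (2 v) ^ n] turns the nonlinearity into
    [4 v ^ 2 u], and division by [4 n u] leaves no constant but [n]. *)
Lemma cRe_divZ p : cRe (\sum_a ZbA a (ZA a fC)) p = - (n%:R * (cRe qC p + vR p ^+ 2)).
Proof.
have n0 : n%:R != 0 :> R by rewrite pnatr_eq0 -lt0n.
pose S := \sum_a ZbA a (ZA a fC).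
pose U : A := creal su.
have eU : U = (2 ^+ n) * vC ^+ n.
  apply: csm_ext => p'; last first.
    have cU : cconj U = U by exact: cconj_creal.
    have cv : cconj vC = vC by exact: cconj_creal.
    have c2 : cconj (2 : A) = 2 by exact: cj_nat.
    by rewrite (cIm_real _ cU) cIm_real // cconjM (cj_exp n c2) (cj_exp n cv).
  have c2 : cconj (2 : A) = 2 by exact: cj_nat.
  rewrite cRe_mulr ?cj_exp // !cRe_exp ?cconj_creal // (cRe_nat 2) !cRe_creal.
  by rewrite u_vR exprMn.
have eL : \sum_a ZbA a (ZA a U) = U * (n%:R * (n%:R * qC + S)).
  have Z2 a : ZA a (2 ^+ n : A) = 0.
    by rewrite -(rmorph_nat (ccst V) 2) -rmorphXn ZA_ccst.
  have Zb2 a : ZbA a (2 ^+ n : A) = 0.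
    by rewrite -(rmorph_nat (ccst V) 2) -rmorphXn ZbA_ccst.
  have Zbn a : ZbA a (n%:R : A) = 0.
    by rewrite -(rmorph_nat (ccst V) n) ZbA_ccst.
  have ZU a : ZA a U = U * (n%:R * ZA a fC).
    by rewrite eU ZAM Z2 ZA_vX; ring.
  have ZbU a : ZbA a U = U * (n%:R * ZbA a fC).
    by rewrite eU ZbAM Zb2 ZbA_vX; ring.
  rewrite /qC /S !mulr_sumr -big_split /= !mulr_sumr; apply: eq_bigr => a _.
  rewrite ZU ZbAM [ZbA a (n%:R * _)]ZbAM Zbn ZbU; ring.
have e1 : subLaplacian u p = - cRe (\sum_a ZbA a (ZA a U)) p.
  rewrite /subLaplacian /cRe csm_sumE; congr (- complex.Re _); apply: eq_bigr => a _.
  rewrite -ZbA_Zbar; congr (Zbar a _ p); apply/funext => q; exact: (ZA_Z a U q).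
have := u_eq p; rewrite e1 eL u_powR cRe_mulr ?cconj_creal // cRe_creal.
rewrite (cRe_mulr _ _ (cj_nat V n)) cRe_add (cRe_mulr _ _ (cj_nat V n)) cRe_nat.
rewrite -/S; set x := cRe S p; set y := cRe qC p => e.
have up := gt_eqF (u_pos p).
apply/eqP; rewrite -subr_eq0.
have : (4 * u p * n%:R) * (x + n%:R * (y + vR p ^+ 2)) == 0.
  apply/eqP; transitivity (n%:R ^+ 2 * (u p * (4 * vR p ^+ 2)) - 4 * - (u p * (n%:R * (n%:R * y + x)))); last by rewrite e subrr.
  ring.
by rewrite !mulf_eq0 up (negPf n0) pnatr_eq0 /= opprK.
Qed.

Definition gC : A := qC + vC * vC - ci R n * DD (et R n) fC.

Lemma cj_ZAf a : cconj (ZA a fC) = ZbA a fC.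
Proof. by rewrite cjZA cconj_creal. Qed.
Lemma cj_ZbAf a : cconj (ZbA a fC) = ZA a fC.
Proof. by rewrite -cj_ZAf cconjK. Qed.

Lemma cj_qC : cconj qC = qC.
Proof.
rewrite /qC raddf_sum; apply: eq_bigr => a _.
by rewrite /= cconjM cj_ZAf cj_ZbAf mulrC.
Qed.

(** The equation determines the real part only; the imaginary part is [n f_0], each commutator of
    [Z a] and [Zb a] contributing equally. *)
Lemma feqC : \sum_a ZbA a (ZA a fC) = - (n%:R * gC).
Proof.
pose S := \sum_a ZbA a (ZA a fC); rewrite -/S.
have cjf0 : cconj (DD (et R n) fC) = DD (et R n) fC by rewrite cconj_DD cconj_creal.
have e1 : S - cconj S = 2 * (n%:R * (ci R n * DD (et R n) fC)).
  rewrite /S raddf_sum -sumrB.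
  under eq_bigr => a _ do rewrite /= -[cconj (ZbA a _)]cconjK.
  have h a : ZbA a (ZA a fC) - cconj (ZbA a (ZA a fC)) = 2 * (ci R n * DD (et R n) fC).
    have -> : cconj (ZbA a (ZA a fC)) = ZA a (ZbA a fC).
      by rewrite -{1}(cj_ZbAf a) -cjZA cconjK.
    by rewrite ZA_ZbA eqxx /=; ring.
  under eq_bigr => a _ do rewrite cconjK h.
  by rewrite sumr_const card_ord -mulr_natl; ring.
have c2 k : cconj (k%:R : A) = k%:R by exact: cj_nat.
have c1 : cconj (1 : A) = 1 by exact: rmorph1.
have cvv : cconj (vC * vC) = vC * vC by rewrite cconjM cconj_creal.
have e2 : S + cconj S = - (2 * (n%:R * (qC + vC * vC))).
  apply: csm_ext => p.
    rewrite cRe_add cRe_conj cRe_divZ cRe_opp (cRe_mulr _ _ (c2 2%N)) (cRe_mulr _ _ (c2 n)) cRe_add.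
    by rewrite (cRe_mulr _ _ (cconj_creal _)) !cRe_nat cRe_creal; ring.
  rewrite cIm_add cIm_conj addrN cIm_opp (cIm_mulr _ _ (c2 2%N)) (cIm_mulr _ _ (c2 n)).
  by rewrite cIm_add (cIm_real _ cj_qC) (cIm_real _ cvv) addr0 !mulr0 oppr0.
transitivity (half R n * ((S + cconj S) + (S - cconj S))).
  have -> : half R n * ((S + cconj S) + (S - cconj S)) = 2 * half R n * S by ring.
  by rewrite half2 mul1r.
rewrite e1 e2 /gC.
transitivity (2 * half R n * - (n%:R * (qC + vC * vC - ci R n * DD (et R n) fC))); first by ring.
by rewrite half2 mul1r.
Qed.

End Logarithm.

(** * Riemann sums *)

(* The grid on the line has spacing [1 / (m + 1)] and covers [[-(m + 1), m + 1]]. *)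
Section GridLine.
Variable R : realType.
Implicit Types (r x c : R) (m : nat).

Definition step m : R := (m.+1%:R)^-1.
Definition gsize m := ((m.+1 ^ 2).*2).+1.
Definition coord m (j : nat) : R := (j%:R - (m.+1 ^ 2)%:R) * step m.

Lemma step_gt0 m : 0 < step m. Proof. by rewrite invr_gt0 ltr0Sn. Qed.
Lemma step_le1 m : step m <= 1. Proof. by rewrite invf_le1 ?ltr0Sn // ler1n. Qed.

Lemma coordS m j : coord m j.+1 = coord m j + step m.
Proof. by rewrite /coord -[j.+1]addn1 natrD; ring. Qed.

Lemma coord0 m : coord m 0 = - m.+1%:R.
Proof.
rewrite /coord sub0r /step natrX expr2 mulNr mulfK //.

Qed.

Lemma coord_max m : coord m (gsize m).-1 = m.+1%:R.
Proof.
rewrite /coord /= -addnn natrD addrK /step natrX expr2 mulfK //.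

Qed.

Lemma coord_size m : coord m (gsize m) = m.+1%:R + step m.
Proof. by rewrite -coord_max -coordS. Qed.

(** The increments of a clamped coordinate telescope along the grid; this counts the grid points of
    an interval without rounding. *)
Definition clamp (a b x : R) := Num.min (Num.max x a) b.

Lemma clamp_mono a b x y : x <= y -> clamp a b x <= clamp a b y.
Proof.
move=> xy; rewrite /clamp.
by case: (leP x a) => ?; case: (leP y a) => ?; case: (leP a b) => ?;
  case: (leP x b) => ?; case: (leP y b) => ?; lra.
Qed.

Lemma clamp_telescope m a b : \sum_(j < gsize m) (clamp a b (coord m j + step m) - clamp a b (coord m j))
  = clamp a b (m.+1%:R + step m) - clamp a b (- m.+1%:R).
Proof.
under eq_bigr => j _ do rewrite -coordS.
rewrite -(big_mkord xpredT (fun j => clamp a b (coord m j.+1) - clamp a b (coord m j))).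
by rewrite telescope_sumr // coord_size coord0.
Qed.

Lemma count_le m r : 0 <= r ->
  \sum_(j < gsize m) (`|coord m j| <= r)%R%:R * step m <= 2 * r + 1.
Proof.
move=> r0; have s0 := step_gt0 m; have s1 := step_le1 m.
(* From a point with [|x| <= r] the clamp to [[- r, r + 1]] rises by the whole step, since a step is
   at most 1. *)
apply: (@le_trans _ _ (\sum_(j < gsize m) (clamp (- r) (r + 1) (coord m j + step m) - clamp (- r) (r + 1) (coord m j)))).
  apply: ler_sum => j _; case: (boolP (_ <= r)) => [|_].
    rewrite ler_norml => /andP[h1 h2]; rewrite mul1r /clamp.
    rewrite (max_idPl _) ?(max_idPl _) ?(min_idPl _) ?(min_idPl _) //; lra.
  by rewrite mul0r subr_ge0 clamp_mono // lerDl ltW.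
rewrite clamp_telescope.
have h1 : clamp (- r) (r + 1) (m.+1%:R + step m) <= r + 1 by rewrite /clamp ge_min lexx orbT.
have h2 : - r <= clamp (- r) (r + 1) (- m.+1%:R) by rewrite /clamp le_min le_max lexx orbT /=; lra.
lra.
Qed.

Lemma count_ge m r c : 0 < r -> step m <= r / 2 -> `|c| + r <= m.+1%:R ->
  r <= \sum_(j < gsize m) (`|coord m j - c| <= r)%R%:R * step m.
Proof.
move=> r0 sr cm; have s0 := step_gt0 m.
have [c1 c2] : c <= `|c| /\ - c <= `|c| by rewrite ler_norm -normrN ler_norm.
(* The clamp to the interval of half the radius is constant along every step starting outside
   [|x - c| <= r], since a step is at most [r / 2]. *)
apply: (@le_trans _ _ (\sum_(j < gsize m) (clamp (c - r / 2) (c + r / 2) (coord m j + step m) - clamp (c - r / 2) (c + r / 2) (coord m j)))).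
  rewrite clamp_telescope /clamp.
  rewrite (min_idPr _); last by rewrite le_max; apply/orP; left; lra.
  rewrite (max_idPr _); last by lra.
  rewrite (min_idPl _); lra.
apply: ler_sum => j _; set x := coord m j.
case: (boolP (_ <= r)) => [_|].
  rewrite mul1r /clamp; case: (leP x (c - r / 2)) => ?; case: (leP (x + step m) (c - r / 2)) => ?;
  case: (leP x (c + r / 2)) => ?; case: (leP (x + step m) (c + r / 2)) => ?;
  case: (leP (c - r / 2) (c + r / 2)) => ?; lra.
rewrite mul0r -ltNge lter_normr => /orP[] h; rewrite /clamp.
- rewrite (max_idPl _); last by lra.
  rewrite (max_idPl _); last by lra.
  rewrite (min_idPr _); last by lra.
  rewrite (min_idPr _); lra.
- rewrite (max_idPr _); last by lra.
  rewrite (max_idPr _); last by lra.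
  by rewrite subrr.
Qed.

Lemma near_step r : 0 < r -> \forall m \near \oo, step m < r.
Proof.
by move=> r0; near=> m; near: m; exact: near_infty_natSinv_lt (PosNum r0).
Unshelve. all: by end_near.
Qed.

Lemma near_size r : \forall m \near \oo, r <= m.+1%:R.
Proof.
near=> m; apply: (@le_trans _ _ m%:R); last by rewrite ler_nat.
near: m; exact: nbhs_infty_ger.
Unshelve. all: by end_near.
Qed.

End GridLine.

Section GridSum.
Variables (R : realType) (n : nat).
Local Notation V := (heis R n).
Implicit Types (f g : V -> R) (p : V) (m : nat) (r : R).

Definition gridT m : finType :=
  ({ffun 'I_n -> 'I_(gsize m)} * {ffun 'I_n -> 'I_(gsize m)} * 'I_(gsize m))%type.

Definition gpt m (k : gridT m) : V :=
  (\row_a coord R m (k.1.1 a), \row_a coord R m (k.1.2 a), coord R m k.2).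

Definition dvol m : R := step R m ^+ (n + n).+1.

Definition Int m f : R := dvol m * \sum_(k : gridT m) f (gpt k).

Lemma dvol_gt0 m : 0 < dvol m.
Proof. by rewrite exprn_gt0 // step_gt0. Qed.

Lemma Int_le m f g : (forall p, f p <= g p) -> Int m f <= Int m g.
Proof.
move=> fg; apply: ler_wpM2l; first exact/ltW/dvol_gt0.
by apply: ler_sum => k _; exact: fg.
Qed.

Lemma IntD m f g : Int m (fun p => f p + g p) = Int m f + Int m g.
Proof. by rewrite /Int big_split mulrDr. Qed.

Lemma IntZ m c f : Int m (fun p => c * f p) = c * Int m f.
Proof. by rewrite /Int -mulr_sumr mulrCA. Qed.

Lemma IntN m f : Int m (fun p => - f p) = - Int m f.
Proof. by rewrite /Int sumrN mulrN. Qed.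

Lemma IntB m f g : Int m (fun p => f p - g p) = Int m f - Int m g.
Proof. by rewrite IntD IntN. Qed.

Lemma Int_ge0 m f : (forall p, 0 <= f p) -> 0 <= Int m f.
Proof.
move=> f0; apply: mulr_ge0; first exact/ltW/dvol_gt0.
by apply: sumr_ge0 => k _; exact: f0.
Qed.

Lemma Int_sum m (I : Type) (s : seq I) (F : I -> V -> R) :
  Int m (fun p => \sum_(i <- s) F i p) = \sum_(i <- s) Int m (F i).
Proof. by rewrite /Int exchange_big mulr_sumr. Qed.

Lemma Int_norm m f : `|Int m f| <= Int m (fun p => `|f p|).
Proof.
rewrite ler_norml -IntN; apply/andP; split; apply: Int_le => p.
  by rewrite lerNl -normrN ler_norm.
exact: ler_norm.
Qed.

(* Coordinate box around [p0], with a separate radius [r'] for the central variable. *)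
Definition inbox r r' p0 p : bool :=
  [&& [forall a, `|p.1.1 0 a - p0.1.1 0 a| <= r],
      [forall a, `|p.1.2 0 a - p0.1.2 0 a| <= r] & `|p.2 - p0.2| <= r'].

Lemma prod_bool (b : 'I_n -> bool) : \prod_a (b a)%:R = ([forall a, b a])%:R :> R.
Proof.
case: (boolP [forall a, b a]) => [/forallP h|/forallPn[a h]].
  by rewrite big1 // => a _; rewrite h.
by rewrite (bigD1 a) //= (negPf h) mul0r.
Qed.

Lemma Int_box m r r' p0 : Int m (fun p => (inbox r r' p0 p)%:R) =
  (\prod_a \sum_(j < gsize m) (`|coord R m j - p0.1.1 0 a| <= r)%R%:R * step R m) *
  (\prod_a \sum_(j < gsize m) (`|coord R m j - p0.1.2 0 a| <= r)%R%:R * step R m) *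
  (\sum_(j < gsize m) (`|coord R m j - p0.2| <= r')%R%:R * step R m).
Proof.
rewrite !bigA_distr_bigA big_distrlr pair_bigA big_distrlr pair_bigA /= /Int mulr_sumr.
apply: eq_bigr => -[[k1 k2] j] _ /=.
rewrite !big_split /= !prodr_const !card_ord !prod_bool /inbox /=.
under eq_forallb => a do rewrite mxE.
under [X in _ && (X && _)]eq_forallb => a do rewrite mxE.
rewrite -!mulnb !natrM /dvol exprS exprD; ring.
Qed.

Lemma vol_le m r r' : 0 <= r -> 0 <= r' ->
  Int m (fun p => (inbox r r' 0 p)%:R) <= (2 * r + 1) ^+ (n + n) * (2 * r' + 1).
Proof.
move=> r0 r'0; rewrite Int_box exprD.
have h s (c : R) : 0 <= s -> c = 0 ->
    0 <= \sum_(j < gsize m) (`|coord R m j - c| <= s)%R%:R * step R m <= 2 * s + 1.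
  move=> s0 ->; rewrite sumr_ge0 /=.
    by under eq_bigr => j _ do rewrite subr0; exact: count_le.
  by move=> j _; rewrite mulr_ge0 // ltW // step_gt0.
have [/andP[a1 a2] b] : 0 <= \sum_(j < gsize m) (`|coord R m j - (0 : V).2| <= r')%R%:R * step R m <= 2 * r' + 1 /\ true.
  by split=> //; exact: h.
have hp (c : 'I_n -> R) : (forall a, c a = 0) ->
   0 <= \prod_a \sum_(j < gsize m) (`|coord R m j - c a| <= r)%R%:R * step R m <= (2 * r + 1) ^+ n.
  move=> c0; rewrite prodr_ge0 /=; last by move=> a _; have /andP[] := h r (c a) r0 (c0 a).
  rewrite -[X in _ <= _ ^+ X]card_ord -prodr_const; apply: ler_prod => a _; exact: h.
have /andP[p1 p2] := hp (fun a => (0 : V).1.1 0 a) (fun a => mxE _ _ _ _).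
have /andP[p3 p4] := hp (fun a => (0 : V).1.2 0 a) (fun a => mxE _ _ _ _).
by apply: ler_pM => //; [exact: mulr_ge0|exact: ler_pM].
Qed.

(** Stands for the positivity of the integral of a nonnegative function that is positive near a
    point. The lower bound has to be independent of the grid to survive refinement. *)
Lemma Int_pos f p0 r c : 0 < r -> 0 < c -> (forall p, 0 <= f p) ->
  (forall p, inbox r r p0 p -> c <= f p) ->
  exists2 c', 0 < c' & \forall m \near \oo, c' <= Int m f.
Proof.
move=> r0 c0 f0 fc; exists (c * (r ^+ n * r ^+ n * r)).
  by rewrite mulr_gt0 // mulr_gt0 // mulr_gt0 // exprn_gt0.
have r20 : 0 < r / 2 by rewrite divr_gt0.
have term_le (F : 'I_n -> R) a : `|F a| <= \sum_b `|F b|.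
  by rewrite (bigD1 a) //= lerDl sumr_ge0.
pose B := \sum_a `|p0.1.1 0 a| + \sum_a `|p0.1.2 0 a| + `|p0.2| + r.
have sx : 0 <= \sum_a `|p0.1.1 0 a| by rewrite sumr_ge0.
have sy : 0 <= \sum_a `|p0.1.2 0 a| by rewrite sumr_ge0.
have st : 0 <= `|p0.2| by [].
near=> m.
have sm : step R m <= r / 2 by apply: ltW; near: m; exact: near_step.
have Bm : B <= m.+1%:R by near: m; exact: near_size.
apply: (@le_trans _ _ (c * Int m (fun p => (inbox r r p0 p)%:R))); last first.
  rewrite -IntZ; apply: Int_le => p; case: (boolP (inbox _ _ _ _)) => h; first by rewrite mulr1 fc.
  by rewrite mulr0.
apply: ler_wpM2l; first exact: ltW.
rewrite Int_box.
have hp (F : 'I_n -> R) : \sum_b `|F b| + r <= m.+1%:R ->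
    r ^+ n <= \prod_a \sum_(j < gsize m) (`|coord R m j - F a| <= r)%R%:R * step R m.
  move=> Fm; rewrite -[X in _ ^+ X]card_ord -prodr_const; apply: ler_prod => a _.
  rewrite (ltW r0) /=; apply: count_ge => //; apply: le_trans Fm.
  by rewrite lerD2r; exact: term_le.
have h1 := hp (fun a => p0.1.1 0 a); have h2 := hp (fun a => p0.1.2 0 a).
have rn : 0 <= r ^+ n by rewrite exprn_ge0 // ltW.
apply: ler_pM; [exact: mulr_ge0|exact: ltW| |].
- apply: ler_pM => //; [apply: h1|apply: h2]; apply: le_trans Bm; rewrite /B; lra.
- apply: count_ge => //; apply: le_trans Bm; rewrite /B; lra.
Unshelve. all: by end_near.
Qed.

Lemma ffun_shift_inj m a :
  injective (fun k : {ffun 'I_n -> 'I_(gsize m)} => [ffun b => if b == a then ordS (k b) else k b]).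
Proof.
move=> k k' /ffunP e; apply/ffunP => b; have := e b; rewrite !ffunE.
by case: ifP => // _; exact: ordS_inj.
Qed.

Lemma coord_ordS m (j : 'I_(gsize m)) :
  coord R m (ordS j) = coord R m j + step R m \/
  coord R m j = m.+1%:R /\ coord R m (ordS j) = - m.+1%:R.
Proof.
have [lt|ge] := ltnP j.+1 (gsize m).
  by left; rewrite -coordS /= modn_small.
have e : j.+1 = gsize m by apply/eqP; rewrite eqn_leq ltn_ord ge.
right; rewrite -[nat_of_ord j]/(j.+1.-1) [X in _ /\ coord _ _ X = _]/=.
by rewrite e modnn coord0 coord_max.
Qed.

Lemma sum_shift_ffun m (F : ('I_n -> R) -> R) a :
  (forall x, F x != 0 -> `|x a| < m.+1%:R) ->
  \sum_(k : {ffun 'I_n -> 'I_(gsize m)}) F (fun b => coord R m (k b)) =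
  \sum_(k : {ffun 'I_n -> 'I_(gsize m)}) F (fun b => coord R m (k b) + step R m * (b == a)%:R).
Proof.
move=> F0; rewrite (reindex_inj (@ffun_shift_inj m a)) /=; apply: eq_bigr => k _.
have Fz x : m.+1%:R <= `|x a| -> F x = 0.
  by move=> h; apply/eqP; apply: contraT => /F0; rewrite ltNge h.
have [e|[e1 e2]] := coord_ordS (k a).
  congr (F _); apply/funext => b; rewrite ffunE; case: eqP => [->|_].
    by rewrite e mulr1.
  by rewrite mulr0 addr0.
(* At the wrap-around the two coordinates compared are [- (m + 1)] and [m + 1 + step], both outside
   the support. *)
rewrite !Fz //.
- by rewrite eqxx mulr1 e1 ger0_norm ?lerDl ?addr_ge0 ?ler0n // ltW // step_gt0.
- by rewrite ffunE eqxx e2 normrN ger0_norm.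
Qed.

Lemma sum_shift_ord m (F : R -> R) :
  (forall x, F x != 0 -> `|x| < m.+1%:R) ->
  \sum_(k < gsize m) F (coord R m k) = \sum_(k < gsize m) F (coord R m k + step R m).
Proof.
move=> F0; rewrite (reindex_inj (@ordS_inj _)) /=; apply: eq_bigr => k _.
have Fz x : m.+1%:R <= `|x| -> F x = 0.
  by move=> h; apply/eqP; apply: contraT => /F0; rewrite ltNge h.
have [e|[e1 e2]] := coord_ordS k; first by rewrite -e.
rewrite !Fz //.
- by rewrite e1 ger0_norm ?lerDl ?addr_ge0 ?ler0n // ltW // step_gt0.
- by rewrite e2 normrN ger0_norm.
Qed.

Definition axis (e : V) := (exists a, e = (delta_mx 0 a, 0, 0)) \/
  (exists a, e = (0, delta_mx 0 a, 0)) \/ e = (0, 0, 1).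

Lemma sum_grid m (F : gridT m -> R) :
  \sum_k F k = \sum_k1 \sum_k2 \sum_k3 F (k1, k2, k3).
Proof. by rewrite pair_bigA pair_bigA; apply: eq_bigr => -[[]]. Qed.

(* Shifting the grid cyclically only loses values at points where [f] vanishes. *)
Lemma Int_shift m f e : axis e ->
  (forall p, f p != 0 -> inbox m%:R m%:R 0 p) ->
  Int m (fun p => f (p + step R m *: e)) = Int m f.
Proof.
move=> he f0; congr (_ * _).
have f0' p : f p != 0 -> [/\ forall a, `|p.1.1 0 a| < m.+1%:R,
    forall a, `|p.1.2 0 a| < m.+1%:R & `|p.2| < m.+1%:R].
  have lt (x : R) : x <= m%:R -> x < m.+1%:R by move=> h; apply: (le_lt_trans h); rewrite ltr_nat.
  move=> /f0/and3P[/forallP h1 /forallP h2 h3]; split=> [a|a|]; apply: lt.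
  - by have := h1 a; rewrite mxE subr0.
  - by have := h2 a; rewrite mxE subr0.
  - by move: h3; rewrite subr0.
rewrite !sum_grid.
case: he => [[a ->]|[[a ->]|->]].
- rewrite [LHS]exchange_big [RHS]exchange_big /=; apply: eq_bigr => k2 _.
  rewrite [LHS]exchange_big [RHS]exchange_big /=; apply: eq_bigr => k3 _.
  pose F (x : 'I_n -> R) := f (\row_b x b, \row_b coord R m (k2 b), coord R m k3).
  rewrite [RHS](@sum_shift_ffun m F a); last first.
    by move=> x /f0'[/(_ a)/=]; rewrite mxE.
  apply: eq_bigr => k1 _; rewrite /F /gpt /=; congr f.
  congr (_, _, _) => /=; rewrite ?scaler0 ?addr0 //.
  by apply/rowP => b; rewrite !mxE eqxx.
- apply: eq_bigr => k1 _.
  rewrite [LHS]exchange_big [RHS]exchange_big /=; apply: eq_bigr => k3 _.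
  pose F (x : 'I_n -> R) := f (\row_b coord R m (k1 b), \row_b x b, coord R m k3).
  rewrite [RHS](@sum_shift_ffun m F a); last first.
    by move=> x /f0'[_ /(_ a)/=]; rewrite mxE.
  apply: eq_bigr => k2 _; rewrite /F /gpt /=; congr f.
  congr (_, _, _) => /=; rewrite ?scaler0 ?addr0 //.
  by apply/rowP => b; rewrite !mxE eqxx.
- apply: eq_bigr => k1 _; apply: eq_bigr => k2 _.
  pose F (x : R) := f (\row_b coord R m (k1 b), \row_b coord R m (k2 b), x).
  rewrite [RHS](@sum_shift_ord m F); last by move=> x /f0'[].
  apply: eq_bigr => k3 _; rewrite /F /gpt /=; congr f.
  congr (_, _, _) => /=; rewrite ?scaler0 ?addr0 //.
  by rewrite [_ *: 1]mulr1.
Qed.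

End GridSum.

(** * Integration by parts along the coordinate axes *)

Section IntegrationByParts.
Variables (R : realType) (n : nat).
Local Notation V := (heis R n).
Implicit Types (f g : V -> R) (p : V) (m : nat) (r : R).

Lemma inbox_compact r r' : compact [set p : V | inbox r r' 0 p].
Proof.
have cI s : compact [set x : R | `|x| <= s].
  have -> : [set x : R | `|x| <= s] = `[- s, s]%classic.
    by apply/seteqP; split=> x /=; rewrite in_itv /= ler_norml.
  exact: segment_compact.
have cV s : compact [set v : 'rV[R]_n | forall a, [set x : R | `|x| <= s] (v 0 a)].
  exact: (@rV_compact R n (fun=> [set x : R | `|x| <= s]) (fun=> cI s)).
have := compact_setX (compact_setX (cV r) (cV r)) (cI r').
congr compact; apply/seteqP; split=> -[[x y] t] /=.
- move=> [[hx hy] ht]; apply/and3P; split; last by rewrite subr0.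
  + by apply/forallP => a; rewrite mxE subr0; exact: hx.
  + by apply/forallP => a; rewrite mxE subr0; exact: hy.
- move=> /and3P[/forallP hx /forallP hy ht].
  split; last by rewrite subr0 in ht.
  split=> a; first by have := hx a; rewrite mxE subr0.
  by have := hy a; rewrite mxE subr0.
Qed.

(** Compactness of the box in covering form: what holds for [s] near 0 around each point of the box
    holds for all small [s] on the whole box at once. *)
Lemma unif_cont_dir g e r eps : continuous g -> 0 < eps ->
  exists2 d, 0 < d & forall p s, inbox r r 0 p -> `|s| < d -> `|g (p + s *: e) - g p| < eps.
Proof.
move=> cg eps0.
have /compact_near_coveringP cK := @inbox_compact r r.
pose Q (s : R) p := `|g (p + s *: e) - g p| < eps.
have [] := cK R (nbhs (0 : R)) Q _.
  move=> p _.
  have cG : continuous (fun z : V * R => g (z.1 + z.2 *: e) - g z.1).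
    move=> z; apply: cvgB.
      apply: (@continuous_comp _ _ _ (fun z : V * R => z.1 + z.2 *: e) g); last exact: cg.
      apply: cvgD; first exact: cvg_fst.
      by apply: cvgZr_tmp; exact: cvg_snd.
    apply: (@continuous_comp _ _ _ (fun z : V * R => z.1) g); [exact: cvg_fst|exact: cg].
  have h : `|g (p + (0 : R) *: e) - g p| < eps by rewrite scale0r addr0 subrr normr0.
  exact: (cvgr_norm_lt _ (cG (p, 0)) _ h).
move=> d /= d0 hd; exists d => // p s hp sd.
by apply: hd => //=; rewrite sub0r normrN.
Qed.

Lemma inbox_shift e r s p : axis e -> `|s| <= 1 -> inbox r r 0 (p + s *: e) -> inbox (r + 1) (r + 1) 0 p.
Proof.
move=> he s1 /and3P[/forallP h1 /forallP h2 h3].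
have tri (x y : R) : `|y| <= 1 -> `|x + s * y - 0| <= r -> `|x - 0| <= r + 1.
  move=> y1; rewrite !subr0 => h; rewrite -[x](addrK (s * y)).
  by apply: (le_trans (ler_normB _ _)); rewrite lerD // normrM mulr_ile1.
have e1 : [/\ forall a, `|e.1.1 0 a| <= 1, forall a, `|e.1.2 0 a| <= 1 & `|e.2| <= 1].
  have z1 : `|0 : R| <= 1 by rewrite normr0.
  have b1 (b : bool) : `|b%:R : R| <= 1 by case: b; rewrite ?normr1 ?normr0.
  by case: he => [[a ->]|[[a ->]|->]]; split=> [b|b|]; rewrite /= ?mxE ?normr1.
case: e1 => ea eb ec; apply/and3P; split.
- apply/forallP => a; rewrite mxE; apply: (tri _ (e.1.1 0 a)) => //.
  by have := h1 a; rewrite !mxE.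
- apply/forallP => a; rewrite mxE; apply: (tri _ (e.1.2 0 a)) => //.
  by have := h2 a; rewrite !mxE.
- exact: (tri _ e.2).
Qed.

Lemma inbox_mono r r' p : r <= r' -> inbox r r 0 p -> inbox r' r' 0 p.
Proof.
move=> rr /and3P[/forallP h1 /forallP h2 h3]; apply/and3P; split.
- by apply/forallP => a; exact: le_trans rr.
- by apply/forallP => a; exact: le_trans rr.
- exact: le_trans rr.
Qed.

(* The difference quotient of [g] has sum 0 by shift invariance, and is uniformly close to ['D_e g]. *)
Lemma ibp_axis g e r : axis e -> 0 <= r ->
  (forall p, differentiable g p) -> continuous ('D_e g) ->
  (forall p, ~~ inbox r r 0 p -> g p = 0 /\ 'D_e g p = 0) ->
  forall eps, 0 < eps -> \forall m \near \oo, `|Int m ('D_e g)| <= eps.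
Proof.
move=> he r0 dg; set g' := 'D_e g => cg' g0 eps eps0.
pose vol : R := (2 * (r + 1) + 1) ^+ (n + n) * (2 * (r + 1) + 1).
have vol0 : 0 < vol by rewrite mulr_gt0 ?exprn_gt0 //; lra.
have [d d0 hd] := unif_cont_dir e (r + 1) cg' (divr_gt0 eps0 vol0).
near=> m.
have s0 := step_gt0 R m; have s1 := step_le1 R m.
have sd : step R m < d by near: m; exact: near_step.
have rm : r <= m%:R by near: m; exact: nbhs_infty_ger.
have sh : Int m (fun p => g (p + step R m *: e)) = Int m g.
  apply: Int_shift => // p gp; apply: (inbox_mono rm).
  by apply: contraT => /g0[gz _]; rewrite gz eqxx in gp.
have -> : Int m g' = Int m (fun p => g' p - (step R m)^-1 * (g (p + step R m *: e) - g p)).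
  by rewrite IntB IntZ IntB sh subrr mulr0 subr0.
apply: (le_trans (Int_norm _ _)).
apply: (@le_trans _ _ (Int m (fun p => eps / vol * (inbox (r + 1) (r + 1) 0 p)%:R))).
  apply: Int_le => p; case: (boolP (inbox _ _ _ _)) => hp.
    have [t /andP[t0 ts] ->] := mvt_line p e dg (ltW s0).
    rewrite mulr1 mulrA mulVf ?gt_eqF // mul1r distrC ltW //.
    by apply: hd => //; rewrite ger0_norm // (le_lt_trans ts).
  have [hp1 hp2] : ~~ inbox r r 0 (p + step R m *: e) /\ ~~ inbox r r 0 p.
    split; apply: contra hp; last by apply: inbox_mono; rewrite lerDl.
    by apply: inbox_shift => //; rewrite ger0_norm // ltW.
  rewrite (g0 _ hp1).1 (g0 _ hp2).1 /g' (g0 _ hp2).2 mulr0 subrr mulr0 subr0 normr0.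
  by [].
rewrite IntZ (@le_trans _ _ (eps / vol * vol)) //.
  by rewrite ler_wpM2l //; [rewrite divr_ge0 // ltW|apply: vol_le; lra].
by rewrite mulfVK ?gt_eqF.
Unshelve. all: by end_near.
Qed.

End IntegrationByParts.

(** * Continuously differentiable cutoffs from positive parts *)

Section PositivePart.
Variable R : realType.
Implicit Types x : R.

Definition posn x : R := Num.max x 0.

Lemma posn_ge0 x : 0 <= posn x. Proof. by rewrite /posn le_max lexx orbT. Qed.

Lemma posn_continuous : continuous posn.
Proof. by move=> x; apply: continuous_max; [exact: cvg_id|exact: cvg_cst]. Qed.

Lemma posn0 : posn 0 = 0. Proof. exact: maxxx. Qed.

Lemma posnX_quotient k x : x != 0 -> x^-1 * posn x ^+ k.+2 = posn x ^+ k.+1.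
Proof.
move=> x0; have [xl|xg] := leP x 0; first by rewrite /posn (max_idPr xl) !expr0n /= mulr0.
by rewrite /posn (max_idPl (ltW xg)) [x ^+ k.+2]exprS mulKf.
Qed.

(** At 0 the difference quotient is [posn h ^ k.+1] itself, which tends to 0. An exponent of at
    least 2 is what turns a positive part into a cutoff that can be differentiated once. *)
Lemma is_derive1_posnX k x :
  is_derive x 1 (fun x => posn x ^+ k.+2) (k.+2%:R * posn x ^+ k.+1).
Proof.
have [x0|x0|->] := ltgtP x 0.
- have -> : k.+2%:R * posn x ^+ k.+1 = 0.
    by rewrite /posn (max_idPr (ltW x0)) expr0n mulr0.
  apply: (@near_eq_is_derive _ _ _ (cst 0)).
  near=> y; have y0 : y < 0 by near: y; exact: lt_nbhsl.
  by rewrite /posn (max_idPr (ltW y0)) expr0n.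
- have -> : k.+2%:R * posn x ^+ k.+1 = (k.+2%:R * id x ^+ k.+1) *: (1 : R).
    by rewrite /posn (max_idPl (ltW x0)) [_ *: 1]mulr1.
  apply: (@near_eq_is_derive _ _ _ ((id : R -> R) ^+ k.+2)).
    near=> y; have y0 : 0 < y by near: y; exact: lt_nbhsr.
    by rewrite /posn (max_idPl (ltW y0)) !fctE.
- have c0 : (fun h : R => h^-1 *: (((fun x => posn x ^+ k.+2) \o shift 0) (h *: 1) - posn 0 ^+ k.+2)) @ 0^' --> (0 : R).
    have c : (fun h : R => posn h ^+ k.+1) @ 0^' --> (0 : R).
      apply: cvg_within_filter.
      have c1 : {for 0, continuous (fun h : R => posn h ^+ k.+1)}.
        apply: (@continuous_comp _ _ _ posn (fun y => y ^+ k.+1)); first exact: posn_continuous.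
        exact: exprn_continuous.
      by move: c1; rewrite /prop_for /continuous_at posn0 expr0n.
    apply: cvg_trans c; apply: near_eq_cvg; near=> h.
    have hq : h^-1 * posn h ^+ k.+2 = posn h ^+ k.+1.
      by apply: posnX_quotient; near: h; exact: nbhs_dnbhs_neq.
    rewrite /= addr0 [h *: 1]mulr1 posn0 [0 ^+ k.+2]expr0n subr0.
    exact: esym hq.
  rewrite posn0 expr0n mulr0.
  apply: DeriveDef; first by apply/cvg_ex; exists 0.
  exact: cvg_lim c0.
Unshelve. all: by end_near.
Qed.

End PositivePart.

Lemma norm3_le (R : realFieldType) (x y z e : R) :
  `|x| <= e / 3 -> `|y| <= e / 3 -> `|z| <= e / 3 -> `|x + y + z| <= e.
Proof. by rewrite !ler_norml; lra. Qed.

Section CutoffIBP.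
Variables (R : realType) (n : nat).
Local Notation V := (heis R n).
Variables (b : V -> R) (sb : smth b) (r : R).
Hypothesis r0 : 0 <= r.
Hypothesis b_supp : forall p, 0 < b p -> inbox r r 0 p.

Definition pb p := posn (b p).

Lemma pb_out p : ~~ inbox r r 0 p -> pb p = 0.
Proof.
move=> h; apply/max_idPr; rewrite leNgt; apply: contra h; exact: b_supp.
Qed.

Lemma pb_continuous : continuous pb.
Proof.
move=> p; apply: (@continuous_comp _ _ _ b (@posn R)); first exact: smth_continuous.
exact: posn_continuous.
Qed.

Lemma pbX_continuous k : continuous (fun p => pb p ^+ k).
Proof.
move=> p; apply: (@continuous_comp _ _ _ pb (fun y => y ^+ k)); first exact: pb_continuous.
exact: exprn_continuous.
Qed.

Lemma deriv_pbX k p v : differentiable (fun q => pb q ^+ k.+2) p /\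
  'D_v (fun q => pb q ^+ k.+2) p = k.+2%:R * pb p ^+ k.+1 * 'D_v b p.
Proof.
have h := is_derive1_posnX k (b p).
have [d e] := @deriv_comp1 R V (fun x => posn x ^+ k.+2) b p v
  (@ex_derive _ _ _ _ _ _ _ h) (smth_diff p sb).
split; first exact: d.
by rewrite [LHS]e derive1E (@derive_val _ _ _ _ _ _ _ h).
Qed.

(** The product rule for [F * pb ^ k.+2]: an interior term plus the flux through the cutoff. As the
    derivative of a compactly supported function it has negligible Riemann sums. *)
Definition ibpt k (F : V -> R) e p :=
  'D_e F p * pb p ^+ k.+2 + k.+2%:R * (pb p ^+ k.+1 * (F p * 'D_e b p)).

Lemma ibp_real (F : V -> R) e k : smth F -> axis e -> forall eps : R, 0 < eps ->
  \forall m \near \oo,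
   `|Int m (ibpt k F e)| <= eps.
Proof.
move=> sF he eps eps0.
pose g := F * (fun q => pb q ^+ k.+2).
have dg p : differentiable g p.
  by apply: differentiableM; [exact: smth_diff|have [] := deriv_pbX k p 0].
have Dg : 'D_e g = ibpt k F e.
  apply/funext => p; rewrite /ibpt; have [d1 e1] := deriv_pbX k p e.
  rewrite (deriveM (@smth_derivable _ _ F p e sF) (@diff_derivable _ _ _ _ p e d1)) e1.
  have sE (x y : R) : x *: y = x * y by [].
  rewrite !sE; move: ('D_e F p) ('D_e b p) => x y; ring.
rewrite -Dg; apply: (@ibp_axis _ _ g e r) => //.
  rewrite Dg /ibpt => p; apply: cvgD.
    by apply: cvgM; [exact: smth_continuous (smthD1 e sF) p|exact: pbX_continuous].
  apply: cvgM; first exact: cvg_cst.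
  apply: cvgM; first exact: pbX_continuous.
  by apply: cvgM; [exact: smth_continuous sF p|exact: smth_continuous (smthD1 e sb) p].
move=> p hp; have z := pb_out hp; split.
  by rewrite /g !fctE z expr0n mulr0.
have /= -> := congr1 (fun h => h p) Dg.
rewrite /ibpt.
by rewrite z !expr0n /= !(mulr0, mul0r) addr0.
Qed.

Definition ibpf k (D : V -> R) (B : V -> R) p := D p * pb p ^+ k.+2 + k.+2%:R * (pb p ^+ k.+1 * B p).

Lemma axis_ex (a : 'I_n) : axis (ex R a). Proof. by left; exists a. Qed.
Lemma axis_ey (a : 'I_n) : axis (ey R a). Proof. by right; left; exists a. Qed.
Lemma axis_et : axis (et R n). Proof. by right; right. Qed.

Lemma ibp_Zb (X : csm V) a k : forall eps : R, 0 < eps -> \forall m \near \oo,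
  `|Int m (ibpf k (cRe (ZbA a X)) (cRe (X * ZbA a (creal sb))))| <= eps.
Proof.
move=> eps eps0; have e3 : 0 < eps / 3 by rewrite divr_gt0.
pose F1 : csm V := half R n * X.
pose F2 : csm V := half R n * ci R n * X.
pose F3 : csm V := - (ci R n * zc R a * X).
have h1 := ibp_real k (smth_cRe F1) (axis_ex a) e3.
have h2 := ibp_real k (smth_cRe F2) (axis_ey a) e3.
have h3 := ibp_real k (smth_cRe F3) axis_et e3.
apply: filterS3 h1 h2 h3 => m h1 h2 h3.
have -> : ibpf k (cRe (ZbA a X)) (cRe (X * ZbA a (creal sb))) =
  (fun p => ibpt k (cRe F1) (ex R a) p + ibpt k (cRe F2) (ey R a) p + ibpt k (cRe F3) (et R n) p).
  (* The coefficient [zc a] does not depend on [t], so [Zb a] is in divergence form and its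
     coefficients move inside the derivatives. *)
  have e1 : ZbA a X = DD (ex R a) F1 + DD (ey R a) F2 + DD (et R n) F3.
    rewrite /ZbA /F1 /F2 /F3 raddfN /= !DDM !DD_half !DD_ci DD_zc_et; ring.
  have e2 : X * ZbA a (creal sb) = F1 * DD (ex R a) (creal sb) + F2 * DD (ey R a) (creal sb)
      + F3 * DD (et R n) (creal sb).
    rewrite /ZbA /F1 /F2 /F3; ring.
  have e4 (F : csm V) v p : cRe (F * DD v (creal sb)) p = cRe F p * 'D_v b p.
    rewrite cReM DD_creal !fctE [cIm (creal _) p]/(0 : R) mulr0 subr0; reflexivity.
  apply/funext => p; rewrite /ibpf e1 e2 !cRe_add !e4 !cRe_DD /ibpt.
  move: ('D_ _ b p) ('D_ _ b p) ('D_ _ b p) => x1 x2 x3.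
  move: ('D_ _ _ p) ('D_ _ _ p) ('D_ _ _ p) => y1 y2 y3; ring.
rewrite (IntD m (fun p => ibpt k (cRe F1) (ex R a) p + ibpt k (cRe F2) (ey R a) p) (ibpt k (cRe F3) (et R n))).
rewrite (IntD m (ibpt k (cRe F1) (ex R a)) (ibpt k (cRe F2) (ey R a))).
exact: norm3_le h1 h2 h3.
Qed.

Lemma ibp_div (X : 'I_n -> csm V) k : forall eps : R, 0 < eps -> \forall m \near \oo,
  `|Int m (ibpf k (cRe (\sum_a ZbA a (X a))) (cRe (\sum_a X a * ZbA a (creal sb))))| <= eps.
Proof.
move=> eps eps0.
have en : 0 < eps / n.+1%:R by rewrite divr_gt0.
have : \forall m \near \oo, forall a, `|Int m (ibpf k (cRe (ZbA a (X a))) (cRe (X a * ZbA a (creal sb))))| <= eps / n.+1%:R.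
  by apply: filter_forall => a; exact: ibp_Zb.
apply: filterS => m hm.
have -> : ibpf k (cRe (\sum_a ZbA a (X a))) (cRe (\sum_a X a * ZbA a (creal sb))) =
  (fun p => \sum_a ibpf k (cRe (ZbA a (X a))) (cRe (X a * ZbA a (creal sb))) p).
  apply/funext => p; rewrite /ibpf !cRe_sum mulr_suml mulr_sumr mulr_sumr -big_split /=.
  by apply: eq_bigr => a _.
rewrite Int_sum (le_trans (ler_norm_sum _ _ _)) //.
apply: (@le_trans _ _ (\sum_(a < n) eps / n.+1%:R)); first by apply: ler_sum => a _; exact: hm.
rewrite sumr_const card_ord -[_ *+ n]mulr_natr mulrAC ler_pdivrMr // ler_pM2l // ler_nat.
exact: leqnSn.
Qed.

End CutoffIBP.

(** * Growth estimates *)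

Section Scalars.
Variable R : realFieldType.
Implicit Types (x y A B c T K : R).

Lemma young T A B c : 0 < c -> 0 <= A -> 0 <= B -> T ^+ 2 <= A * B ->
  `|T| <= (c * A + B / c) / 2.
Proof.
move=> c0 A0 B0 h.
have e : c * (B / c) = B by rewrite mulrCA mulfV ?gt_eqF // mulr1.
have Bc : 0 <= B / c by rewrite divr_ge0 // ltW.
rewrite -(@ler_pXn2r _ 2) ?nnegrE //; last by rewrite divr_ge0 // addr_ge0 // mulr_ge0 // ltW.
rewrite real_normK ?num_real //; apply: (le_trans h).
have -> : A * B = (c * A) * (B / c) by rewrite -{1}e; ring.
move: (c * A) (B / c) => X Y; have := sqr_ge0 (X - Y); nra.
Qed.

Lemma pow_young x y K j e : 0 <= x -> 0 <= y -> 0 <= K ->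
  K * y ^+ e * x ^+ j <= K * (x ^+ (j + e) + y ^+ (j + e)).
Proof.
move=> x0 y0 K0; rewrite -mulrA ler_wpM2l // !exprD [y ^+ e * _]mulrC.
have [xy|xy] := lerP x y.
  have : x ^+ j * y ^+ e <= y ^+ j * y ^+ e by rewrite ler_wpM2r ?exprn_ge0 // lerXn2r.
  have : 0 <= x ^+ j * x ^+ e by rewrite mulr_ge0 // exprn_ge0.
  lra.
have : x ^+ j * y ^+ e <= x ^+ j * x ^+ e by rewrite ler_wpM2l ?exprn_ge0 // lerXn2r // ltW.
have : 0 <= y ^+ j * y ^+ e by rewrite mulr_ge0 // exprn_ge0.
lra.
Qed.

Lemma pow_young_half K j : 0 <= K -> exists2 K', 0 <= K' & forall x y, 0 <= x -> 0 <= y ->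
  K * y ^+ 2 * x ^+ j <= x ^+ j.+2 / 2 + K' * y ^+ j.+2.
Proof.
(* Below the threshold [(2 K + 1) y] the variable [x] is replaced by this bound; above it
   [2 K y ^ 2 <= x ^ 2], and half of [x ^ (j + 2)] absorbs the left side. *)
move=> K0; exists (K * (2 * K + 1) ^+ j) => [|x y x0 y0].
  by rewrite mulr_ge0 // exprn_ge0 //; lra.
have xj : 0 <= x ^+ j by rewrite exprn_ge0.
have xj2 : 0 <= x ^+ j.+2 by rewrite exprn_ge0.
have [h|h] := lerP x ((2 * K + 1) * y).
  have : K * y ^+ 2 * x ^+ j <= K * y ^+ 2 * ((2 * K + 1) * y) ^+ j.
    by apply: ler_wpM2l; [rewrite mulr_ge0 // exprn_ge0|rewrite lerXn2r // nnegrE mulr_ge0 //; lra].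
  rewrite exprMn -[j.+2]addn2 [y ^+ (j + 2)]exprD => h1.
  have h2 : 0 <= x ^+ (j + 2) by rewrite exprn_ge0.
  move: h1 h2; move: (x ^+ (j + 2)) (K * y ^+ 2 * x ^+ j) => u w.
  by move: ((2 * K + 1) ^+ j) (y ^+ j) (y ^+ 2) => a b c; lra.
have : K * y ^+ 2 * x ^+ j <= x ^+ 2 / 2 * x ^+ j.
  apply: ler_wpM2r => //.
  have : ((2 * K + 1) * y) ^+ 2 <= x ^+ 2.
    by rewrite lerXn2r ?nnegrE // ?mulr_ge0 //; lra.
  have : 0 <= y ^+ 2 by exact: sqr_ge0.
  rewrite exprMn; have : 2 * K <= (2 * K + 1) ^+ 2 by nra.
  move: (y ^+ 2) (x ^+ 2) ((2 * K + 1) ^+ 2) => a b c; nra.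
have -> : x ^+ 2 / 2 * x ^+ j = x ^+ j.+2 / 2 by rewrite -[j.+2]addn2 exprD; ring.
have : 0 <= K * (2 * K + 1) ^+ j * y ^+ j.+2.
  by apply: mulr_ge0; [apply: mulr_ge0 => //; apply: exprn_ge0; lra|exact: exprn_ge0].
lra.
Qed.

End Scalars.

(** * Pointwise inequalities behind the growth estimates *)

Section Pointwise.
Variable R : realFieldType.
Variable d : nat.
Local Notation D := (d + d)%N.
Implicit Types (b v q f T U y M a Lam : R).

Lemma ge1S j : 1 <= (j.+1)%:R :> R. Proof. by rewrite ler1n. Qed.

Lemma flux_absorb k b q T y : 0 < k -> 0 <= q -> T ^+ 2 <= q * (4 * y ^+ 2) ->
  k * `|b * T| <= b ^+ 2 * q / 2 + 2 * k ^+ 2 * y ^+ 2.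
Proof.
move=> k0 q0 hT.
have hb : `|b * T| <= (k^-1 * (b ^+ 2 * q) + 4 * y ^+ 2 / k^-1) / 2.
  apply: young; first by rewrite invr_gt0.
  - by rewrite mulr_ge0 // sqr_ge0.
  - by rewrite mulr_ge0 // sqr_ge0.
  by rewrite exprMn -mulrA ler_wpM2l // sqr_ge0.
rewrite invrK in hb.
apply: (@le_trans _ _ (k * ((k^-1 * (b ^+ 2 * q) + 4 * y ^+ 2 * k) / 2))).
  by rewrite ler_pM2l.
by rewrite le_eqVlt; apply/orP; left; apply/eqP; field; rewrite gt_eqF.
Qed.

(* Each of the following bounds an integrand by the corresponding integration by parts integrand
   plus terms already controlled; [T], [U] are the fluxes through the cutoff, [y] is [1 / L] on
   the support of the cutoff. *)
Lemma bump_energy_pointwise : exists2 K : R, 0 <= K & forall b v q T y, 0 <= b -> 0 < v -> 0 <= q -> 0 <= y ->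
  T ^+ 2 <= q * (4 * y ^+ 2) ->
  b ^+ d.+3 * (v ^+ d.+1 * (q + v ^+ 2)) <=
  - 4 * (v ^+ d.+1 * ((d.+1%:R - d.+2%:R) * q - d.+2%:R * v ^+ 2) * b ^+ d.+3
         + d.+3%:R * (b ^+ d.+2 * (v ^+ d.+1 * T))) + K * y ^+ d.+3.
Proof.
have [K' K'0 hK] := @pow_young_half R (4 * d.+3%:R ^+ 2) d.+1 (mulr_ge0 (ler0n _ _) (sqr_ge0 _)).
exists (2 * K') => [|b v q T y b0 v0 q0 y0 hT]; first by rewrite mulr_ge0.
have := hK (b * v) y (mulr_ge0 b0 (ltW v0)) y0.
have e3 : b ^+ d.+3 = b ^+ 2 * b ^+ d.+1 by rewrite -exprD.
have e2 : b ^+ d.+2 = b * b ^+ d.+1 by rewrite exprS.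
set w := (b * v) ^+ d.+1; have w0 : 0 <= w by rewrite exprn_ge0 // mulr_ge0 // ltW.
have -> : (b * v) ^+ d.+3 = w * (b * v) ^+ 2 by rewrite -exprD addn2.
have -> : b ^+ d.+3 * (v ^+ d.+1 * (q + v ^+ 2)) = w * (b ^+ 2 * (q + v ^+ 2)).
  by rewrite e3 /w exprMn; ring.
have -> : v ^+ d.+1 * ((d.+1%:R - d.+2%:R) * q - d.+2%:R * v ^+ 2) * b ^+ d.+3
         + d.+3%:R * (b ^+ d.+2 * (v ^+ d.+1 * T)) =
   w * (d.+3%:R * (b * T) - b ^+ 2 * (q + d.+2%:R * v ^+ 2)).
  (* At weight exponent [n - 1] the coefficient of [q] is -1, of the same sign as that of [v ^ 2],
     so the divergence controls both terms. *)
  have -> : d.+1%:R - d.+2%:R = -1 :> R by rewrite -[d.+2]addn1 natrD; ring.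
  by rewrite e3 e2 /w exprMn; ring.
have N0 : 0 < d.+3%:R :> R by rewrite ltr0n.
have hb2 : d.+3%:R * (b * T) <= b ^+ 2 * q / 2 + 2 * d.+3%:R ^+ 2 * y ^+ 2.
  by apply: (le_trans _ (flux_absorb b N0 q0 hT)); rewrite ler_pM2l // ler_norm.
have vN : v ^+ 2 <= d.+2%:R * v ^+ 2 by rewrite ler_peMl ?sqr_ge0 // ge1S.
have q2 : 0 <= b ^+ 2 * v ^+ 2 by rewrite mulr_ge0 ?sqr_ge0.
have vN' : b ^+ 2 * v ^+ 2 <= b ^+ 2 * (d.+2%:R * v ^+ 2) by rewrite ler_wpM2l ?sqr_ge0.
have q3 : 0 <= b ^+ 2 * q by rewrite mulr_ge0 ?sqr_ge0.
have {hb2} main : b ^+ 2 * (q + v ^+ 2) / 2 + (b * v) ^+ 2 / 2 <= - 2 * (d.+3%:R * (b * T) - b ^+ 2 * (q + d.+2%:R * v ^+ 2))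
   + 4 * d.+3%:R ^+ 2 * y ^+ 2.
  rewrite exprMn; move: hb2 vN' q2 q3; move: (d.+2%:R) (d.+3%:R ^+ 2) (d.+3%:R * (b * T)) => ? ? ?; lra.
have := ler_wpM2l w0 main.
have := mulr_ge0 w0 q3; have := mulr_ge0 w0 q2.
have -> : b ^+ 2 * (q + v ^+ 2) = b ^+ 2 * q + b ^+ 2 * v ^+ 2 by ring.
rewrite exprMn mulrDr.
move: (d.+3%:R * (b * T) - _) (4 * d.+3%:R ^+ 2 * y ^+ 2) (y ^+ d.+3) => A B C.
move: (b ^+ 2 * q) (b ^+ 2 * v ^+ 2) => X Y; lra.
Qed.

(** At weight exponent [n] the coefficient of [q] vanishes, so the power of [b v] is paid for by the
    flux alone; and [v T <= y (q + v ^ 2)] makes the flux [y] times the energy density of the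
    preceding bound. *)
Lemma bump_pow_pointwise b v q T y : 0 <= b -> 0 < v -> 0 <= q -> 0 <= y ->
  T ^+ 2 <= q * (4 * y ^+ 2) ->
  (b * v) ^+ d.+4 <=
  - (v ^+ d.+2 * ((d.+2%:R - d.+2%:R) * q - d.+2%:R * v ^+ 2) * b ^+ d.+4
         + d.+4%:R * (b ^+ d.+3 * (v ^+ d.+2 * T)))
  + d.+4%:R * y * (b ^+ d.+3 * (v ^+ d.+1 * (q + v ^+ 2))).
Proof.
move=> b0 v0 q0 y0 hT.
have qv0 : 0 <= q + v ^+ 2 by rewrite addr_ge0 // sqr_ge0.
have vT : `|v * T| <= y * (q + v ^+ 2).
  rewrite -(@ler_pXn2r _ 2) ?nnegrE ?mulr_ge0 // real_normK ?num_real // exprMn.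
  apply: (@le_trans _ _ (v ^+ 2 * (q * (4 * y ^+ 2)))); first by rewrite ler_wpM2l // sqr_ge0.
  rewrite exprMn; have := mulr_ge0 (sqr_ge0 y) (sqr_ge0 (q - v ^+ 2)).
  by move: (v ^+ 2) (y ^+ 2) => V Y; lra.
have w0 : 0 <= (b * v) ^+ d.+1 by rewrite exprn_ge0 // mulr_ge0 // ltW.
have e4 : b ^+ d.+4 = b ^+ 3 * b ^+ d.+1 by rewrite -exprD.
have e3 : b ^+ d.+3 = b ^+ 2 * b ^+ d.+1 by rewrite -exprD.
have e5 : v ^+ d.+2 = v * v ^+ d.+1 by rewrite exprS.
have -> : (b * v) ^+ d.+4 = (b * v) ^+ d.+1 * (b * v) ^+ 3 by rewrite -exprD addn3.
rewrite e4 e3 e5.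
rewrite [leRHS](_ : _ = (b * v) ^+ d.+1 * (d.+2%:R * (b * v) ^+ 3
   + d.+4%:R * (y * (q + v ^+ 2) - v * T) * b ^+ 2)); last by rewrite !exprMn; ring.
apply: ler_wpM2l => //.
have h1 : 0 <= d.+4%:R * (y * (q + v ^+ 2) - v * T) * b ^+ 2.
  apply: mulr_ge0; last exact: sqr_ge0.
  by apply: mulr_ge0; [exact: ler0n|rewrite subr_ge0 (le_trans (ler_norm _))].
have h2 : (b * v) ^+ 3 <= d.+2%:R * (b * v) ^+ 3.
  by rewrite ler_peMl ?ge1S // exprn_ge0 // mulr_ge0 // ltW.
lra.
Qed.

(** At weight exponent [2 n] the coefficients of [q] and [v ^ 2] are [n] and [- n]: the gradient
    term is bounded by the critical power. *)
Lemma bump_vq_pointwise : exists2 K : R, 0 <= K & forall b v q T y, 0 <= b -> 0 < v -> 0 <= q -> 0 <= y ->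
  T ^+ 2 <= q * (4 * y ^+ 2) ->
  b ^+ D.+4.+2 * (v ^+ D.+4 * q) <=
  (v ^+ D.+4 * ((D.+4%:R - d.+2%:R) * q - d.+2%:R * v ^+ 2) * b ^+ D.+4.+2
         + D.+4.+2%:R * (b ^+ D.+4.+1 * (v ^+ D.+4 * T)))
  + K * ((b * v) ^+ D.+4.+2 + y ^+ D.+4.+2).
Proof.
pose k : R := D.+4.+2%:R; have k0 : 0 < k by rewrite ltr0n.
exists (d.+2%:R + 2 * k ^+ 2) => [|b v q T y b0 v0 q0 y0 hT].
  by rewrite addr_ge0 // mulr_ge0 // sqr_ge0.
have x0 : 0 <= b * v by rewrite mulr_ge0 // ltW.
set w := (b * v) ^+ D.+4; have w0 : 0 <= w by rewrite exprn_ge0.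
have := @pow_young R (b * v) y (2 * k ^+ 2) D.+4 2 x0 y0 (mulr_ge0 (ler0n R 2) (sqr_ge0 k)).
rewrite addn2 -/w.
have e6 : b ^+ D.+4.+2 = b ^+ 2 * b ^+ D.+4 by rewrite -exprD.
have e5 : b ^+ D.+4.+1 = b * b ^+ D.+4 by rewrite exprS.
have eD : D.+4%:R - d.+2%:R = d.+2%:R :> R.
  by rewrite -[D.+4]/((D.+2).+2) -addnS -addSn -addnS -addSn natrD addrK.
have -> : (b * v) ^+ D.+4.+2 = w * (b ^+ 2 * v ^+ 2) by rewrite -exprMn -exprD addn2.
have -> : b ^+ D.+4.+2 * (v ^+ D.+4 * q) = w * (b ^+ 2 * q) by rewrite e6 /w exprMn; ring.
rewrite -/k eD.
have -> : v ^+ D.+4 * (d.+2%:R * q - d.+2%:R * v ^+ 2) * b ^+ D.+4.+2 +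
   k * (b ^+ D.+4.+1 * (v ^+ D.+4 * T)) = w * (d.+2%:R * (b ^+ 2 * q) - d.+2%:R * (b ^+ 2 * v ^+ 2) + k * (b * T)).
  by rewrite e6 e5 /w exprMn; ring.
have hb := flux_absorb b k0 q0 hT.
have hb' : - (k * (b * T)) <= k * `|b * T| by rewrite -mulrN ler_pM2l // -normrN ler_norm.
have X0 : 0 <= b ^+ 2 * q by rewrite mulr_ge0 // sqr_ge0.
have V0 : 0 <= b ^+ 2 * v ^+ 2 by rewrite mulr_ge0 // sqr_ge0.
have NX : 2 * (b ^+ 2 * q) <= d.+2%:R * (b ^+ 2 * q) by rewrite ler_wpM2r // (ler_nat _ 2).
have main : b ^+ 2 * q <= d.+2%:R * (b ^+ 2 * q) - d.+2%:R * (b ^+ 2 * v ^+ 2) + k * (b * T)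
    + d.+2%:R * (b ^+ 2 * v ^+ 2) + 2 * k ^+ 2 * y ^+ 2.
  move: hb hb' NX X0; move: (d.+2%:R * (b ^+ 2 * v ^+ 2)) (k * (b * T)) => ? ?.
  move: (d.+2%:R * (b ^+ 2 * q)) (k * `|b * T|) (k ^+ 2 * y ^+ 2) => ? ? ?; lra.
have := ler_wpM2l w0 main.
have y60 : 0 <= y ^+ D.+4.+2 by exact: exprn_ge0.
have : 0 <= d.+2%:R * y ^+ D.+4.+2 by rewrite mulr_ge0.
have := mulr_ge0 w0 V0.
move: (k * (b * T)) (y ^+ D.+4.+2) => ? ?; move: (d.+2%:R) (k ^+ 2) => ? ?.
move: (b ^+ 2 * q) (b ^+ 2 * v ^+ 2) => ? ?; lra.
Qed.

(** The hypothesis on [b ^ 2] says, without a case distinction, that [y ^ 2] is [1 / Lam] on the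
    support of the cutoff. The weight of Young's inequality is set to leave a share [del * Lam] of
    the density [M]. *)
Lemma tensor_absorb del b q M a y Lam c : 0 < del -> 0 < Lam -> 0 <= q -> 0 <= M -> 0 <= c ->
  b ^+ 2 = b ^+ 2 * (Lam * y ^+ 2) -> a ^+ 2 <= c * (q * M) ->
  `|b ^+ 4 * a| <= del * Lam * (b ^+ 6 * M) + c / (4 * del) * (b ^+ 2 * q * y ^+ 2).
Proof.
move=> d0 L0 q0 M0 c0 hb ha.
have b6 : 0 <= b ^+ 6 * M by rewrite mulr_ge0 // (exprM b 3 2) sqr_ge0.
apply: (@le_trans _ _ ((2 * del * Lam * (b ^+ 6 * M) + c * (b ^+ 2 * q) / (2 * del * Lam)) / 2)).
  apply: young => //.
  - by rewrite !mulr_gt0.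
  - by rewrite mulr_ge0 // mulr_ge0 // sqr_ge0.
  have -> : b ^+ 6 * M * (c * (b ^+ 2 * q)) = (b ^+ 4) ^+ 2 * (c * (q * M)) by ring.
  by rewrite exprMn ler_wpM2l // sqr_ge0.
have -> : b ^+ 2 * q * y ^+ 2 = b ^+ 2 * q / Lam.
  by rewrite [in RHS]hb; field; rewrite gt_eqF.
by rewrite le_eqVlt; apply/orP; left; apply/eqP; field; rewrite !gt_eqF.
Qed.

(** In the divergence of [v ^ (2 n - 2) q grad f] the term [q ^ 2] has coefficient [n - 1 > 0]. The
    mixed term is the quantity of [bump_vq_pointwise], and the contracted tensors [a] cost a small
    multiple of [M]. *)
Lemma bump_qsq_pointwise del : 0 < del -> exists2 K : R, 0 <= K & forall b v q T y a M Lam,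
  0 <= b -> 0 < v -> 0 <= q -> 0 <= y -> 0 <= M -> 0 < Lam ->
  T ^+ 2 <= q * (4 * y ^+ 2) -> a ^+ 2 <= 10 * (q * M) -> b ^+ 2 = b ^+ 2 * (Lam * y ^+ 2) ->
  b ^+ D.+4.+2 * (v ^+ D.+2 * q ^+ 2) <=
  4 * (v ^+ D.+2 * (d.+1%:R * q ^+ 2 - d.+3%:R * (q * v ^+ 2) + a) * b ^+ D.+4.+2
         + D.+4.+2%:R * (b ^+ D.+4.+1 * (v ^+ D.+2 * (q * T))))
  + 4 * d.+3%:R * (b ^+ D.+4.+2 * (v ^+ D.+4 * q))
  + 4 * del * Lam * (b ^+ D.+4.+4 * (v ^+ D.+2 * M))
  + K * ((b * v) ^+ D.+4.+2 + y ^+ D.+4.+2).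
Proof.
move=> del0; pose k : R := D.+4.+2%:R; have k0 : 0 < k by rewrite ltr0n.
(* Four times the constants that arise from completing the squares in [i2] and [i1]. *)
pose K0 := 32 * k ^+ 4 + 50 / del ^+ 2.
have K00 : 0 <= K0.
  by rewrite addr_ge0 // ?divr_ge0 ?sqr_ge0 // mulr_ge0 // (exprM k 2 2) sqr_ge0.
exists K0 => // b v q T y a M Lam b0 v0 q0 y0 M0 L0 hT ha hb.
have x0 : 0 <= b * v by rewrite mulr_ge0 // ltW.
set w := (b * v) ^+ D.+2; have w0 : 0 <= w by rewrite exprn_ge0.
have := @pow_young R (b * v) y K0 D.+2 4 x0 y0 K00; rewrite addn4 -/w.
have e6 : b ^+ D.+4.+2 = b ^+ 4 * b ^+ D.+2 by rewrite -exprD.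
have e5 : b ^+ D.+4.+1 = b ^+ 3 * b ^+ D.+2 by rewrite -exprD.
have e8 : b ^+ D.+4.+4 = b ^+ 6 * b ^+ D.+2 by rewrite -exprD.
have e4 : v ^+ D.+4 = v ^+ 2 * v ^+ D.+2 by rewrite -exprD.
have -> : b ^+ D.+4.+2 * (v ^+ D.+2 * q ^+ 2) = w * (b ^+ 2 * q) ^+ 2 by rewrite e6 /w !exprMn; ring.
have -> : b ^+ D.+4.+2 * (v ^+ D.+4 * q) = w * ((b ^+ 2 * q) * (b ^+ 2 * v ^+ 2)).
  by rewrite e6 e4 /w !exprMn; ring.
have -> : b ^+ D.+4.+4 * (v ^+ D.+2 * M) = w * (b ^+ 6 * M) by rewrite e8 /w !exprMn; ring.
rewrite -/k.
have -> : v ^+ D.+2 * (d.+1%:R * q ^+ 2 - d.+3%:R * (q * v ^+ 2) + a) * b ^+ D.+4.+2 +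
   k * (b ^+ D.+4.+1 * (v ^+ D.+2 * (q * T))) = w * (d.+1%:R * (b ^+ 2 * q) ^+ 2
     - d.+3%:R * ((b ^+ 2 * q) * (b ^+ 2 * v ^+ 2)) + b ^+ 4 * a + (b ^+ 2 * q) * (k * (b * T))).
  by rewrite e6 e5 /w !exprMn; ring.
have X0 : 0 <= b ^+ 2 * q by rewrite mulr_ge0 // sqr_ge0.
have V0 : 0 <= b ^+ 2 * v ^+ 2 by rewrite mulr_ge0 // sqr_ge0.
have hA := tensor_absorb del0 L0 q0 M0 (ler0n R 10) hb ha.
have hA' : - (b ^+ 4 * a) <= `|b ^+ 4 * a| by rewrite -normrN ler_norm.
have hb1 := flux_absorb b k0 q0 hT.
have hb' : - (k * (b * T)) <= k * `|b * T| by rewrite -mulrN ler_pM2l // -normrN ler_norm.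
have hb2 := ler_wpM2l X0 (le_trans hb' hb1).
have NX : (b ^+ 2 * q) ^+ 2 <= d.+1%:R * (b ^+ 2 * q) ^+ 2 by rewrite ler_peMl ?ge1S // sqr_ge0.
move: hA hA' hb2 NX; move: (b ^+ 2 * q) X0 (b ^+ 2 * v ^+ 2) V0 (b ^+ 4 * a) (k * (b * T)) (b ^+ 6 * M).
move=> X X0 V V0 a' t M' hA hA' hb2 NX.
have i1 : 10 / (4 * del) * (X * y ^+ 2) <= X ^+ 2 / 8 + 25 / 2 / del ^+ 2 * (y ^+ 2) ^+ 2.
  rewrite -subr_ge0 [leRHS](_ : _ = 2^-1 * (X / 2 - 5 * (y ^+ 2) / del) ^+ 2).
    by rewrite mulr_ge0 // sqr_ge0.
  by field; rewrite gt_eqF.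
have i2 : 2 * k ^+ 2 * y ^+ 2 * X <= X ^+ 2 / 8 + 8 * k ^+ 4 * (y ^+ 2) ^+ 2.
  rewrite -subr_ge0 [leRHS](_ : _ = 2^-1 * (X / 2 - 4 * k ^+ 2 * y ^+ 2) ^+ 2).
    by rewrite mulr_ge0 // sqr_ge0.
  by field.
have eK : K0 * y ^+ 4 = 4 * (8 * k ^+ 4 * (y ^+ 2) ^+ 2) + 4 * (25 / 2 / del ^+ 2 * (y ^+ 2) ^+ 2).
  by rewrite /K0; field; rewrite gt_eqF.
have main : X ^+ 2 <= 4 * (d.+1%:R * X ^+ 2 - d.+3%:R * (X * V) + a' + X * t)
   + 4 * d.+3%:R * (X * V) + 4 * del * Lam * M' + K0 * y ^+ 4.
  rewrite eK; move: hA hA' hb2 NX i1 i2.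
  move: (d.+1%:R) (d.+3%:R) (10 / (4 * del) * (X * y ^+ 2)) => ? ? ?.
  move: (25 / 2 / del ^+ 2 * (y ^+ 2) ^+ 2) => ?.
  move: (8 * k ^+ 4 * (y ^+ 2) ^+ 2) (2 * k ^+ 2 * y ^+ 2) => ? ?; lra.
have := ler_wpM2l w0 main.
move: (K0 * y ^+ 4) (K0 * (_ + _)) => ? ?; lra.
Qed.

(** The product of [g] and [gb] puts [f0 ^ 2] with the definite coefficient [- n] into the
    divergence of [v ^ (2 n - 2) gb grad f], where it can be traded for [q ^ 2]. Since [gb] is not
    real, the imaginary flux [U] appears. *)
Lemma bump_f0sq_pointwise del : 0 < del -> exists2 K : R, 0 <= K & forall b v q f T U y a M Lam,
  0 <= b -> 0 < v -> 0 <= q -> 0 <= y -> 0 <= M -> 0 < Lam ->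
  T ^+ 2 <= q * (4 * y ^+ 2) -> U ^+ 2 <= q * (4 * y ^+ 2) ->
  a ^+ 2 <= 15 * (q * M) -> b ^+ 2 = b ^+ 2 * (Lam * y ^+ 2) ->
  b ^+ D.+4.+2 * (v ^+ D.+2 * f ^+ 2) <=
  - (v ^+ D.+2 * (d.+2%:R * (q ^+ 2 - v ^+ 4 - f ^+ 2) + a) * b ^+ D.+4.+2
         + D.+4.+2%:R * (b ^+ D.+4.+1 * (v ^+ D.+2 * ((q + v ^+ 2) * T + f * U))))
  + del * Lam * (b ^+ D.+4.+4 * (v ^+ D.+2 * M))
  + K * (b ^+ D.+4.+2 * (v ^+ D.+2 * q ^+ 2)
         + (b * v) ^+ D.+4.+2 + y ^+ D.+4.+2).
Proof.
move=> del0; pose k : R := D.+4.+2%:R; have k0 : 0 < k by rewrite ltr0n.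
pose K0 := d.+2%:R + 3 + 8 * k ^+ 2 + 4 * k ^+ 4 + 15 / (4 * del).
have k2 : 0 <= k ^+ 2 by exact: sqr_ge0.
have k4 : 0 <= k ^+ 4 by rewrite (exprM k 2 2) sqr_ge0.
have dl : 0 <= 15 / (4 * del) by rewrite divr_ge0 // mulr_ge0 // ltW.
have N0 : 0 <= d.+2%:R :> R by exact: ler0n.
have K00 : 0 <= K0 by rewrite /K0; move: N0 k2 k4 dl; lra.
exists (2 * K0) => [|b v q f T U y a M Lam b0 v0 q0 y0 M0 L0 hT hU ha hb]; first by rewrite mulr_ge0.
have x0 : 0 <= b * v by rewrite mulr_ge0 // ltW.
set w := (b * v) ^+ D.+2; have w0 : 0 <= w by rewrite exprn_ge0.
have := @pow_young R (b * v) y K0 D.+2 4 x0 y0 K00; rewrite addn4 -/w.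
have e6 : b ^+ D.+4.+2 = b ^+ 4 * b ^+ D.+2 by rewrite -exprD.
have e5 : b ^+ D.+4.+1 = b ^+ 3 * b ^+ D.+2 by rewrite -exprD.
have e8 : b ^+ D.+4.+4 = b ^+ 6 * b ^+ D.+2 by rewrite -exprD.
have -> : b ^+ D.+4.+2 * (v ^+ D.+2 * q ^+ 2) = w * (b ^+ 2 * q) ^+ 2 by rewrite e6 /w !exprMn; ring.
have -> : b ^+ D.+4.+2 * (v ^+ D.+2 * f ^+ 2) = w * (b ^+ 2 * f) ^+ 2 by rewrite e6 /w !exprMn; ring.
have -> : b ^+ D.+4.+4 * (v ^+ D.+2 * M) = w * (b ^+ 6 * M) by rewrite e8 /w !exprMn; ring.
have -> : (b * v) ^+ D.+4.+2 = w * (b ^+ 2 * v ^+ 2) ^+ 2 by rewrite -exprMn -exprM -exprD addn4.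
rewrite -/k.
have -> : v ^+ D.+2 * (d.+2%:R * (q ^+ 2 - v ^+ 4 - f ^+ 2) + a) * b ^+ D.+4.+2 +
   k * (b ^+ D.+4.+1 * (v ^+ D.+2 * ((q + v ^+ 2) * T + f * U))) =
   w * (d.+2%:R * ((b ^+ 2 * q) ^+ 2 - (b ^+ 2 * v ^+ 2) ^+ 2 - (b ^+ 2 * f) ^+ 2)
     + b ^+ 4 * a + (b ^+ 2 * q + b ^+ 2 * v ^+ 2) * (k * (b * T)) + (b ^+ 2 * f) * (k * (b * U))).
  by rewrite e6 e5 /w !exprMn; ring.
have X0 : 0 <= b ^+ 2 * q by rewrite mulr_ge0 // sqr_ge0.
have V0 : 0 <= b ^+ 2 * v ^+ 2 by rewrite mulr_ge0 // sqr_ge0.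
have hA := tensor_absorb del0 L0 q0 M0 (ler0n R 15) hb ha.
have hA' : b ^+ 4 * a <= `|b ^+ 4 * a| by rewrite ler_norm.
have hb1 := flux_absorb b k0 q0 hT.
have hb' : k * (b * T) <= k * `|b * T| by rewrite ler_pM2l // ler_norm.
have hb2 := ler_wpM2l (addr_ge0 X0 V0) (le_trans hb' hb1).
have hU2 : (k * (b * U)) ^+ 2 <= 4 * k ^+ 2 * (b ^+ 2 * q * y ^+ 2).
  have -> : 4 * k ^+ 2 * (b ^+ 2 * q * y ^+ 2) = (k * b) ^+ 2 * (q * (4 * y ^+ 2)) by ring.
  by rewrite mulrA exprMn ler_wpM2l // sqr_ge0.
have hF := sqr_ge0 (b ^+ 2 * f - k * (b * U)).
have NF : (b ^+ 2 * f) ^+ 2 / 2 + (b ^+ 2 * f) ^+ 2 <= d.+2%:R * (b ^+ 2 * f) ^+ 2.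
  have : 2 * (b ^+ 2 * f) ^+ 2 <= d.+2%:R * (b ^+ 2 * f) ^+ 2 by rewrite ler_wpM2r ?sqr_ge0 // (ler_nat _ 2).
  by have := sqr_ge0 (b ^+ 2 * f); lra.
have e4 : y ^+ 4 = (y ^+ 2) ^+ 2 by rewrite -exprM.
have y40 : 0 <= y ^+ 4 by rewrite e4 sqr_ge0.
have NV : 0 <= d.+2%:R * (b ^+ 2 * v ^+ 2) ^+ 2 by rewrite mulr_ge0 // sqr_ge0.
move: hA hA' hb2 hU2 hF NF NV; move: (b ^+ 2 * q) X0 (b ^+ 2 * v ^+ 2) V0 (b ^+ 4 * a) (k * (b * T)) (b ^+ 6 * M) (b ^+ 2 * f) (k * (b * U)).
move=> X X0 V V0 a' t M' F u hA hA' hb2 hU2 hF NF NV.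
have XY : X * y ^+ 2 <= X ^+ 2 + y ^+ 4.
  by rewrite e4; have := sqr_ge0 (X - y ^+ 2); have := sqr_ge0 X; have := sqr_ge0 (y ^+ 2); nra.
have VY : V * y ^+ 2 <= V ^+ 2 + y ^+ 4.
  by rewrite e4; have := sqr_ge0 (V - y ^+ 2); have := sqr_ge0 V; have := sqr_ge0 (y ^+ 2); nra.
have XV : X * V <= X ^+ 2 + V ^+ 2 by have := sqr_ge0 (X - V); have := sqr_ge0 X; have := sqr_ge0 V; nra.
have c1 : 15 / (4 * del) * (X * y ^+ 2) <= 15 / (4 * del) * (X ^+ 2 + y ^+ 4) by rewrite ler_wpM2l.
have c2 : k ^+ 2 * (X * y ^+ 2) <= k ^+ 2 * (X ^+ 2 + y ^+ 4) by rewrite ler_wpM2l.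
have c3 : k ^+ 2 * (V * y ^+ 2) <= k ^+ 2 * (V ^+ 2 + y ^+ 4) by rewrite ler_wpM2l.
have main : F ^+ 2 <= - (d.+2%:R * (X ^+ 2 - V ^+ 2 - F ^+ 2) + a' + (X + V) * t + F * u)
   + del * Lam * M' + K0 * (X ^+ 2 + V ^+ 2 + y ^+ 4).
  have p1 := mulr_ge0 N0 (sqr_ge0 X); have p2 := mulr_ge0 N0 (sqr_ge0 V); have p3 := mulr_ge0 N0 y40.
  have p4 := mulr_ge0 k2 (sqr_ge0 X); have p5 := mulr_ge0 k2 (sqr_ge0 V); have p6 := mulr_ge0 k2 y40.
  have p7 := mulr_ge0 k4 (sqr_ge0 X); have p8 := mulr_ge0 k4 (sqr_ge0 V); have p9 := mulr_ge0 k4 y40.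
  have p10 := mulr_ge0 dl (sqr_ge0 V); have p11 := sqr_ge0 X; have p12 := sqr_ge0 V.
  rewrite /K0; move: hA hA' hb2 hU2 hF NF NV XV c1 c2 c3 p1 p2 p3 p4 p5 p6 p7 p8 p9 p10 p11 p12 y40 (mulr_ge0 dl y40).
  move: (15 / (4 * del)) (k ^+ 4) (k ^+ 2) (y ^+ 4) (y ^+ 2) (d.+2%:R) => ? ? ? ? ? ?; lra.
have := ler_wpM2l w0 main.
have := mulr_ge0 K00 (mulr_ge0 w0 (sqr_ge0 X)); have := mulr_ge0 K00 (mulr_ge0 w0 (sqr_ge0 V)).
have := mulr_ge0 K00 (exprn_ge0 D.+4.+2 y0).
move: (y ^+ D.+4.+2) (X ^+ 2) (V ^+ 2) (y ^+ 4) (F ^+ 2) => ? ? ? ? ?.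
move: ((X + V) * t) (F * u) => ? ?. clearbody K0; lra.
Qed.

(** The relation [h * s <= N * b] converts the gradient of the outer cutoff into the power [2 n + 3]
    of the inner one. Young's inequality splits it evenly, [2 n + 4] going to the density [M] and
    [2 n + 2] to the weights estimated before. *)
Lemma mass_pointwise c : 0 <= c -> exists2 K : R, 0 <= K & forall b v q f h s T y M tau,
  0 <= b -> 0 < v -> 0 <= q -> 0 <= y -> 0 <= M -> 0 < tau -> 0 <= h -> 0 <= s ->
  h * s <= D.+4.+4%:R * b ->
  T ^+ 2 <= c * (((q + v ^+ 2) ^+ 2 + f ^+ 2) * M * y ^+ 2) ->
  v ^+ D.+2 * M * h ^+ D.+4.+4 <=
  (v ^+ D.+2 * M * h ^+ D.+4.+4 + D.+4.+4%:R * (h ^+ D.+4.+3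
     * (- (D.+4.+4%:R * (s ^+ D.+4.+3 * (v ^+ D.+2 * T))))))
  + K * tau^-1 * (b ^+ D.+4.+4 * (v ^+ D.+2 * M))
  + K * tau * y ^+ 2 * (b ^+ D.+4.+2 * (v ^+ D.+2 * q ^+ 2)
     + b ^+ D.+4.+2 * (v ^+ D.+2 * f ^+ 2) + (b * v) ^+ D.+4.+2).
Proof.
move=> c0; pose k : R := D.+4.+4%:R; have k0 : 0 < k by rewrite ltr0n.
rewrite -/k; pose K1 := k ^+ 2 * k ^+ D.+4.+3.
have K10 : 0 <= K1 by rewrite mulr_ge0 // exprn_ge0 // ltW.
exists (K1 * (c + 1)) => [|b v q f h s T y M tau b0 v0 q0 y0 M0 t0 h0 s0 hs hT].
  by rewrite mulr_ge0 // addr_ge0.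
have ti : 0 < tau^-1 by rewrite invr_gt0.
have x0 : 0 <= b * v by rewrite mulr_ge0 // ltW.
set w := (b * v) ^+ D.+2; have w0 : 0 <= w by rewrite exprn_ge0.
have e6 : b ^+ D.+4.+2 = b ^+ 4 * b ^+ D.+2 by rewrite -exprD.
have e8 : b ^+ D.+4.+4 = b ^+ 6 * b ^+ D.+2 by rewrite -exprD.
have e7 : b ^+ D.+4.+3 = b ^+ 5 * b ^+ D.+2 by rewrite -exprD.
have -> : b ^+ D.+4.+2 * (v ^+ D.+2 * q ^+ 2) = w * (b ^+ 2 * q) ^+ 2 by rewrite e6 /w !exprMn; ring.
have -> : b ^+ D.+4.+2 * (v ^+ D.+2 * f ^+ 2) = w * (b ^+ 2 * f) ^+ 2 by rewrite e6 /w !exprMn; ring.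
have -> : b ^+ D.+4.+4 * (v ^+ D.+2 * M) = w * (b ^+ 6 * M) by rewrite e8 /w !exprMn; ring.
have -> : (b * v) ^+ D.+4.+2 = w * (b ^+ 2 * v ^+ 2) ^+ 2 by rewrite -exprMn -exprM -exprD addn4.
have key : k ^+ 2 * ((h * s) ^+ D.+4.+3 * (v ^+ D.+2 * T)) <= K1 * (w * `|b ^+ 5 * T|).
  have vT : v ^+ D.+2 * T <= v ^+ D.+2 * `|T| by rewrite ler_wpM2l ?ler_norm // exprn_ge0 // ltW.
  have vT0 : 0 <= v ^+ D.+2 * `|T| by rewrite mulr_ge0 // exprn_ge0 // ltW.
  apply: (@le_trans _ _ (k ^+ 2 * ((k * b) ^+ D.+4.+3 * (v ^+ D.+2 * `|T|)))).
    rewrite ler_wpM2l ?sqr_ge0 //; apply: (@le_trans _ _ ((h * s) ^+ D.+4.+3 * (v ^+ D.+2 * `|T|))).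
      by rewrite ler_wpM2l // exprn_ge0 // mulr_ge0.
    rewrite ler_wpM2r // lerXn2r // nnegrE mulr_ge0 //; exact: ltW.
  rewrite normrM (ger0_norm (exprn_ge0 5 b0)) exprMn e7 /K1 /w exprMn.
  by rewrite le_eqVlt; apply/orP; left; apply/eqP; ring.
have b6 : 0 <= b ^+ 6 * M by rewrite mulr_ge0 // exprn_ge0.
have G0 : 0 <= (q + v ^+ 2) ^+ 2 + f ^+ 2 by rewrite addr_ge0 // sqr_ge0.
have bT : `|b ^+ 5 * T| <= (tau^-1 * (b ^+ 6 * M) + c * (y ^+ 2 * (b ^+ 4 * ((q + v ^+ 2) ^+ 2 + f ^+ 2))) / tau^-1) / 2.
  apply: young => //.
    by rewrite mulr_ge0 // mulr_ge0 ?sqr_ge0 // mulr_ge0 // exprn_ge0.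
  have -> : b ^+ 6 * M * (c * (y ^+ 2 * (b ^+ 4 * ((q + v ^+ 2) ^+ 2 + f ^+ 2)))) =
     (b ^+ 5) ^+ 2 * (c * (((q + v ^+ 2) ^+ 2 + f ^+ 2) * M * y ^+ 2)) by ring.
  by rewrite exprMn ler_wpM2l // sqr_ge0.
rewrite invrK in bT.
have hG : b ^+ 4 * ((q + v ^+ 2) ^+ 2 + f ^+ 2) <= 2 * ((b ^+ 2 * q) ^+ 2 + (b ^+ 2 * f) ^+ 2 + (b ^+ 2 * v ^+ 2) ^+ 2).
  have -> : b ^+ 4 * ((q + v ^+ 2) ^+ 2 + f ^+ 2) = (b ^+ 2 * q + b ^+ 2 * v ^+ 2) ^+ 2 + (b ^+ 2 * f) ^+ 2 by ring.
  have := sqr_ge0 (b ^+ 2 * q - b ^+ 2 * v ^+ 2); have := sqr_ge0 (b ^+ 2 * f).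
  by move: (b ^+ 2 * q) (b ^+ 2 * f) (b ^+ 2 * v ^+ 2) => ? ? ?; nra.
have ty0 : 0 <= tau * y ^+ 2 by rewrite mulr_ge0 ?sqr_ge0 // ltW.
have ty := mulr_ge0 c0 ty0.
have hG' := ler_wpM2l ty hG.
have m1 : `|b ^+ 5 * T| <= (c + 1) * tau^-1 * (b ^+ 6 * M) + (c + 1) * tau * y ^+ 2 * ((b ^+ 2 * q) ^+ 2 + (b ^+ 2 * f) ^+ 2 + (b ^+ 2 * v ^+ 2) ^+ 2).
  have p1 : 0 <= tau^-1 * (b ^+ 6 * M) by rewrite mulr_ge0 // ltW.
  have p2 := mulr_ge0 c0 p1.
  have p3 := mulr_ge0 ty0 (addr_ge0 (addr_ge0 (sqr_ge0 (b ^+ 2 * q)) (sqr_ge0 (b ^+ 2 * f))) (sqr_ge0 (b ^+ 2 * v ^+ 2))).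
  move: bT hG' p1 p2 p3; move: (b ^+ 4 * _) (b ^+ 6 * M) ((b ^+ 2 * q) ^+ 2) ((b ^+ 2 * f) ^+ 2) ((b ^+ 2 * v ^+ 2) ^+ 2) => ? ? ? ? ?; lra.
have := ler_wpM2l (mulr_ge0 K10 w0) m1; move: key.
have -> : k * (h ^+ D.+4.+3 * - (k * (s ^+ D.+4.+3 * (v ^+ D.+2 * T)))) =
  - (k ^+ 2 * ((h * s) ^+ D.+4.+3 * (v ^+ D.+2 * T))) by rewrite exprMn; ring.
move: (k ^+ 2 * (_ * _)) (v ^+ D.+2 * M * h ^+ D.+4.+4) `|b ^+ 5 * T| => ? ? ?.
move: (b ^+ 6 * M) ((b ^+ 2 * q) ^+ 2) ((b ^+ 2 * f) ^+ 2) ((b ^+ 2 * v ^+ 2) ^+ 2) => ? ? ? ?; lra.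
Qed.

End Pointwise.

(* The situation, abstracted from the vector fields: [s L] is the fourth power of the gauge divided by
   [L ^ 4]; [M] is the Jerison-Lee density; [a], [a'] are the contractions of the tensors with grad f;
   [T1], [T2], [TJ] are the fluxes of grad f (real and imaginary part) and of the Jerison-Lee field
   through the level sets of [s L]; the dimension is [n = d + 2], so that [2n - 2 = D + 2]. *)
Section Estimates.
Variables (R : realType) (d : nat).
Local Notation V := (heis R d.+2).
Local Notation D := (d + d)%N.
Implicit Types (p : V) (L : R) (m : nat).
Variables (v q f0 M a a' : V -> R) (s T1 T2 TJ : R -> V -> R).

(** An annular cutoff, paired with the ball cutoff [eta]. The power of [s] in [eta] equals the power
    to which the cutoffs are raised, so that the derivative of [eta ^ N] contains
    [(eta * s) ^ (N - 1)], which [bump] controls. *)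
Definition bump L p := posn (s L p * (1 - s L p)).
Definition eta L p := posn (1 - s L p ^+ D.+4.+4).
Definition chi L p : R := (s L p < 1)%R%:R.
Definition Yc L p := L^-1 * chi L p.

Hypothesis v_gt0 : forall p, 0 < v p.
Hypothesis q_ge0 : forall p, 0 <= q p.
Hypothesis M_ge0 : forall p, 0 <= M p.
Hypothesis s_ge0 : forall L p, 0 <= s L p.
Hypothesis s_scale : forall L p, s (2 * L) p = s L p / 16.
Hypothesis vol : exists2 K : R, 0 <= K & forall L m, 1 <= L -> Int m (chi L) <= K * L ^+ D.+4.+2.
Hypothesis decay : exists2 C : R, 0 <= C & forall L p, 1 <= L ->
  (bump L p * v p) ^+ d.+2 <= C * L^-1 ^+ d.
Hypothesis T1_bound : forall L p, 1 <= L -> T1 L p ^+ 2 <= q p * (4 * Yc L p ^+ 2).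
Hypothesis T2_bound : forall L p, 1 <= L -> T2 L p ^+ 2 <= q p * (4 * Yc L p ^+ 2).
Variable cJ : R.
Hypothesis cJ0 : 0 <= cJ.
Hypothesis TJ_bound : forall L p, 1 <= L ->
  TJ L p ^+ 2 <= cJ * (((q p + v p ^+ 2) ^+ 2 + f0 p ^+ 2) * M p * Yc L p ^+ 2).
Hypothesis a_bound : forall p, a p ^+ 2 <= 10 * (q p * M p).
Hypothesis a'_bound : forall p, a' p ^+ 2 <= 15 * (q p * M p).

Definition ibp_f j k L p := v p ^+ j * ((j%:R - d.+2%:R) * q p - d.+2%:R * v p ^+ 2) * bump L p ^+ k.+2
  + k.+2%:R * (bump L p ^+ k.+1 * (v p ^+ j * T1 L p)).
Definition ibp_qf L p := v p ^+ D.+2 * (d.+1%:R * q p ^+ 2 - d.+3%:R * (q p * v p ^+ 2) + a p) * bump L p ^+ D.+4.+2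
  + D.+4.+2%:R * (bump L p ^+ D.+4.+1 * (v p ^+ D.+2 * (q p * T1 L p))).
Definition ibp_gf L p := v p ^+ D.+2 * (d.+2%:R * (q p ^+ 2 - v p ^+ 4 - f0 p ^+ 2) + a' p) * bump L p ^+ D.+4.+2
  + D.+4.+2%:R * (bump L p ^+ D.+4.+1 * (v p ^+ D.+2 * ((q p + v p ^+ 2) * T1 L p + f0 p * T2 L p))).
Definition ibp_X L p := v p ^+ D.+2 * M p * eta L p ^+ D.+4.+4
  + D.+4.+4%:R * (eta L p ^+ D.+4.+3
     * (- (D.+4.+4%:R * (s L p ^+ D.+4.+3 * (v p ^+ D.+2 * TJ L p))))).

Hypothesis ibp_f_small : forall j k L eps, 1 <= L -> 0 < eps -> \forall m \near \oo, `|Int m (ibp_f j k L)| <= eps.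
Hypothesis ibp_qf_small : forall L eps, 1 <= L -> 0 < eps -> \forall m \near \oo, `|Int m (ibp_qf L)| <= eps.
Hypothesis ibp_gf_small : forall L eps, 1 <= L -> 0 < eps -> \forall m \near \oo, `|Int m (ibp_gf L)| <= eps.
Hypothesis ibp_X_small : forall L eps, 1 <= L -> 0 < eps -> \forall m \near \oo, `|Int m (ibp_X L)| <= eps.

Local Notation Int_qsq L m := (Int m (fun p => bump L p ^+ D.+4.+2 * (v p ^+ D.+2 * q p ^+ 2))).
Local Notation Int_f0sq L m := (Int m (fun p => bump L p ^+ D.+4.+2 * (v p ^+ D.+2 * f0 p ^+ 2))).
Local Notation Int_vpow L m := (Int m (fun p => (bump L p * v p) ^+ D.+4.+2)).
Local Notation Int_Yc L m := (Int m (fun p => Yc L p ^+ D.+4.+2)).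

Lemma bump_ge0 L p : 0 <= bump L p. Proof. exact: posn_ge0. Qed.
Lemma eta_ge0 L p : 0 <= eta L p. Proof. exact: posn_ge0. Qed.

Lemma bump_eq0 L p : 1 <= s L p -> bump L p = 0.
Proof.
move=> h; apply/max_idPr; rewrite mulr_ge0_le0 //; lra.
Qed.

Lemma bumpE L p : s L p < 1 -> bump L p = s L p * (1 - s L p).
Proof.
by move=> h; apply/max_idPl; rewrite mulr_ge0 //; lra.
Qed.

Lemma Yc_ge0 L p : 1 <= L -> 0 <= Yc L p.
Proof. by move=> L1; rewrite mulr_ge0 // invr_ge0; lra. Qed.

Lemma YcX L p j : Yc L p ^+ j.+1 = L^-1 ^+ j.+1 * chi L p.
Proof. by rewrite /Yc /chi; case: (_ < 1); rewrite ?mulr1 // mulr0 expr0n mulr0. Qed.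

Lemma bump_Yc L p : 1 <= L -> bump L p ^+ 2 = bump L p ^+ 2 * (L ^+ 2 * Yc L p ^+ 2).
Proof.
move=> L1; rewrite YcX /chi; case: (ltP (s L p) 1) => h.
  by rewrite mulr1 -exprMn mulfV ?expr1n ?mulr1 // gt_eqF //; lra.
by rewrite bump_eq0 // expr0n mul0r.
Qed.

Lemma Int_le2 m (F G H : V -> R) x y : (forall p, F p <= x * G p + y * H p) ->
  Int m F <= x * Int m G + y * Int m H.
Proof.
by move=> h; rewrite -!IntZ -IntD; apply: Int_le.
Qed.

Lemma Int_le3 m (F G H I : V -> R) x y z : (forall p, F p <= x * G p + y * H p + z * I p) ->
  Int m F <= x * Int m G + y * Int m H + z * Int m I.
Proof.
by move=> h; rewrite -!IntZ -!IntD; apply: Int_le.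
Qed.

Lemma LVX L j k : 1 <= L -> L^-1 ^+ j * L ^+ (j + k) = L ^+ k.
Proof.
move=> L1; rewrite exprD mulrA -exprMn mulVf ?expr1n ?mul1r // gt_eqF //; lra.
Qed.

Lemma Int_chi : exists2 K : R, 0 <= K & forall L j k m, 1 <= L -> (j.+1 + k = D.+4.+2)%N ->
  Int m (fun p => Yc L p ^+ j.+1) <= K * L ^+ k.
Proof.
have [K K0 hK] := vol; exists K => // L j k m L1 e.
have -> : (fun p => Yc L p ^+ j.+1) = (fun p => L^-1 ^+ j.+1 * chi L p).
  by apply/funext => p; rewrite YcX.
rewrite IntZ -(@LVX L j.+1 k) // e [leRHS]mulrCA; apply: ler_wpM2l; last exact: hK.
by rewrite exprn_ge0 // invr_ge0; lra.
Qed.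

Lemma L1X L k : 1 <= L -> 1 <= L ^+ k.
Proof. by move=> L1; rewrite exprn_ege1. Qed.

(** The order is the volume [L ^ (2 n + 2)] of the gauge ball times the cutoff term
    [L ^ (- n - 1)]. *)
Lemma energy_growth : exists2 K : R, 0 <= K & forall L, 1 <= L -> \forall m \near \oo,
  Int m (fun p => bump L p ^+ d.+3 * (v p ^+ d.+1 * (q p + v p ^+ 2))) <= K * L ^+ d.+3.
Proof.
have [K K0 hK] := bump_energy_pointwise R d; have [K' K'0 hK'] := Int_chi.
exists (4 + K * K') => [|L L1]; first by rewrite addr_ge0 // mulr_ge0.
apply: filterS (ibp_f_small d.+1 d.+1 L1 ltr01) => m.
rewrite ler_norml => /andP[h _].
have le p := hK (bump L p) (v p) (q p) (T1 L p) (Yc L p) (bump_ge0 L p) (v_gt0 p) (q_ge0 p) (Yc_ge0 p L1) (T1_bound p L1).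
have := @Int_le2 m _ (ibp_f d.+1 d.+1 L) (fun p => Yc L p ^+ d.+3) (- 4) K le.
have hc := hK' L d.+2 d.+3 m L1 _; rewrite -addnS -addSn in hc.
have {}hc : Int m (fun p => Yc L p ^+ d.+3) <= K' * L ^+ d.+3.
  by apply: hc; rewrite !addSn !addnS.
have := ler_wpM2l K0 hc; have := L1X d.+3 L1.
move: (Int m _) (Int m _) (Int m _) h (L ^+ d.+3) => x y z h l; lra.
Qed.

Lemma Yc_le L p : 1 <= L -> Yc L p <= L^-1.
Proof.
move=> L1; rewrite /Yc /chi; case: (_ < 1); rewrite ?mulr1 // mulr0 invr_ge0; lra.
Qed.

Lemma LV_gt0 L : 1 <= L -> 0 < L^-1. Proof. by move=> L1; rewrite invr_gt0; lra. Qed.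

Lemma bump_pow_growth : exists2 K : R, 0 <= K & forall L, 1 <= L -> \forall m \near \oo,
  Int m (fun p => (bump L p * v p) ^+ d.+4) <= K * L ^+ d.+2.
Proof.
have [K K0 hK] := energy_growth.
have c0 : 0 <= d.+4%:R :> R by exact: ler0n.
exists (1 + d.+4%:R * K) => [|L L1]; first by rewrite addr_ge0 // mulr_ge0.
apply: filterS2 (hK L L1) (ibp_f_small d.+2 d.+2 L1 ltr01) => m h1.
rewrite ler_norml => /andP[h _].
have le p : (bump L p * v p) ^+ d.+4 <= (- 1) * ibp_f d.+2 d.+2 L p +
    (d.+4%:R * L^-1) * (bump L p ^+ d.+3 * (v p ^+ d.+1 * (q p + v p ^+ 2))).
  have h2 := bump_pow_pointwise d (bump_ge0 L p) (v_gt0 p) (q_ge0 p) (Yc_ge0 p L1) (T1_bound p L1).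
  apply: (le_trans h2); rewrite mulN1r; apply: lerD; first exact: lexx.
  apply: ler_wpM2r; last by apply: ler_wpM2l => //; exact: Yc_le.
  apply: mulr_ge0; first by rewrite exprn_ge0 ?bump_ge0.
  apply: mulr_ge0; first by rewrite exprn_ge0 // ltW.
  by rewrite addr_ge0 // sqr_ge0.
apply: (le_trans (Int_le2 m le)).
have h3 : d.+4%:R * L^-1 * Int m (fun p => bump L p ^+ d.+3 * (v p ^+ d.+1 * (q p + v p ^+ 2)))
   <= d.+4%:R * K * L ^+ d.+2.
  have -> : d.+4%:R * K * L ^+ d.+2 = d.+4%:R * L^-1 * (K * L ^+ d.+3).
    rewrite [L ^+ d.+3]exprS; field; rewrite gt_eqF //; lra.
  by apply: ler_wpM2l => //; rewrite mulr_ge0 // ltW // LV_gt0.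
have := L1X d.+2 L1; move: h h3.
move: (Int m _) (d.+4%:R * L^-1 * Int m _) (d.+4%:R * K) (L ^+ d.+2) => ? ? ? ? ? ? ?.
rewrite mulrDl; lra.
Qed.

(** The exponent [2 n + 2] is split as [n + (n + 2)]: the decay bounds the first factor by
    [L ^ (2 - n)] pointwise, and [bump_pow_growth] integrates the second to [L ^ n]. *)
Lemma bump_critical_growth : exists2 K : R, 0 <= K & forall L, 1 <= L -> \forall m \near \oo,
  Int_vpow L m <= K * L ^+ 2.
Proof.
have [K K0 hK] := bump_pow_growth; have [C C0 hC] := decay.
exists (C * K) => [|L L1]; first by rewrite mulr_ge0.
apply: filterS (hK L L1) => m h1.
have x0 p : 0 <= bump L p * v p by rewrite mulr_ge0 ?bump_ge0 // ltW.
have le p : (bump L p * v p) ^+ D.+4.+2 <= (C * L^-1 ^+ d) * (bump L p * v p) ^+ d.+4.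
  have -> : (bump L p * v p) ^+ D.+4.+2 = (bump L p * v p) ^+ d.+2 * (bump L p * v p) ^+ d.+4.
    by rewrite -exprD; congr (_ ^+ _); rewrite !addSn !addnS.
  by rewrite ler_wpM2r ?exprn_ge0 // hC.
have : Int_vpow L m <= (C * L^-1 ^+ d) * Int m (fun p => (bump L p * v p) ^+ d.+4).
  by rewrite -IntZ; apply: Int_le.
move/le_trans; apply.
have -> : C * K * L ^+ 2 = (C * L^-1 ^+ d) * (K * L ^+ d.+2).
  by have e := @LVX L d 2 L1; rewrite addn2 in e; rewrite -e; ring.
by apply: ler_wpM2l => //; rewrite mulr_ge0 // exprn_ge0 // ltW // LV_gt0.
Qed.

Lemma Yc_growth : exists2 K : R, 0 <= K & forall L m, 1 <= L ->
  Int_Yc L m <= K * L ^+ 2.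
Proof.
have [K K0 hK] := Int_chi; exists K => // L m L1.
have := hK L D.+4.+1 0%N m L1 (addn0 _); rewrite expr0 => /le_trans; apply.
by rewrite ler_wpM2l // L1X.
Qed.

Lemma bump_vq_growth : exists2 K : R, 0 <= K & forall L, 1 <= L -> \forall m \near \oo,
  Int m (fun p => bump L p ^+ D.+4.+2 * (v p ^+ D.+4 * q p)) <= K * L ^+ 2.
Proof.
have [K K0 hK] := bump_vq_pointwise R d; have [K3 K30 h3] := bump_critical_growth; have [KY KY0 hY] := Yc_growth.
exists (1 + K * (K3 + KY)) => [|L L1]; first by rewrite addr_ge0 // mulr_ge0 // addr_ge0.
apply: filterS2 (h3 L L1) (ibp_f_small D.+4 D.+4 L1 ltr01) => m h1.
rewrite ler_norml => /andP[_ h].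
have le p : bump L p ^+ D.+4.+2 * (v p ^+ D.+4 * q p) <= 1 * ibp_f D.+4 D.+4 L p +
    K * ((bump L p * v p) ^+ D.+4.+2 + Yc L p ^+ D.+4.+2).
  by rewrite mul1r; exact: hK (bump_ge0 L p) (v_gt0 p) (q_ge0 p) (Yc_ge0 p L1) (T1_bound p L1).
have h2 : Int m (fun p => bump L p ^+ D.+4.+2 * (v p ^+ D.+4 * q p)) <=
   1 * Int m (ibp_f D.+4 D.+4 L) + K * (Int_vpow L m
       + Int_Yc L m).
  by rewrite -IntD; exact: Int_le2 le.
have h5 := ler_wpM2l K0 (lerD h1 (hY L m L1)); have h6 := L1X 2 L1.
apply: (le_trans h2); lra.
Qed.

Local Notation inner_mass L m := (Int m (fun p => bump L p ^+ D.+4.+4 * (v p ^+ D.+2 * M p))).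

Lemma bump_qsq_growth del : 0 < del -> exists2 K : R, 0 <= K & forall L, 1 <= L -> \forall m \near \oo,
  Int_qsq L m <=
  K * L ^+ 2 + 4 * del * L ^+ 2 * inner_mass L m.
Proof.
move=> del0; have [K K0 hK] := bump_qsq_pointwise d del0.
have [K3 K30 h3] := bump_critical_growth; have [K4 K40 h4] := bump_vq_growth; have [KY KY0 hY] := Yc_growth.
have c0 : 0 <= 4 * d.+3%:R :> R by rewrite mulr_ge0.
exists (4 + 4 * d.+3%:R * K4 + K * (K3 + KY)) => [|L L1].
  by rewrite addr_ge0 // ?addr_ge0 // mulr_ge0 // addr_ge0.
apply: filterS3 (h3 L L1) (h4 L L1) (ibp_qf_small L1 ltr01) => m {}h3 {}h4.
rewrite ler_norml => /andP[_ h].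
have L20 : 0 < L ^+ 2 by rewrite exprn_gt0 //; lra.
have le p : bump L p ^+ D.+4.+2 * (v p ^+ D.+2 * q p ^+ 2) <= 1 * (4 * ibp_qf L p +
    4 * d.+3%:R * (bump L p ^+ D.+4.+2 * (v p ^+ D.+4 * q p)))
    + (4 * del * L ^+ 2) * (bump L p ^+ D.+4.+4 * (v p ^+ D.+2 * M p))
    + K * ((bump L p * v p) ^+ D.+4.+2 + Yc L p ^+ D.+4.+2).
  rewrite mul1r.
  exact: hK (bump_ge0 L p) (v_gt0 p) (q_ge0 p) (Yc_ge0 p L1) (M_ge0 p) L20 (T1_bound p L1) (a_bound p) (bump_Yc p L1).
have h2 : Int_qsq L m <=
   1 * (4 * Int m (ibp_qf L) + 4 * d.+3%:R * Int m (fun p => bump L p ^+ D.+4.+2 * (v p ^+ D.+4 * q p)))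
   + (4 * del * L ^+ 2) * inner_mass L m
   + K * (Int_vpow L m + Int_Yc L m).
  by rewrite -IntD -!IntZ -IntD; move: (Int_le3 m le); rewrite !IntZ.
have h5 := ler_wpM2l K0 (lerD h3 (hY L m L1)); have h6 := ler_wpM2l c0 h4; have h7 := L1X 2 L1.
apply: (le_trans h2); lra.
Qed.

Lemma inner_mass_ge0 L m : 0 <= inner_mass L m.
Proof.
apply: Int_ge0 => p; rewrite mulr_ge0 ?exprn_ge0 ?bump_ge0 // mulr_ge0 // exprn_ge0 // ltW //.
Qed.

Lemma weight_growth del : 0 < del -> exists2 K : R, 0 <= K & forall L, 1 <= L -> \forall m \near \oo,
  Int_qsq L m +
  Int_f0sq L m +
  Int_vpow L m <= K * L ^+ 2 + del * L ^+ 2 * inner_mass L m.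
Proof.
move=> del0; have del2 : 0 < del / 2 by rewrite divr_gt0.
have [K6 K60 hK] := bump_f0sq_pointwise d del2.
(* The integral of [q ^ 2] is counted [K6 + 1] times in total, so this share contributes [del / 2]
   to the coefficient of the mass; the [f0 ^ 2] estimate contributes the other half. *)
pose del5 := del / (8 * (K6 + 1)).
have K61 : 0 < K6 + 1 by lra.
have del50 : 0 < del5 by rewrite divr_gt0 // mulr_gt0.
have [K5 K50 h5] := bump_qsq_growth del50.
have [K3 K30 h3] := bump_critical_growth; have [KY KY0 hY] := Yc_growth.
exists (1 + (K6 + 1) * K5 + (K6 + 1) * (K3 + KY)) => [|L L1].
  by rewrite !addr_ge0 // ?mulr_ge0 ?addr_ge0.
apply: filterS3 (h3 L L1) (h5 L L1) (ibp_gf_small L1 ltr01) => m {}h3 {}h5.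
rewrite ler_norml => /andP[h _].
have L20 : 0 < L ^+ 2 by rewrite exprn_gt0 //; lra.
have le p : bump L p ^+ D.+4.+2 * (v p ^+ D.+2 * f0 p ^+ 2) <= (-1) * ibp_gf L p
    + (del / 2 * L ^+ 2) * (bump L p ^+ D.+4.+4 * (v p ^+ D.+2 * M p))
    + K6 * (bump L p ^+ D.+4.+2 * (v p ^+ D.+2 * q p ^+ 2) + (bump L p * v p) ^+ D.+4.+2 + Yc L p ^+ D.+4.+2).
  rewrite mulN1r.
  exact: hK (bump_ge0 L p) (v_gt0 p) (q_ge0 p) (Yc_ge0 p L1) (M_ge0 p) L20 (T1_bound p L1) (T2_bound p L1) (a'_bound p) (bump_Yc p L1).
have h2 : Int_f0sq L m <=
   (-1) * Int m (ibp_gf L) + (del / 2 * L ^+ 2) * inner_mass L m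
   + K6 * (Int_qsq L m +
      Int_vpow L m + Int_Yc L m).
  have h2' : Int_f0sq L m <=
   (-1) * Int m (ibp_gf L) + (del / 2 * L ^+ 2) * inner_mass L m
   + K6 * Int m (fun p => bump L p ^+ D.+4.+2 * (v p ^+ D.+2 * q p ^+ 2) + (bump L p * v p) ^+ D.+4.+2 + Yc L p ^+ D.+4.+2).
    exact: Int_le3 le.
  move: h2'; rewrite (IntD m (fun p => bump L p ^+ D.+4.+2 * (v p ^+ D.+2 * q p ^+ 2) + (bump L p * v p) ^+ D.+4.+2)).
  by rewrite (IntD m (fun p => bump L p ^+ D.+4.+2 * (v p ^+ D.+2 * q p ^+ 2))).
have h6 := ler_wpM2l (ltW K61) h5; have h7 := ler_wpM2l (ltW K61) h3; have h8 := ler_wpM2l K60 (hY L m L1).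
have h9 : (K6 + 1) * (4 * del5) = del / 2 by rewrite /del5; field; rewrite gt_eqF.
have h10 : (K6 + 1) * (4 * del5 * L ^+ 2 * inner_mass L m) = del / 2 * L ^+ 2 * inner_mass L m by rewrite -h9; ring.
have h11 := L1X 2 L1; have h12 : 0 <= KY * L ^+ 2 by rewrite mulr_ge0 // ltW.
have h13 := mulr_ge0 K30 (ltW L20).
rewrite mulrDr h10 in h6.
move: h2 h6 h7 h8 h h11 h12 h13; move: (Int m (ibp_gf L)) (Int_Yc L m) (Int_vpow L m) (inner_mass L m).
move: (Int_qsq L m) (Int_f0sq L m).
move: (L ^+ 2) => l x1 x2 x3 x4 x5 x6; lra.
Qed.

Local Notation outer_mass L m := (Int m (fun p => v p ^+ D.+2 * M p * eta L p ^+ D.+4.+4)).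

Lemma bernoulli (x : R) k : 0 <= x -> x <= 1 -> 1 - x ^+ k <= k%:R * (1 - x).
Proof.
move=> x0 x1; elim: k => [|k IH]; first by rewrite expr0 subrr mul0r.
have -> : 1 - x ^+ k.+1 = (1 - x ^+ k) + x ^+ k * (1 - x) by rewrite exprSr; ring.
rewrite -addn1 natrD mulrDl mul1r lerD // ler_piMl ?exprn_ile1 //; lra.
Qed.

Lemma pow_diff (A B x : R) k : 0 <= B -> B <= A -> 2^-1 <= A -> 0 <= x -> x / 2 <= A - B ->
  (2^-1) ^+ k.+1 * x <= A ^+ k.+1 - B ^+ k.+1.
Proof.
move=> B0 BA hA x0 hx; have A0 : 0 <= A by exact: le_trans BA.
apply: (@le_trans _ _ ((A - B) * A ^+ k)).
  rewrite exprS -mulrA mulrC -mulrA [leRHS]mulrC.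
  apply: ler_pM; rewrite ?exprn_ge0 ?invr_ge0 ?mulr_ge0 //.
  by rewrite lerXn2r // nnegrE invr_ge0.
rewrite mulrBl -exprS lerD2l lerN2 exprS ler_wpM2l //.
by rewrite lerXn2r.
Qed.

Lemma eta_mul_s L p : eta L p * s L p <= D.+4.+4%:R * bump L p.
Proof.
have s0 := s_ge0 L p; have b0 := bump_ge0 L p.
have [h|h] := ltP (s L p) 1; last first.
  have -> : eta L p = 0.
    by apply/max_idPr; rewrite subr_le0 exprn_ege1.
  by rewrite mul0r mulr_ge0.
rewrite bumpE //.
have e : eta L p = 1 - s L p ^+ D.+4.+4.
  by apply/max_idPl; rewrite subr_ge0 exprn_ile1 // ltW.
rewrite e mulrC mulrCA ler_wpM2l //.
by apply: bernoulli => //; exact: ltW.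
Qed.

Lemma bump_le_eta L p : bump L p <= eta L p.
Proof.
have s0 := s_ge0 L p.
have [h|h] := ltP (s L p) 1; last by rewrite bump_eq0 // eta_ge0.
rewrite bumpE // /eta /posn le_max; apply/orP; left.
have : s L p ^+ D.+4.+4 <= s L p by rewrite -[leRHS]expr1 ler_wiXn2l // ltW.
have : s L p * (1 - s L p) <= 1 - s L p by rewrite ler_piMl; lra.
lra.
Qed.

(** Doubling [L] divides [s] by 16. On the ball the outer cutoff therefore rises by at least
    [s ^ N / 2] to a value of at least 1/2, and [bump <= s]. *)
Lemma bump_le_eta_diff L p : (2 : R)^-1 ^+ D.+4.+4 * bump L p ^+ D.+4.+4 <= eta (2 * L) p ^+ D.+4.+4 - eta L p ^+ D.+4.+4.
Proof.
have s0 := s_ge0 L p; have [h|h] := ltP (s L p) 1; last first.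
  have -> : eta L p = 0 by apply/max_idPr; rewrite subr_le0 exprn_ege1.
  by rewrite bump_eq0 // !expr0n mulr0 subr0 exprn_ge0 // eta_ge0.
have sN : s L p ^+ D.+4.+4 <= 1 by rewrite exprn_ile1 // ltW.
have sN0 : 0 <= s L p ^+ D.+4.+4 by rewrite exprn_ge0.
have s16 : 0 <= s L p / 16 by rewrite divr_ge0.
have s16N : (s L p / 16) ^+ D.+4.+4 <= s L p ^+ D.+4.+4 / 2.
  rewrite exprMn ler_wpM2l //; apply: (@le_trans _ _ 16^-1).
    by rewrite -[leRHS]expr1 ler_wiXn2l //; lra.
  lra.
have -> : eta L p = 1 - s L p ^+ D.+4.+4 by apply/max_idPl; lra.
have -> : eta (2 * L) p = 1 - (s L p / 16) ^+ D.+4.+4.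
  by rewrite /eta s_scale; apply/max_idPl; lra.
apply: (@le_trans _ _ (2^-1 ^+ D.+4.+4 * s L p ^+ D.+4.+4)).
  rewrite ler_wpM2l ?exprn_ge0 ?invr_ge0 //.
  rewrite lerXn2r ?nnegrE ?bump_ge0 // bumpE // ler_piMr //; lra.
apply: pow_diff => //; lra.
Qed.

Lemma inner_le_outer_mass L m : inner_mass L m <= outer_mass L m.
Proof.
apply: Int_le => p; rewrite mulrC ler_wpM2l //.
  by rewrite mulr_ge0 // exprn_ge0 // ltW.
by rewrite lerXn2r ?nnegrE ?bump_ge0 ?eta_ge0 // bump_le_eta.
Qed.

Lemma outer_mass_step L m : (2 : R)^-1 ^+ D.+4.+4 * inner_mass L m <= outer_mass (2 * L) m - outer_mass L m.
Proof.
rewrite -IntZ -IntB; apply: Int_le => p.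
rewrite -mulrBr mulrA mulrC ler_wpM2l ?bump_le_eta_diff //.
by rewrite mulr_ge0 // exprn_ge0 // ltW.
Qed.

(** The factor [L ^ 2] of [weight_growth] cancels against the squared cutoff gradient, which makes
    the estimate uniform in [L]. The order of the quantifiers matters: [K] precedes [del], so [del]
    can be chosen against [K * tau]. *)
Lemma mass_caccioppoli : exists2 K : R, 0 <= K & forall del, 0 < del -> exists2 K' : R, 0 <= K' &
  forall L eps, 1 <= L -> 0 < eps -> \forall m \near \oo, forall tau, 0 < tau ->
  outer_mass L m <= eps + K * tau^-1 * inner_mass L m + K * tau * (K' + del * inner_mass L m).
Proof.
have [K K0 hK] := mass_pointwise d cJ0; exists K => // del del0.
have [K' K'0 h6] := weight_growth del0; exists K' => // L eps L1 e0.
apply: filterS2 (h6 L L1) (ibp_X_small L1 e0) => m {}h6.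
rewrite ler_norml => /andP[_ h] tau t0.
have V0 p : 0 <= v p by exact: ltW.
pose S p := bump L p ^+ D.+4.+2 * (v p ^+ D.+2 * q p ^+ 2) + bump L p ^+ D.+4.+2 * (v p ^+ D.+2 * f0 p ^+ 2) + (bump L p * v p) ^+ D.+4.+2.
have S0 p : 0 <= S p.
  have b0 := bump_ge0 L p.
  apply: addr_ge0; last by rewrite exprn_ge0 // mulr_ge0.
  by apply: addr_ge0; (apply: mulr_ge0; first exact: exprn_ge0);
   (apply: mulr_ge0; [exact: exprn_ge0|exact: sqr_ge0]).
have kt : 0 <= K * tau by rewrite mulr_ge0 // ltW.
have le p : v p ^+ D.+2 * M p * eta L p ^+ D.+4.+4 <= 1 * ibp_X L p
   + (K * tau^-1) * (bump L p ^+ D.+4.+4 * (v p ^+ D.+2 * M p)) + (K * tau * L^-1 ^+ 2) * S p.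
  rewrite mul1r.
  have := hK (bump L p) (v p) (q p) (f0 p) (eta L p) (s L p) (TJ L p) (Yc L p) (M p) tau
    (bump_ge0 L p) (v_gt0 p) (q_ge0 p) (Yc_ge0 p L1) (M_ge0 p) t0 (eta_ge0 L p) (s_ge0 L p) (eta_mul_s L p) (TJ_bound p L1).
  move/le_trans; apply; apply: lerD; first exact: lexx.
  apply: ler_wpM2r; first exact: S0.
  apply: ler_wpM2l => //; rewrite lerXn2r ?nnegrE ?Yc_ge0 ?Yc_le //.
  by rewrite ltW // LV_gt0.
have h2 := Int_le3 m le.
have eS : Int m S = Int_qsq L m +
  Int_f0sq L m +
  Int_vpow L m.
  rewrite /S (IntD m (fun p => bump L p ^+ D.+4.+2 * (v p ^+ D.+2 * q p ^+ 2) + bump L p ^+ D.+4.+2 * (v p ^+ D.+2 * f0 p ^+ 2))).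
  by rewrite (IntD m (fun p => bump L p ^+ D.+4.+2 * (v p ^+ D.+2 * q p ^+ 2))).
rewrite -eS in h6.
have h7 : (K * tau * L^-1 ^+ 2) * Int m S <= K * tau * (K' + del * inner_mass L m).
  have L00 : L != 0 by rewrite gt_eqF //; lra.
  have -> : K * tau * (K' + del * inner_mass L m) = (K * tau * L^-1 ^+ 2) * (K' * L ^+ 2 + del * L ^+ 2 * inner_mass L m).
    by field.
  by apply: ler_wpM2l => //; rewrite mulr_ge0 // exprn_ge0 // ltW // LV_gt0.
rewrite mul1r in h2; apply: (le_trans h2); apply: lerD => //.
by apply: lerD.
Qed.

Lemma outer_mass_bounded : exists2 B : R, 0 <= B & forall L, 1 <= L -> \forall m \near \oo, outer_mass L m <= B.
Proof.
have [K K0 hK] := mass_caccioppoli.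
(* First [tau] and then [del] give each occurrence of the inner mass a coefficient of at most 1/4.
   The inner mass is at most the outer one, so half of the left side absorbs both. *)
pose tau := 4 * (K + 1); have t0 : 0 < tau by rewrite mulr_gt0 //; lra.
pose del := (4 * (K * tau + 1))^-1.
have kt : 0 <= K * tau by rewrite mulr_ge0 // ltW.
have del0 : 0 < del by rewrite invr_gt0 mulr_gt0 //; lra.
have [K' K'0 h] := hK del del0.
exists (2 * (1 + K * tau * K')) => [|L L1]; first by rewrite mulr_ge0 // addr_ge0 // mulr_ge0.
apply: filterS (h L 1 L1 ltr01) => m /(_ tau t0) hm.
have m0 := inner_mass_ge0 L m; have mf := inner_le_outer_mass L m.
have c1 : K * tau^-1 <= 4^-1.
  rewrite ler_pdivrMr // /tau; lra.
have c2 : K * tau * del <= 4^-1.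
  by rewrite /del ler_pdivrMr ?mulr_gt0 //; lra.
have := ler_wpM2r m0 c1; have := ler_wpM2r m0 c2; move: hm m0 mf.
rewrite mulrDr mulrA; move: (K * tau^-1) (K * tau * del) (K * tau) (inner_mass L m) (outer_mass L m) => ? ? ? ? ?; lra.
Qed.

(* With [tau] proportional to [c0], [mass_caccioppoli] bounds [inner_mass] from below by a fixed
   multiple of [c0 ^ 2]; then each doubling of [L] increases [outer_mass] by at least [g]. *)
Lemma no_mass L0 c0 : 1 <= L0 -> 0 < c0 -> ~ (\forall m \near \oo, c0 <= outer_mass L0 m).
Proof.
move=> L01 c00 hc.
have [B B0 hB] := outer_mass_bounded; have [K K0 hK] := mass_caccioppoli.
have [K' K'0 h] := hK 1 ltr01.
pose A := K * (K' + B) + 1; have A0 : 0 < A by rewrite ltr_wpDl // mulr_ge0 // addr_ge0.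
pose g := c0 ^+ 2 / (8 * A * (K + 1)) * (2 : R)^-1 ^+ D.+4.+4.
have K1 : 0 < K + 1 by lra.
have g0 : 0 < g.
  apply: mulr_gt0; last by apply: exprn_gt0; rewrite invr_gt0.
  by apply: divr_gt0; [exact: exprn_gt0|apply: mulr_gt0 => //; exact: mulr_gt0].
have L1 i : 1 <= 2 ^+ i * L0.
  by apply: (le_trans L01); rewrite ler_peMl ?exprn_ege1 ?ler1n //; lra.
have step i : (\forall m \near \oo, c0 + i%:R * g <= outer_mass (2 ^+ i * L0) m).
  elim: i => [|i IH]; first by rewrite mul0r addr0 expr0 mul1r.
  have c40 : 0 < c0 / 4 by rewrite divr_gt0.
  apply: filterS3 IH (hB _ (L1 i)) (h _ _ (L1 i) c40) => m h1 h2 h3.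
  have e0 : 2 * (2 ^+ i * L0) = 2 ^+ i.+1 * L0 by rewrite mulrA -exprS.
  have := outer_mass_step (2 ^+ i * L0) m; rewrite e0.
  have t0 : 0 < c0 / (4 * A) by rewrite divr_gt0 // mulr_gt0.
  have := h3 _ t0; have m0 := inner_mass_ge0 (2 ^+ i * L0) m; have mf := inner_le_outer_mass (2 ^+ i * L0) m.
  have ig : 0 <= i%:R * g by rewrite mulr_ge0 // ltW.
  have e1 : K * (c0 / (4 * A)) * (K' + 1 * inner_mass (2 ^+ i * L0) m) <= c0 / 4.
    have -> : c0 / 4 = (c0 / (4 * A)) * A by field; rewrite gt_eqF.
    rewrite (_ : K * _ * _ = c0 / (4 * A) * (K * (K' + 1 * inner_mass (2 ^+ i * L0) m))); last by ring.
    apply: ler_wpM2l; first exact: ltW.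
    rewrite /A mul1r; apply: (@le_trans _ _ (K * (K' + B))); last by rewrite lerDl.
    by apply: ler_wpM2l => //; rewrite lerD2l; exact: le_trans h2.
  have e2 : K * (c0 / (4 * A))^-1 * inner_mass (2 ^+ i * L0) m <= (K + 1) * (4 * A / c0) * inner_mass (2 ^+ i * L0) m.
    rewrite invf_div ler_wpM2r // ler_wpM2r ?lerDl //.
    by rewrite divr_ge0 ?mulr_ge0 // ltW.
  move=> hF hS.
  have e3 : c0 / 2 <= (K + 1) * (4 * A / c0) * inner_mass (2 ^+ i * L0) m by lra.
  have e4 : c0 ^+ 2 / (8 * A * (K + 1)) <= inner_mass (2 ^+ i * L0) m.
    have -> : inner_mass (2 ^+ i * L0) m = (c0 / (4 * A * (K + 1))) * ((K + 1) * (4 * A / c0) * inner_mass (2 ^+ i * L0) m).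
      by field; rewrite !gt_eqF.
    have -> : c0 ^+ 2 / (8 * A * (K + 1)) = (c0 / (4 * A * (K + 1))) * (c0 / 2).
      by field; rewrite !gt_eqF.
    by rewrite ler_wpM2l // divr_ge0 ?(ltW c00) // mulr_ge0 // ?mulr_ge0 // ltW.
  have e5 : g <= 2^-1 ^+ D.+4.+4 * inner_mass (2 ^+ i * L0) m.
    by rewrite /g mulrC ler_wpM2l // exprn_ge0 // invr_ge0.
  have -> : i.+1%:R * g = i%:R * g + g by rewrite -addn1 natrD mulrDl mul1r.
  rewrite addrA; apply: (le_trans (lerD h1 (le_trans e5 hS))). by rewrite addrC subrK.
have [j hj] : exists j : nat, B < j%:R * g.
  exists (Num.truncn (B / g)).+1; rewrite -ltr_pdivrMr //; exact: truncnS_gt.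
(* The number of doublings is fixed before the grid, so the two eventual bounds hold on a common
   grid. *)
have [m [h1 h2]] : exists m, c0 + j%:R * g <= outer_mass (2 ^+ j * L0) m /\ outer_mass (2 ^+ j * L0) m <= B.
  apply: (@filter_ex _ (nbhs \oo)).
  by apply: filterS2 (step j) (hB _ (L1 j)) => m h1 h2.
by move: (le_trans h1 h2); lra.
Qed.

End Estimates.

(** * Cutoffs and affine CR functions *)

Section CauchySchwarz.
Variable R : realFieldType.

Lemma quad_cs (A B T : R) : 0 <= A -> (forall l, 0 <= A * l ^+ 2 - 2 * l * T + B) ->
  T ^+ 2 <= A * B.
Proof.
move=> A0 h; have [A1|A1] := ltP 0 A.
  have := h (T / A); have -> : A * (T / A) ^+ 2 - 2 * (T / A) * T + B = (A * B - T ^+ 2) / A.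
    by field; rewrite gt_eqF.
  by rewrite pmulr_lge0 ?invr_gt0 // subr_ge0.
have A2 : A = 0 by apply/eqP; rewrite eq_le A0 A1.
have [->|T0] := eqVneq T 0; first by rewrite A2 mul0r expr0n.
(* For [A = 0] the form is affine in [l], and this [l] gives it the value -1. *)
have := h ((B + 1) / (2 * T)); have -> : A * ((B + 1) / (2 * T)) ^+ 2 - 2 * ((B + 1) / (2 * T)) * T + B = -1.
  by rewrite A2; field.
by lra.
Qed.

Lemma sum_cs (I : finType) (x y c e : I -> R) :
  (\sum_a (x a * c a + y a * e a)) ^+ 2 <=
  (\sum_a (x a ^+ 2 + y a ^+ 2)) * (\sum_a (c a ^+ 2 + e a ^+ 2)).
Proof.
apply: quad_cs => [|l]; first by apply: sumr_ge0 => a _; rewrite addr_ge0 // sqr_ge0.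
rewrite mulr_suml mulr_sumr -sumrB -big_split /=; apply: sumr_ge0 => a _.
have -> : (x a ^+ 2 + y a ^+ 2) * l ^+ 2 - 2 * l * (x a * c a + y a * e a) + (c a ^+ 2 + e a ^+ 2)
  = (x a * l - c a) ^+ 2 + (y a * l - e a) ^+ 2 by ring.
by rewrite addr_ge0 // sqr_ge0.
Qed.
End CauchySchwarz.

Section ComplexCauchySchwarz.
Variables (R : realType) (V : normedModType R) (I : finType).
Implicit Types (X Y : I -> csm V) (p : V).

Definition nsq (F : csm V) p : R := cRe F p ^+ 2 + cIm F p ^+ 2.
Lemma nsq_ge0 F p : 0 <= nsq F p. Proof. by rewrite addr_ge0 // sqr_ge0. Qed.

Lemma cRe_cs X Y p : cRe (\sum_a X a * Y a) p ^+ 2 <= (\sum_a nsq (X a) p) * (\sum_a nsq (Y a) p).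
Proof.
rewrite cRe_sum; under eq_bigr => a _ do rewrite cRe_mul.
have := @sum_cs R I (fun a => cRe (X a) p) (fun a => - cIm (X a) p) (fun a => cRe (Y a) p) (fun a => cIm (Y a) p).
move=> h; have e : \sum_a (cRe (X a) p * cRe (Y a) p - cIm (X a) p * cIm (Y a) p) =
  \sum_a (cRe (X a) p * cRe (Y a) p + - cIm (X a) p * cIm (Y a) p).
  by apply: eq_bigr => a _; rewrite mulNr.
rewrite e (le_trans h) //.
have -> // : \sum_a (cRe (X a) p ^+ 2 + (- cIm (X a) p) ^+ 2) = \sum_a nsq (X a) p.
by apply: eq_bigr => a _; rewrite sqrrN.
Qed.

Lemma cIm_cs X Y p : cIm (\sum_a X a * Y a) p ^+ 2 <= (\sum_a nsq (X a) p) * (\sum_a nsq (Y a) p).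
Proof.
rewrite cIm_sum; under eq_bigr => a _ do rewrite cIm_mul.
have := @sum_cs R I (fun a => cRe (X a) p) (fun a => cIm (X a) p) (fun a => cIm (Y a) p) (fun a => cRe (Y a) p).
move=> h; rewrite (le_trans h) //.
have -> // : \sum_a (cIm (Y a) p ^+ 2 + cRe (Y a) p ^+ 2) = \sum_a nsq (Y a) p.
by apply: eq_bigr => a _; rewrite addrC.
Qed.

Lemma nsq_mul F G p : nsq (F * G) p = nsq F p * nsq G p.
Proof. rewrite /nsq cRe_mul cIm_mul; ring. Qed.
Lemma nsq_add F G p : nsq (F + G) p <= 2 * nsq F p + 2 * nsq G p.
Proof.
rewrite /nsq cRe_add cIm_add.
have := sqr_ge0 (cRe F p - cRe G p); have := sqr_ge0 (cIm F p - cIm G p).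
by move: (cRe F p) (cRe G p) (cIm F p) (cIm G p) => ? ? ? ?; nra.
Qed.
Lemma nsq_opp F p : nsq (- F) p = nsq F p.
Proof. by rewrite /nsq cRe_opp cIm_opp !sqrrN. Qed.
Lemma nsq_conj F p : nsq (cconj F) p = nsq F p.
Proof. by rewrite /nsq cRe_conj cIm_conj sqrrN. Qed.
Lemma nsqE F p : cRe (F * cconj F) p = nsq F p.
Proof. exact: cRe_sqnorm. Qed.
Lemma nsq0_eq F : (forall p, nsq F p = 0) -> F = 0.
Proof.
move=> h; apply: csm_ext => p; have /eqP := h p; rewrite /nsq paddr_eq0 ?sqr_ge0 // !sqrf_eq0.
  by move=> /andP[/eqP -> _]; rewrite (cRe_nat 0).
by move=> /andP[_ /eqP ->]; rewrite (cIm_real _ (cj_nat _ 0)).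
Qed.
End ComplexCauchySchwarz.

(** * The Koranyi gauge and its cutoffs *)

Section Gauge.
Variables (R : realType) (n : nat).
Local Notation V := (heis R n).
Local Notation A := (csm V).
Local Notation ii := (ci R n).
Implicit Types (p : V) (L : R) (a : 'I_n).

Definition zsq p : R := \sum_a (xlin a p ^+ 2 + ylin a p ^+ 2).
(** The fourth power of the Koranyi gauge is a polynomial, hence smooth at the origin as well, and
    it is homogeneous of degree 4 under the dilations [(r z, r ^ 2 t)]. *)
Definition gauge4 p : R := zsq p ^+ 2 + p.2 ^+ 2.
Definition sg L p : R := gauge4 p * L^-1 ^+ 4.

Definition Zq : A := \sum_a zc R a * cconj (zc R a).
Definition Rho : A := Zq * Zq + ct R n * ct R n.
Definition Sc L : A := Rho * ccst V (L^-1 ^+ 4)%:C%C.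

Lemma cj_Zq : cconj Zq = Zq.
Proof.
rewrite /Zq raddf_sum; apply: eq_bigr => a _ /=.
by rewrite cconjM cconjK mulrC.
Qed.
Lemma cj_ct : cconj (ct R n) = ct R n. Proof. exact: cconj_creal. Qed.
Lemma cj_Rho : cconj Rho = Rho.
Proof. by rewrite /Rho cconjD 2!cconjM cj_Zq cj_ct. Qed.
Lemma cj_cst c : cconj (ccst V c%:C%C) = ccst V c%:C%C.
Proof. by rewrite cconj_ccst; congr (ccst _ _); apply/eqP; rewrite eq_complex /= oppr0 !eqxx. Qed.
Lemma cj_Sc L : cconj (Sc L) = Sc L.
Proof. by rewrite /Sc cconjM cj_Rho cj_cst. Qed.

Lemma cRe_cst c p : cRe (ccst V c%:C%C) p = c. Proof. by []. Qed.
Lemma cIm_cst c p : cIm (ccst V c%:C%C) p = 0. Proof. by []. Qed.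
Lemma cRe_ci p : cRe ii p = 0. Proof. by []. Qed.
Lemma cIm_ci p : cIm ii p = 1. Proof. by []. Qed.
Lemma cRe_cx a p : cRe (cx R a) p = xlin a p. Proof. by []. Qed.
Lemma cRe_cy a p : cRe (cy R a) p = ylin a p. Proof. by []. Qed.
Lemma nsq_zc a p : nsq (zc R a) p = xlin a p ^+ 2 + ylin a p ^+ 2.
Proof.
rewrite /nsq cRe_add cIm_add [cRe (ci R n * _) p]cRe_mul [cIm (ci R n * _) p]cIm_mul.
rewrite cRe_ci cIm_ci cRe_cx cRe_cy.
rewrite [cIm (cx R a) p](cIm_real p (cj_cx R a)) [cIm (cy R a) p](cIm_real p (cj_cy R a)); ring.
Qed.
Lemma cRe_Zq p : cRe Zq p = zsq p.
Proof. by rewrite cRe_sum; apply: eq_bigr => a _; rewrite nsqE nsq_zc. Qed.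
Lemma cRe_ct p : cRe (ct R n) p = p.2. Proof. exact: cRe_creal. Qed.
Lemma cRe_Sc L p : cRe (Sc L) p = sg L p.
Proof.
rewrite (cRe_mulr _ _ cj_Rho) cRe_cst /sg cRe_add (cRe_mulr _ _ cj_Zq) (cRe_mulr _ _ cj_ct).
by rewrite cRe_Zq cRe_ct.
Qed.

Lemma csm_real_eq (F G : A) : cconj F = F -> cconj G = G -> (forall p, cRe F p = cRe G p) -> F = G.
Proof. by move=> hF hG h; apply: csm_ext => // p; rewrite !cIm_real. Qed.

Lemma zsq_ge0 p : 0 <= zsq p.
Proof. by apply: sumr_ge0 => a _; rewrite addr_ge0 // sqr_ge0. Qed.
Lemma gauge4_ge0 p : 0 <= gauge4 p.
Proof. by rewrite addr_ge0 // sqr_ge0. Qed.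
Lemma sg_ge0 L p : 0 <= sg L p.
Proof. by rewrite mulr_ge0 ?gauge4_ge0 // (_ : L^-1 ^+ 4 = (L^-1 ^+ 2) ^+ 2) ?sqr_ge0 // -exprM. Qed.
Lemma sg_scale L p : sg (2 * L) p = sg L p / 16.
Proof. by rewrite /sg invfM; move: (L^-1) => l; field. Qed.

Lemma sg_lt1 L p : 1 <= L -> sg L p < 1 -> gauge4 p < L ^+ 4.
Proof.
move=> L1; have L0 : 0 < L by lra.
by rewrite /sg exprVn ltr_pdivrMr ?mul1r // exprn_gt0.
Qed.
Lemma sg_zsq L p : 1 <= L -> sg L p < 1 -> zsq p < L ^+ 2.
Proof.
move=> L1 h; have := sg_lt1 L1 h; have L0 : 0 < L by lra.
rewrite /gauge4 => h2.
have {}h2 : zsq p ^+ 2 < (L ^+ 2) ^+ 2 by rewrite -exprM; have := sqr_ge0 p.2; lra.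
by rewrite -(@ltr_pXn2r _ 2) // nnegrE ?zsq_ge0 // exprn_ge0 // ltW.
Qed.
Lemma sg_t L p : 1 <= L -> sg L p < 1 -> `|p.2| < L ^+ 2.
Proof.
move=> L1 h; have := sg_lt1 L1 h; have L0 : 0 < L by lra.
rewrite /gauge4 => h2.
have {}h2 : `|p.2| ^+ 2 < (L ^+ 2) ^+ 2 by rewrite -exprM real_normK ?num_real //; have := sqr_ge0 (zsq p); lra.
by rewrite -(@ltr_pXn2r _ 2) // nnegrE ?normr_ge0 // exprn_ge0 // ltW.
Qed.

Lemma sg_inbox L p : 1 <= L -> sg L p < 1 -> inbox L (L ^+ 2) 0 p.
Proof.
move=> L1 h; have L0 : 0 < L by lra.
have hz a : xlin a p ^+ 2 + ylin a p ^+ 2 <= L ^+ 2.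
  apply/ltW/(le_lt_trans _ (sg_zsq L1 h)); rewrite /zsq (bigD1 a) //= lerDl.
  by apply: sumr_ge0 => b _; rewrite addr_ge0 // sqr_ge0.
have sq (x : R) : x ^+ 2 <= L ^+ 2 -> `|x| <= L.
  by rewrite -(real_normK (num_real x)) ler_pXn2r // nnegrE // ltW.
have hx a : `|p.1.1 0 a| <= L by apply: sq; have := hz a; have := sqr_ge0 (ylin a p); rewrite /xlin; lra.
have hy a : `|p.1.2 0 a| <= L by apply: sq; have := hz a; have := sqr_ge0 (xlin a p); rewrite /ylin; lra.
rewrite /inbox; apply/and3P; split.
- by apply/forallP => a; rewrite !mxE subr0.
- by apply/forallP => a; rewrite !mxE subr0.
- by rewrite subr0 ltW // sg_t.
Qed.

Lemma ZbA_zc a b : ZbA a (zc R b) = 0.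
Proof.
rewrite /ZbA DD_zc_ex DD_zc_ey DD_zc_et.
have -> : half R n * ((a == b)%:R + ii * (ii * (a == b)%:R)) - ii * zc R a * 0 =
  half R n * (a == b)%:R * (1 + ii * ii) by ring.
by rewrite ci2 addrN mulr0.
Qed.
Lemma ZbA_cjzc a b : ZbA a (cconj (zc R b)) = (a == b)%:R.
Proof.
rewrite /ZbA DD_cjzc_ex DD_cjzc_ey DD_cjzc_et.
have -> : half R n * ((a == b)%:R + ii * - (ii * (a == b)%:R)) - ii * zc R a * 0 =
  half R n * (a == b)%:R * (1 - ii * ii) by ring.
rewrite ci2; transitivity ((2 * half R n) * (a == b)%:R); first by ring.
by rewrite half2 mul1r.
Qed.
Lemma ZbA_ct a : ZbA a (ct R n) = - (ii * zc R a).
Proof.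
rewrite /ZbA !DD_ct /tlin /= (ccst_nat _ _ 0) (ccst_nat _ _ 1); ring.
Qed.
Lemma ZbA_Zq a : ZbA a Zq = zc R a.
Proof.
rewrite /Zq raddf_sum /= -[RHS](JL.delta_sum a (fun b => zc R b)); apply: eq_bigr => b _.
by rewrite ZbAM ZbA_zc ZbA_cjzc mul0r add0r mulrC.
Qed.

Lemma ZbA_Sc L a : ZbA a (Sc L) = 2 * ccst V (L^-1 ^+ 4)%:C%C * (zc R a * (Zq - ii * ct R n)).
Proof.
rewrite /Sc ZbAM ZbA_ccst raddfD /= 2!ZbAM ZbA_Zq ZbA_ct; ring.
Qed.

(** The gradient is a multiple of [z_a (|z|^2 - i t)], and the squared modulus of [|z|^2 - i t] is
    [gauge4] again. On the gauge ball this gives at most [4 / L ^ 2], the source of the factor 4 in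
    the flux bounds. *)
Lemma sum_nsq_Sc L p : \sum_a nsq (ZbA a (Sc L)) p = 4 * (L^-1 ^+ 4) ^+ 2 * (zsq p * gauge4 p).
Proof.
have e : nsq (Zq - ii * ct R n) p = gauge4 p.
  rewrite /nsq cRe_sub cIm_add cIm_opp [cRe (ci R n * _) p]cRe_mul [cIm (ci R n * _) p]cIm_mul.
  rewrite cRe_ci cIm_ci cRe_Zq cRe_ct (cIm_real p cj_Zq) (cIm_real p cj_ct).
  rewrite /gauge4; ring.
rewrite (_ : zsq p = \sum_a (xlin a p ^+ 2 + ylin a p ^+ 2)) // mulr_suml mulr_sumr; apply: eq_bigr => a _.
rewrite ZbA_Sc (nsq_mul (2 * _)) (nsq_mul 2) (nsq_mul (zc R a)) e nsq_zc.
have -> : nsq (2 : A) p = 4 by rewrite /nsq (cRe_nat 2) (cIm_real _ (cj_nat V 2)); ring.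
by rewrite [nsq (ccst _ _) p]/nsq cRe_cst cIm_cst; ring.
Qed.

Lemma sum_nsq_Sc_le L p : 1 <= L -> sg L p < 1 -> \sum_a nsq (ZbA a (Sc L)) p <= 4 * L^-1 ^+ 2.
Proof.
move=> L1 h; have L0 : 0 < L by lra.
rewrite sum_nsq_Sc.
have h1 := ltW (sg_zsq L1 h); have h2 := ltW (sg_lt1 L1 h).
have h3 : zsq p * gauge4 p <= L ^+ 2 * L ^+ 4.
  by apply: ler_pM => //; [exact: zsq_ge0|exact: gauge4_ge0].
have -> : 4 * L^-1 ^+ 2 = 4 * (L^-1 ^+ 4) ^+ 2 * (L ^+ 2 * L ^+ 4) by field; rewrite gt_eqF.
by rewrite ler_wpM2l // mulr_ge0 // sqr_ge0.
Qed.

Definition bcut L p : R := sg L p * (1 - sg L p).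
Definition ecut N L p : R := 1 - sg L p ^+ N.

Lemma cRe_bcut L p : cRe (Sc L * (1 - Sc L)) p = bcut L p.
Proof. by rewrite (cRe_mulr _ _ (cj_Sc L)) cRe_sub cRe_Sc (cRe_nat 1). Qed.
Lemma cRe_ecut N L p : cRe (1 - Sc L ^+ N) p = ecut N L p.
Proof. by rewrite cRe_sub (cRe_exp _ _ (cj_Sc L)) cRe_Sc (cRe_nat 1). Qed.

Lemma smth_bcut L : smth (bcut L).
Proof. by rewrite -(_ : cRe (Sc L * (1 - Sc L)) = bcut L); [exact: smth_cRe|apply/funext => p; exact: cRe_bcut]. Qed.
Lemma smth_ecut N L : smth (ecut N L).
Proof. by rewrite -(_ : cRe (1 - Sc L ^+ N) = ecut N L); [exact: smth_cRe|apply/funext => p; exact: cRe_ecut]. Qed.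

Lemma creal_bcut L : creal (smth_bcut L) = Sc L * (1 - Sc L).
Proof.
apply: csm_real_eq => [||p]; first exact: cconj_creal.
  by rewrite cconjM cconjB (cj_nat _ 1) cj_Sc.
by rewrite cRe_bcut cRe_creal.
Qed.
Lemma creal_ecut N L : creal (smth_ecut N L) = 1 - Sc L ^+ N.
Proof.
apply: csm_real_eq => [||p]; first exact: cconj_creal.
  by rewrite cconjB (cj_nat _ 1) (cj_exp _ (cj_Sc L)).
by rewrite cRe_ecut cRe_creal.
Qed.

Lemma ZbA_1 a : ZbA a (1 : A) = 0.
Proof. by rewrite -(rmorph1 (ccst V)) ZbA_ccst. Qed.
Lemma ZbA_exp a (F : A) N : ZbA a (F ^+ N.+1) = N.+1%:R * F ^+ N * ZbA a F.
Proof.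
elim: N => [|N IH]; first by rewrite expr1 expr0 !mul1r.
by rewrite exprS ZbAM IH -[N.+2]addn1 natrD exprS; ring.
Qed.

Lemma ZbA_bcut L a : ZbA a (creal (smth_bcut L)) = (1 - 2 * Sc L) * ZbA a (Sc L).
Proof. rewrite creal_bcut ZbAM raddfB /= ZbA_1; ring. Qed.
Lemma ZbA_ecut N L a : ZbA a (creal (smth_ecut N.+1 L)) = - (N.+1%:R * Sc L ^+ N) * ZbA a (Sc L).
Proof. by rewrite creal_ecut raddfB /= ZbA_1 ZbA_exp sub0r mulNr. Qed.

(** Integration by parts is stated for isotropic boxes, whereas the volume count relies on the
    anisotropic one. *)
Lemma inbox_widen L p : 1 <= L -> inbox L (L ^+ 2) 0 p -> inbox (L ^+ 2) (L ^+ 2) 0 p.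
Proof.
move=> L1 /and3P[/forallP h1 /forallP h2 h3]; have h : L <= L ^+ 2 by nra.
apply/and3P; split=> //; apply/forallP => a.
  exact: le_trans (h1 a) h.
exact: le_trans (h2 a) h.
Qed.

Lemma bcut_supp L p : 1 <= L -> 0 < bcut L p -> inbox (L ^+ 2) (L ^+ 2) 0 p.
Proof.
move=> L1; rewrite /bcut => h; apply/inbox_widen/sg_inbox => //.
by have := sg_ge0 L p; nra.
Qed.
Lemma ecut_supp N L p : 1 <= L -> 0 < ecut N L p -> inbox (L ^+ 2) (L ^+ 2) 0 p.
Proof.
move=> L1; rewrite /ecut subr_gt0 => h; apply/inbox_widen/sg_inbox => //.
by rewrite ltNge; apply/negP => h1; move: h; rewrite ltNge exprn_ege1.
Qed.

End Gauge.

(** * CR functions with affine horizontal gradient *)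

Section CRAffine.
Variables (R : realType) (n : nat).
Local Notation V := (heis R n).
Local Notation A := (csm V).
Local Notation ii := (ci R n).
Local Notation T := (DD (et R n)).
Implicit Types (p : V) (a b : 'I_n) (F : A).

Lemma axis_decomp p : p = \sum_a p.1.1 0 a *: ex R a + \sum_a p.1.2 0 a *: ey R a + p.2 *: et R n.
Proof.
have sum_ex : \sum_a p.1.1 0 a *: ex R a = (p.1.1, 0, 0).
  rewrite [in RHS](row_sum_delta p.1.1).
  elim/big_rec2: _ => [//|a x y _ ->]; rewrite /ex.
  by congr (_, _, _) => /=; rewrite scaler0 addr0.
have sum_ey : \sum_a p.1.2 0 a *: ey R a = (0, p.1.2, 0).
  rewrite [in RHS](row_sum_delta p.1.2).
  elim/big_rec2: _ => [//|a x y _ ->]; rewrite /ey.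
  by congr (_, _, _) => /=; rewrite scaler0 addr0.
rewrite sum_ex sum_ey; case: p {sum_ex sum_ey} => -[x y] t; rewrite /et; congr (_, _, _) => /=.
- by rewrite scaler0 !addr0.
- by rewrite scaler0 !addr0 add0r.
- by rewrite !add0r; rewrite /GRing.scale /= mulr1.
Qed.

Lemma real_const (h : V -> R) : smth h -> (forall a p, 'D_(ex R a) h p = 0) ->
  (forall a p, 'D_(ey R a) h p = 0) -> (forall p, 'D_(et R n) h p = 0) -> forall p, h p = h 0.
Proof.
move=> sh hx hy ht p.
have D0 v p' : 'D_v h p' = 0.
  have dh : differentiable h p' by exact: smth_diff.
  rewrite deriveE // (axis_decomp v) !linearD !linear_sum /= linearZ /= -[X in _ + _ *: X]deriveE // ht scaler0 addr0.
  rewrite !big1 ?addr0 // => a _; rewrite linearZ /= -deriveE // ?hx ?hy scaler0 //.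
have [t _] := mvt_line 0 p (fun q => @smth_diff R V h q sh) (ler01 : (0 : R) <= 1).
by rewrite D0 mulr0 scale1r add0r => /eqP; rewrite subr_eq0 => /eqP.
Qed.

Lemma cRe_D0 v F p : DD v F = 0 -> 'D_v (cRe F : V -> R) p = 0.
Proof. by move=> h; have e : cRe (DD v F) p = 0 by [rewrite h; exact: (cRe_nat 0 p)]; exact: e. Qed.
Lemma cIm_D0 v F p : DD v F = 0 -> 'D_v (cIm F : V -> R) p = 0.
Proof. by move=> h; have e : cIm (DD v F) p = 0 by [rewrite h; exact: (cIm_real p (cj_nat V 0))]; exact: e. Qed.

(** Up to multiples of [T F], the sum and the difference of [ZA a F] and [ZbA a F] are the two
    coordinate derivatives. *)
Lemma csm_const F : (forall a, ZA a F = 0) -> (forall a, ZbA a F = 0) -> T F = 0 ->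
  F = ccst V (F 0).
Proof.
move=> h1 h2 h3.
have hx a : DD (ex R a) F = 0.
  have e : ZA a F + ZbA a F = 2 * half R n * DD (ex R a) F + ii * (cconj (zc R a) - zc R a) * T F.
    rewrite /ZA /ZbA; ring.
  by rewrite h1 h2 h3 half2 mul1r mulr0 !addr0 in e.
have hy a : DD (ey R a) F = 0.
  have e : ZbA a F - ZA a F = ii * (2 * half R n * DD (ey R a) F) - ii * (cconj (zc R a) + zc R a) * T F.
    rewrite /ZA /ZbA; ring.
  rewrite h1 h2 h3 half2 mul1r mulr0 !subr0 in e.
  have -> : DD (ey R a) F = - (ii * ii) * DD (ey R a) F by rewrite ci2 opprK mul1r.
  by rewrite mulNr -mulrA -e mulr0 oppr0.
have r : forall p, cRe F p = cRe F 0.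
  apply: (@real_const (cRe F)) => [|a p|a p|p]; first exact: smth_cRe.
  + exact: cRe_D0 (hx a).
  + exact: cRe_D0 (hy a).
  + exact: cRe_D0 h3.
have i : forall p, cIm F p = cIm F 0.
  apply: (@real_const (cIm F)) => [|a p|a p|p]; first exact: smth_cIm.
  + exact: cIm_D0 (hx a).
  + exact: cIm_D0 (hy a).
  + exact: cIm_D0 h3.
by apply: csm_ext => p; [rewrite r|rewrite i].
Qed.

Lemma ZA_zc a b : ZA a (zc R b) = (a == b)%:R.
Proof. by rewrite -[zc R b]cconjK -[LHS]cconjK cjZA cconjK ZbA_cjzc cj_nat. Qed.
Lemma ZA_cjzc a b : ZA a (cconj (zc R b)) = 0.
Proof. by rewrite -[LHS]cconjK cjZA cconjK ZbA_zc (cj_nat _ 0). Qed.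
Lemma ZA_ct a : ZA a (ct R n) = ii * cconj (zc R a).
Proof. by rewrite -[LHS]cconjK cjZA cj_ct ZbA_ct raddfN /= cconjM cj_ci mulNr opprK. Qed.
Lemma ZA_Zq a : ZA a (Zq R n) = cconj (zc R a).
Proof. by rewrite -[LHS]cconjK cjZA cj_Zq ZbA_Zq. Qed.
Lemma T_Zq : T (Zq R n) = 0.
Proof.
rewrite /Zq raddf_sum big1 //= => a _.
by rewrite DDM DD_zc_et DD_cjzc_et mulr0 mul0r addr0.
Qed.
Lemma T_ct : T (ct R n) = 1.
Proof. by rewrite DD_ct; exact: (ccst_nat _ _ 1). Qed.

Lemma ZA_sub a F G : ZA a (F - G) = ZA a F - ZA a G. Proof. exact: raddfB. Qed.
Lemma ZbA_sub a F G : ZbA a (F - G) = ZbA a F - ZbA a G. Proof. exact: raddfB. Qed.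
Lemma T_sub F G : T (F - G) = T F - T G. Proof. exact: raddfB. Qed.

Lemma cr_affine F : T F = 1 -> (forall a, ZbA a F = 0) -> (forall a b, ZA b (ZA a F) = 0) ->
  exists (mu : 'rV[R[i]]_n) (lambda : R[i]),
    F = ct R n + ii * Zq R n + \sum_a ccst V (mu 0 a) * zc R a + ccst V lambda /\
    forall a, ZA a F = ccst V (mu 0 a) + 2 * ii * cconj (zc R a).
Proof.
move=> TF ZbF ZZF.
pose H := F - ct R n - ii * Zq R n.
have TH : T H = 0 by rewrite /H 2!T_sub TF T_ct DDM DD_ci T_Zq; ring.
have ZbH a : ZbA a H = 0.
  rewrite /H 2!ZbA_sub ZbF ZbA_ct ZbAM ZbA_ci ZbA_Zq; ring.
have ZH a : ZA a H = ZA a F - 2 * ii * cconj (zc R a).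
  rewrite /H 2!ZA_sub ZA_ct ZAM ZA_ci ZA_Zq; ring.
have Z2 a : ZA a (2 * ii) = 0 :> A.
  by rewrite -(rmorph_nat (ccst V) 2) -rmorphM ZA_ccst.
have cZ a : ZA a H = ccst V (ZA a H 0).
  apply: csm_const => [b|b|].
  - rewrite ZH ZA_sub ZZF ZAM Z2 ZA_cjzc; ring.
  - have := ZA_ZbA a b H; rewrite ZbH TH raddf0 mulr0 mulr0 subr0 => <- //.
  - by rewrite -ZA_DDet TH raddf0.
pose mu : 'rV[R[i]]_n := \row_a ZA a H 0.
have muE a : ccst V (mu 0 a) = ZA a H by rewrite mxE -cZ.
have ZF a : ZA a F = ccst V (mu 0 a) + 2 * ii * cconj (zc R a).
  by rewrite muE ZH subrK.
pose K := H - \sum_a ccst V (mu 0 a) * zc R a.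
have cK : K = ccst V (K 0).
  apply: csm_const => [b|b|].
  - rewrite /K ZA_sub raddf_sum /= -(muE b) -[X in X - _](JL.delta_sum b (fun a => ccst V (mu 0 a))) -sumrB big1 // => a _.
    by rewrite ZAM ZA_ccst ZA_zc; ring.
  - rewrite /K ZbA_sub raddf_sum /= ZbH big1 ?subr0 // => a _.
    by rewrite ZbAM ZbA_ccst ZbA_zc; ring.
  - rewrite /K T_sub raddf_sum /= TH big1 ?subr0 // => a _.
    by rewrite DDM DD_ccst DD_zc_et; ring.
exists mu, (K 0); split=> //.
by rewrite -cK /K /H; ring.
Qed.
End CRAffine.

(** * Vanishing of the Jerison-Lee density and conclusion *)

Section Bubble.
Variables (R : realType) (d : nat) (u : heis R d.+2 -> R).
Local Notation n := d.+2.
Local Notation V := (heis R n).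
Local Notation A := (csm V).
Hypothesis u_smooth : smooth u.
Hypothesis u_pos : forall p, 0 < u p.
Hypothesis u_eq : forall p : V,
     4 * subLaplacian u p = n%:R ^+ 2 * u p `^ ((n%:R + 2) / n%:R).
Hypothesis u_decay : exists2 C : R, 0 < C &
     forall p : V, p != 0 ->
       u p <= C * (csqnorm (zcoord p) + `|tcoord p|) `^ (- ((n%:R - 2) / 2)).
Local Notation f := (fC u_smooth u_pos).
Local Notation v := (vC u_smooth u_pos).
Local Notation vr := (vR u).
Local Notation ii := (ci R n).
Implicit Types (p : V) (L : R).
Let n_gt0 : (0 < n)%N := isT.

(* Bundled copies of [ZA], [ZbA], [DD] and [cconj]: the lemmas of [JL] quantify over bundled maps. *)
Definition Zs a : {additive A -> A} := ZA a.
Definition Zbs a : {additive A -> A} := ZbA a.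
Definition Ts : {additive A -> A} := DD (et R n).
Definition cjs : {rmorphism A -> A} := @cconj R V.

Lemma ZsM a (x y : A) : Zs a (x * y) = Zs a x * y + x * Zs a y. Proof. exact: ZAM. Qed.
Lemma ZbsM a (x y : A) : Zbs a (x * y) = Zbs a x * y + x * Zbs a y. Proof. exact: ZbAM. Qed.
Lemma TsM (x y : A) : Ts (x * y) = Ts x * y + x * Ts y. Proof. exact: DDM. Qed.
Lemma iis2 : ii * ii = -1. Proof. exact: ci2. Qed.
Lemma cjs_ii : cjs ii = - ii. Proof. exact: cj_ci. Qed.
Lemma Zs_ii a : Zs a ii = 0. Proof. exact: ZA_ci. Qed.
Lemma Zbs_ii a : Zbs a ii = 0. Proof. exact: ZbA_ci. Qed.
Lemma Ts_ii : Ts ii = 0. Proof. exact: DD_ci. Qed.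
Lemma cjsK (x : A) : cjs (cjs x) = x. Proof. exact: cconjK. Qed.
Lemma cjs_Zs a (x : A) : cjs (Zs a x) = Zbs a (cjs x). Proof. exact: cjZA. Qed.
Lemma cjs_Ts (x : A) : cjs (Ts x) = Ts (cjs x). Proof. exact: cconj_DD. Qed.
Lemma Zs_Zs a b (x : A) : Zs a (Zs b x) = Zs b (Zs a x). Proof. exact: ZA_ZA. Qed.
Lemma Zs_Ts a (x : A) : Zs a (Ts x) = Ts (Zs a x). Proof. exact: ZA_DDet. Qed.
Lemma Zs_Zbs a b (x : A) : Zs a (Zbs b x) = Zbs b (Zs a x) - (a == b)%:R * (2 * ii * Ts x).
Proof. exact: ZA_ZbA. Qed.
Lemma cjs_f : cjs f = f. Proof. exact: cconj_creal. Qed.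
Lemma cjs_v : cjs v = v. Proof. exact: cconj_creal. Qed.
Lemma Zs_v a : Zs a v = v * Zs a f. Proof. exact: ZA_vC. Qed.
Lemma Ts_v : Ts v = v * Ts f. Proof. exact: DD_vC. Qed.
Lemma feqs : \sum_a Zbs a (JL.fa Zs f a) = - (n%:R * JL.g Zs Zbs Ts ii f v).
Proof. exact: feqC. Qed.

Local Notation Z := Zs.
Local Notation Zb := Zbs.
Local Notation T := Ts.
Local Notation cj := cjs.
Local Notation fa := (JL.fa Zs f).
Local Notation fb := (JL.fb Zbs f).
Local Notation q := (JL.q Zs Zbs f).
Local Notation g := (JL.g Zs Zbs Ts ii f v).
Local Notation gb := (JL.gb Zs Zbs Ts ii f v).
Local Notation Dc := (JL.Dv Zs Zbs f).
Local Notation Ec := (JL.Ev Zs Zbs Ts ii f v).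
Local Notation Gc := (JL.Gv Zs Zbs Ts ii f v).
Local Notation dd := (JL.dd Zs Zbs f).
Local Notation ee := (JL.ee Zs Zbs Ts ii f v).
Local Notation cc := (JL.cc Zs Zbs Ts ii f v).
Local Notation hh := (JL.h Ts ii f).
Local Notation Xc := (JL.XJ Zs Zbs Ts ii f v).
Local Notation Tabc := (JL.Tabc Zs Zbs Ts ii f v).
Local Notation Dm := (JL.Dm Zs f).
Local Notation Em := (JL.Em Zs Zbs Ts ii f v).

Definition Qc : A := \sum_a ((Gc a + Dc a) * cjs (Gc a + Dc a) + (Gc a - Ec a) * cjs (Gc a - Ec a)
     + Gc a * cjs (Gc a)) + JL.P v * (JL.ND Zs cjs f + JL.NE Zs Zbs Ts cjs ii f v)
     + \sum_a \sum_b \sum_c Tabc a b c * cjs (Tabc a b c).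

Lemma divc_f j : \sum_a Zbs a (v ^+ j * fa a) = v ^+ j * (j%:R * q - n%:R * g).
Proof. exact (@JL.div_vf A n Zs Zbs Ts cjs ii ZsM ZbsM cjs_Zs f v cjs_f cjs_v Zs_v feqs j). Qed.

Lemma divc_qf j : \sum_a Zbs a (v ^+ j * q * fa a) =
  v ^+ j * (j%:R * q * q + cjs dd + cjs ee + (2 * q - g) * q - n%:R * q * g).
Proof.
exact (@JL.div_vqf A n Zs Zbs Ts cjs ii ZsM ZbsM cjs_ii cjsK cjs_Zs cjs_Ts Zs_Zs Zs_Zbs f v cjs_f cjs_v
  Zs_v feqs j).
Qed.

Lemma divc_gf j : \sum_a Zbs a (v ^+ j * gb * fa a) =
  v ^+ j * (j%:R * q * gb + cjs dd + cjs ee - cjs cc + 2 * gb * q - n%:R * g * gb).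
Proof.
exact (@JL.div_vgf A n Zs Zbs Ts cjs ii ZsM ZbsM cjs_ii Zs_ii cjsK cjs_Zs cjs_Ts Zs_Zs Zs_Ts Zs_Zbs
  f v cjs_f cjs_v Zs_v feqs j).
Qed.

Lemma divc_X j : (j%:R = 2 * (n%:R - 1) :> A) ->
  \sum_a Zbs a (v ^+ j * Xc a) + cjs (\sum_a Zbs a (v ^+ j * Xc a)) = 2 * v ^+ j * Qc.
Proof.
exact (@JL.jerison_lee A n Zs Zbs Ts cjs ii ZsM ZbsM TsM cjs_ii Zs_ii Zbs_ii cjsK cjs_Zs cjs_Ts Zs_Zs
  Zs_Ts Zs_Zbs f v cjs_f cjs_v Zs_v Ts_v feqs j).
Qed.

Lemma cj_gc : cjs g = gb.
Proof. exact (@JL.cj_g A n Zs Zbs Ts cjs ii cjs_ii cjsK cjs_Zs cjs_Ts f v cjs_f cjs_v). Qed.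
Lemma cj_qc : cjs q = q.
Proof. exact (@JL.cj_q A n Zs Zbs cjs cjsK cjs_Zs f cjs_f). Qed.
Lemma cj_fac a : cjs (fa a) = fb a.
Proof. exact (@JL.cj_fa A n Zs Zbs cjs cjs_Zs f cjs_f a). Qed.
Lemma gcE : g = q + v * v - hh. Proof. exact: JL.gE. Qed.
Lemma gbcE : gb = q + v * v + hh. Proof. exact: JL.gbE. Qed.
Lemma hcE : hh = ii * Ts f. Proof. exact: JL.hE. Qed.
Lemma qcE : q = \sum_a fa a * fb a. Proof. exact: JL.qE. Qed.

(** * Real densities and the bounds between them *)

Definition qr : V -> R := cRe q.
Definition f0r : V -> R := cRe (T f).
Definition Mr : V -> R := cRe Qc.
Definition ar p : R := cRe dd p + cRe ee p.
Definition a'r p : R := cRe dd p + cRe ee p - cRe cc p.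

Lemma cRe_cjs (x : A) p : cRe (cj x) p = cRe x p. Proof. exact: cRe_conj. Qed.
Lemma nsq_cjs (x : A) p : nsq (cj x) p = nsq x p. Proof. exact: nsq_conj. Qed.
Lemma nsqEs (x : A) p : cRe (x * cj x) p = nsq x p. Proof. exact: nsqE. Qed.
Lemma cRe_v p : cRe v p = vr p. Proof. exact: cRe_creal. Qed.
Lemma cj_vX j : cconj (v ^+ j) = v ^+ j. Proof. by apply: cj_exp; exact: cconj_creal. Qed.
Lemma cj_vv : cconj (v * v) = v * v. Proof. by rewrite cconjM cconj_creal. Qed.
Lemma cRe_vX j p : cRe (v ^+ j) p = vr p ^+ j.
Proof. by rewrite cRe_exp ?cRe_v //; exact: cconj_creal. Qed.
Lemma cRe_vv p : cRe (v * v) p = vr p ^+ 2.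
Proof. exact: (cRe_vX 2). Qed.
Lemma cIm_q p : cIm q p = 0. Proof. by apply: cIm_real; exact: cj_qc. Qed.
Lemma cIm_f0 p : cIm (T f) p = 0.
Proof. by apply: cIm_real; rewrite cconj_DD cconj_creal. Qed.
Lemma cRe_ii p : cRe ii p = 0. Proof. by []. Qed.
Lemma cIm_ii p : cIm ii p = 1. Proof. by []. Qed.
Lemma cRe_hh p : cRe hh p = 0.
Proof. by rewrite hcE cRe_mul cRe_ii cIm_ii cIm_f0; ring. Qed.
Lemma cIm_hh p : cIm hh p = f0r p.
Proof. by rewrite hcE cIm_mul cRe_ii cIm_ii; rewrite /f0r; ring. Qed.
Lemma cIm_vv p : cIm (v * v) p = 0. Proof. by apply: cIm_real; exact: cj_vv. Qed.
Lemma cRe_g p : cRe g p = qr p + vr p ^+ 2.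
Proof. by rewrite gcE cRe_sub cRe_add cRe_vv cRe_hh subr0. Qed.
Lemma cIm_g p : cIm g p = - f0r p.
Proof. by rewrite gcE cIm_add cIm_opp cIm_add cIm_vv cIm_hh cIm_q; ring. Qed.
Lemma cRe_gb p : cRe gb p = qr p + vr p ^+ 2.
Proof. by rewrite gbcE cRe_add cRe_add cRe_vv cRe_hh addr0. Qed.
Lemma cIm_gb p : cIm gb p = f0r p.
Proof. by rewrite gbcE cIm_add cIm_add cIm_vv cIm_hh cIm_q; ring. Qed.

Lemma qrE p : qr p = \sum_a nsq (fa a) p.
Proof.
rewrite /qr qcE cRe_sum; apply: eq_bigr => a _.
by rewrite -cj_fac nsqEs.
Qed.
Lemma qr_ge0 p : 0 <= qr p.
Proof. by rewrite qrE; apply: sumr_ge0 => a _; exact: nsq_ge0. Qed.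

Lemma cRe_div1 j p : cRe (\sum_a Zb a (v ^+ j * fa a)) p =
  vr p ^+ j * ((j%:R - n%:R) * qr p - n%:R * vr p ^+ 2).
Proof.
rewrite (divc_f ) (cRe_mulr _ _ (cj_vX j)) cRe_vX cRe_sub.
rewrite (cRe_mulr _ _ (cj_nat _ _)) (cRe_mulr _ _ (cj_nat _ _)) !cRe_nat cRe_g -/(qr p); ring.
Qed.

Lemma cRe_div2 p : cRe (\sum_a Zb a (v ^+ (d + d).+2 * q * fa a)) p =
  vr p ^+ (d + d).+2 * (d.+1%:R * qr p ^+ 2 - d.+3%:R * (qr p * vr p ^+ 2) + ar p).
Proof.
rewrite (divc_qf ) (cRe_mulr _ _ (cj_vX _)) cRe_vX; congr (_ * _).
rewrite cRe_sub cRe_add cRe_add cRe_add !cRe_cjs.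
rewrite -[(d + d).+2%:R * q * q]mulrA -[n%:R * q * g]mulrA.
rewrite (cRe_mulr _ _ (cj_nat _ _)) (cRe_mulr _ _ (cj_nat _ _)) !cRe_nat.
rewrite cRe_mul [cRe (_ * q) p]cRe_mul [cRe (q * g) p]cRe_mul !cIm_q cRe_sub (cRe_mulr _ _ (cj_nat _ _)) cRe_nat.
rewrite cRe_g -/(qr p) /ar.
move: (qr p) (vr p) (cRe dd p) (cRe ee p) (cIm _ p) (cIm _ p) => x y a b c e.
rewrite -[(d + d).+2]addn2 -[d.+3]addn3 -[d.+2]addn2 -[d.+1]addn1 !natrD; ring.
Qed.

Lemma cRe_div3 p : cRe (\sum_a Zb a (v ^+ (d + d).+2 * gb * fa a)) p =
  vr p ^+ (d + d).+2 * (n%:R * (qr p ^+ 2 - vr p ^+ 4 - f0r p ^+ 2) + a'r p).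
Proof.
rewrite (divc_gf ) (cRe_mulr _ _ (cj_vX _)) cRe_vX; congr (_ * _).
rewrite cRe_sub cRe_add cRe_sub cRe_add cRe_add !cRe_cjs.
rewrite -[(d + d).+2%:R * q * gb]mulrA -[n%:R * g * gb]mulrA -[2 * gb * q]mulrA.
rewrite (cRe_mulr _ _ (cj_nat _ _)) (cRe_mulr _ _ (cj_nat _ _)) (cRe_mulr _ _ (cj_nat _ _)) !cRe_nat.
rewrite (cRe_mulr _ _ cj_qc) cRe_mul [cRe (g * gb) p]cRe_mul cIm_q.
rewrite cRe_g cRe_gb cIm_g cIm_gb -/(qr p) /a'r.
move: (qr p) (vr p) (f0r p) (cRe dd p) (cRe ee p) (cRe cc p) => x y z a b c.
rewrite -[(d + d).+2]addn2 -[d.+2]addn2 !natrD; ring.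
Qed.

Lemma cRe_div4 p : cRe (\sum_a Zb a (v ^+ (d + d).+2 * Xc a)) p = vr p ^+ (d + d).+2 * Mr p.
Proof.
have e : (d + d).+2%:R = 2 * (n%:R - 1) :> A.
  by rewrite -[(d + d).+2]addn2 -[d.+2]addn2 !natrD; ring.
have := divc_X e.
move: (\sum_a Zb a (v ^+ (d + d).+2 * Xc a)) => S hS.
have : cRe (S + cj S) p = cRe (2 * v ^+ (d + d).+2 * Qc) p by rewrite hS.
rewrite cRe_add cRe_cjs -mulrA (cRe_mulr _ _ (cj_nat _ _)) (cRe_mulr _ _ (cj_vX _)) cRe_vX cRe_nat -/(Mr p).
by move: (cRe S p) (_ * Mr p) => x y h; lra.
Qed.

Lemma MrE p : Mr p = \sum_a (nsq (Gc a + Dc a) p + nsq (Gc a - Ec a) p + nsq (Gc a) p)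
  + vr p ^+ 2 * (\sum_a \sum_b nsq (Dm a b) p + \sum_a \sum_b nsq (Em a b) p)
  + \sum_a \sum_b \sum_c nsq (Tabc a b c) p.
Proof.
rewrite /Mr /Qc 2!cRe_add; congr (_ + _ + _).
- rewrite cRe_sum; apply: eq_bigr => a _; rewrite 2!cRe_add !nsqEs; reflexivity.
- rewrite JL.PE (cRe_mulr _ _ cj_vv) cRe_vv cRe_add; congr (_ * (_ + _)).
  + rewrite cRe_sum; apply: eq_bigr => a _; rewrite cRe_sum; apply: eq_bigr => b _; exact: nsqEs.
  + rewrite cRe_sum; apply: eq_bigr => a _; rewrite cRe_sum; apply: eq_bigr => b _; exact: nsqEs.
- rewrite cRe_sum; apply: eq_bigr => a _; rewrite cRe_sum; apply: eq_bigr => b _.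
  rewrite cRe_sum; apply: eq_bigr => c _; exact: nsqEs.
Qed.

Lemma nsq_sum2_ge0 (F : 'I_n -> 'I_n -> A) p : 0 <= \sum_a \sum_b nsq (F a b) p.
Proof. by apply: sumr_ge0 => a _; apply: sumr_ge0 => b _; exact: nsq_ge0. Qed.
Lemma nsq_sum3_ge0 (F : 'I_n -> 'I_n -> 'I_n -> A) p : 0 <= \sum_a \sum_b \sum_c nsq (F a b c) p.
Proof. by apply: sumr_ge0 => a _; exact: nsq_sum2_ge0. Qed.

Lemma Mr_ge p : \sum_a (nsq (Gc a + Dc a) p + nsq (Gc a - Ec a) p + nsq (Gc a) p) <= Mr p.
Proof.
rewrite MrE; have h1 := nsq_sum2_ge0 Dm p; have h2 := nsq_sum2_ge0 Em p.
have h3 := nsq_sum3_ge0 Tabc p.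
have h4 := mulr_ge0 (sqr_ge0 (vr p)) (addr_ge0 h1 h2).
by rewrite -addrA lerDl addr_ge0.
Qed.

Lemma Mr_ge0 p : 0 <= Mr p.
Proof.
apply: le_trans (Mr_ge p); apply: sumr_ge0 => a _.
exact: addr_ge0 (addr_ge0 (nsq_ge0 _ _) (nsq_ge0 _ _)) (nsq_ge0 _ _).
Qed.

Lemma nsq_sub (F G : A) p : nsq (F - G) p <= 2 * nsq F p + 2 * nsq G p.
Proof. by rewrite -(nsq_opp G); exact: nsq_add. Qed.

Definition Nr p := \sum_a (nsq (Dc a) p + nsq (Ec a) p + nsq (Gc a) p).

(** From [D = (G + D) - G] and [E = G - (G - E)]: the squares in [Mr] are used with weights 2, 2 and
    2 + 2 + 1 = 5. *)
Lemma Nr_le p : Nr p <= 5 * Mr p.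
Proof.
apply: (@le_trans _ _ (5 * \sum_a (nsq (Gc a + Dc a) p + nsq (Gc a - Ec a) p + nsq (Gc a) p))); last first.
  by rewrite ler_pM2l // Mr_ge.
rewrite mulr_sumr; apply: ler_sum => a _.
have h1 := nsq_sub (Gc a + Dc a) (Gc a) p; have h2 := nsq_sub (Gc a) (Gc a - Ec a) p.
have e1 : Gc a + Dc a - Gc a = Dc a by ring.
have e2 : Gc a - (Gc a - Ec a) = Ec a by ring.
rewrite e1 in h1; rewrite e2 in h2.
have h3 := nsq_ge0 (Gc a + Dc a) p; have h4 := nsq_ge0 (Gc a - Ec a) p.
move: h1 h2 h3 h4; move: (nsq (Gc a + Dc a) p) (nsq (Gc a - Ec a) p) (nsq _ p) (nsq _ p) (nsq _ p) => *; lra.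
Qed.

Lemma sum_fb p : \sum_a nsq (fb a) p = qr p.
Proof. by rewrite qrE; apply: eq_bigr => a _; rewrite -cj_fac nsq_cjs. Qed.

Lemma ar_le p : ar p ^+ 2 <= 10 * (qr p * Mr p).
Proof.
have e : ar p = cRe (\sum_a (Dc a + Ec a) * fb a) p.
  rewrite /ar -cRe_add; congr (cRe _ p); rewrite /JL.dd /JL.ee -big_split /=.
  by apply: eq_bigr => a _; rewrite mulrDl.
rewrite e (le_trans (cRe_cs _ _ p)) // sum_fb.
have h : \sum_a nsq (Dc a + Ec a) p <= 2 * Nr p.
  rewrite mulr_sumr; apply: ler_sum => a _.
  have := nsq_add (Dc a) (Ec a) p; have := nsq_ge0 (Gc a) p.
  by move: (nsq (Gc a) p) (nsq (Dc a) p) (nsq (Ec a) p) (nsq _ p) => *; lra.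
have -> : 10 * (qr p * Mr p) = (2 * (5 * Mr p)) * qr p by ring.
apply: ler_wpM2r; first exact: qr_ge0.
by apply: (le_trans h); rewrite ler_pM2l // Nr_le.
Qed.

Lemma nsq_add3 (x y z : A) p : nsq (x + y - z) p <= 3 * (nsq x p + nsq y p + nsq z p).
Proof.
rewrite /nsq cRe_sub cRe_add cIm_add cIm_opp cIm_add.
move: (cRe x p) (cRe y p) (cRe z p) (cIm x p) (cIm y p) (cIm z p) => a b c a' b' c'.
rewrite -subr_ge0.
have -> : 3 * (a ^+ 2 + a' ^+ 2 + (b ^+ 2 + b' ^+ 2) + (c ^+ 2 + c' ^+ 2)) - ((a + b - c) ^+ 2 + (a' + b' - c') ^+ 2)
  = (a - b) ^+ 2 + (a + c) ^+ 2 + (b + c) ^+ 2 + ((a' - b') ^+ 2 + (a' + c') ^+ 2 + (b' + c') ^+ 2) by ring.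
by rewrite !addr_ge0 // sqr_ge0.
Qed.

Lemma a'r_le p : a'r p ^+ 2 <= 15 * (qr p * Mr p).
Proof.
have e : a'r p = cRe (\sum_a (Dc a + Ec a - Gc a) * fb a) p.
  rewrite /a'r -cRe_add -cRe_sub; congr (cRe _ p); rewrite /JL.dd /JL.ee /JL.cc -big_split /= -sumrB.
  apply: eq_bigr => a _; rewrite [RHS]mulrBl; congr (_ - _); rewrite mulrDl; reflexivity.
rewrite e (le_trans (cRe_cs _ _ p)) // sum_fb.
have h : \sum_a nsq (Dc a + Ec a - Gc a) p <= 3 * Nr p.
  by rewrite mulr_sumr; apply: ler_sum => a _; exact: nsq_add3.
have -> : 15 * (qr p * Mr p) = (3 * (5 * Mr p)) * qr p by ring.
apply: ler_wpM2r; first exact: qr_ge0.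
by apply: (le_trans h); rewrite ler_pM2l // Nr_le.
Qed.

(** 135 is [3 * 9 * 5]: a sum of three terms, coefficients with squared modulus at most 9 times the
    weight, and the constant of [Nr_le]. *)
Lemma Xc_le p : \sum_a nsq (Xc a) p <=
  135 * (((qr p + vr p ^+ 2) ^+ 2 + f0r p ^+ 2) * Mr p).
Proof.
set r2 := _ + f0r p ^+ 2.
have r20 : 0 <= r2 by rewrite addr_ge0 // sqr_ge0.
apply: (@le_trans _ _ (27 * (r2 * Nr p))); last first.
  have -> : 135 * (r2 * Mr p) = 27 * (r2 * (5 * Mr p)) by ring.
  by rewrite ler_pM2l //; apply: ler_wpM2l => //; exact: Nr_le.
rewrite /Nr !mulr_sumr; apply: ler_sum => a _.
rewrite /JL.XJ; apply: (le_trans (nsq_add3 _ _ _ p)).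
rewrite (nsq_mul (gb + hh)) (nsq_mul (g - hh)) (nsq_mul (3 * hh)) (nsq_mul 3 hh).
have e3 : nsq (3 : A) p = 9.
  by rewrite /nsq (cRe_nat 3) (cIm_real _ (cj_nat V 3)); ring.
have e1 : nsq (gb + hh) p <= 9 * r2.
  rewrite /nsq cRe_add cIm_add cRe_gb cIm_gb cRe_hh cIm_hh /r2.
  by have := sqr_ge0 (qr p + vr p ^+ 2); have := sqr_ge0 (f0r p); move: (qr p + vr p ^+ 2) (f0r p) => x y; nra.
have e2 : nsq (g - hh) p <= 9 * r2.
  rewrite /nsq cRe_sub cIm_add cIm_opp cRe_g cIm_g cRe_hh cIm_hh /r2.
  by have := sqr_ge0 (qr p + vr p ^+ 2); have := sqr_ge0 (f0r p); move: (qr p + vr p ^+ 2) (f0r p) => x y; nra.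
have e4 : nsq hh p <= r2.
  rewrite /nsq cRe_hh cIm_hh /r2.
  by have := sqr_ge0 (qr p + vr p ^+ 2); have := sqr_ge0 (f0r p); move: (qr p + vr p ^+ 2) (f0r p) => x y; nra.
rewrite e3.
have h1 := ler_wpM2r (nsq_ge0 (Ec a) p) e1.
have h2 := ler_wpM2r (nsq_ge0 (Dc a) p) e2.
have h3 := ler_wpM2r (nsq_ge0 (Gc a) p) e4.
move: h1 h2 h3.
move: (nsq (Ec a) p) (nsq (Dc a) p) (nsq (Gc a) p) (nsq (gb + hh) p) (nsq (g - hh) p) (nsq hh p) => x y z a1 a2 a3 h1 h2 h3.
lra.
Qed.

Lemma nsq_sum0 (I : finType) (F : I -> A) p : \sum_i nsq (F i) p <= 0 -> forall i, nsq (F i) p = 0.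
Proof.
move=> h i; apply/eqP; rewrite eq_le nsq_ge0 andbT; apply: le_trans h.
by rewrite (bigD1 i) //= lerDl; apply: sumr_ge0 => j _; exact: nsq_ge0.
Qed.

(** [grad f] may vanish, so squares of contracted tensors are not enough; the term with the positive
    factor [vr ^ 2] yields the full tensors [Dm] and [Em]. *)
Lemma Mr_eq0 : (forall p, Mr p = 0) ->
  [/\ forall a b, Dm a b = 0, forall a b, Em a b = 0 & forall a, Gc a = 0].
Proof.
move=> M0.
have key p : (\sum_a \sum_b nsq (Dm a b) p <= 0) /\ (\sum_a \sum_b nsq (Em a b) p <= 0).
  have h1 := nsq_sum2_ge0 Dm p; have h2 := nsq_sum2_ge0 Em p; have h3 := nsq_sum3_ge0 Tabc p.
  have h4 : 0 <= \sum_a (nsq (Gc a + Dc a) p + nsq (Gc a - Ec a) p + nsq (Gc a) p).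
    by apply: sumr_ge0 => a _; exact: addr_ge0 (addr_ge0 (nsq_ge0 _ _) (nsq_ge0 _ _)) (nsq_ge0 _ _).
  have := M0 p; rewrite MrE.
  have v0 : 0 < vr p ^+ 2 by rewrite exprn_gt0 // vR_gt0.
  have h5 := mulr_ge0 (ltW v0) (addr_ge0 h1 h2).
  move=> e; have {}e : vr p ^+ 2 * (\sum_a \sum_b nsq (Dm a b) p + \sum_a \sum_b nsq (Em a b) p) <= 0.
    by rewrite -[X in _ <= X]e -addrA addrCA lerDl; exact: addr_ge0.
  rewrite pmulr_rle0 // in e.
  by split; apply: le_trans e; rewrite (lerDl, lerDr).
have sum2 (F : 'I_n -> 'I_n -> A) : (forall p, \sum_a \sum_b nsq (F a b) p <= 0) -> forall a b, F a b = 0.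
  move=> h a b; apply: nsq0_eq => p; apply: (nsq_sum0 (F := F a)).
  apply: le_trans (h p); rewrite [X in _ <= X](bigD1 a) //= lerDl; apply: sumr_ge0 => c _.
  by apply: sumr_ge0 => e _; exact: nsq_ge0.
split.
- by apply: sum2 => p; case: (key p).
- by apply: sum2 => p; case: (key p).
move=> a; apply: nsq0_eq => p.
apply: nsq_sum0; apply: (le_trans _ (_ : Nr p <= 0)).
  by apply: ler_sum => b _; rewrite lerDr; exact: addr_ge0 (nsq_ge0 _ _) (nsq_ge0 _ _).
by have := Nr_le p; rewrite M0 mulr0.
Qed.

Lemma csqnorm_zsq p : csqnorm (zcoord p) = zsq p.
Proof.
apply: eq_bigr => a _; rewrite mxE /= sqr_sqrtr //.
by rewrite addr_ge0 // sqr_ge0.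
Qed.

Lemma bump_le1 L p : bump (@sg R n) L p <= 1.
Proof.
rewrite /bump /posn ge_max ler01 andbT; have := sg_ge0 L p.
by move: (sg L p) => s h; have := sqr_ge0 (s - 1); nra.
Qed.
Lemma bump_le_sg L p : bump (@sg R n) L p <= sg L p.
Proof.
rewrite /bump /posn ge_max sg_ge0 andbT; have := sg_ge0 L p.
by move: (sg L p) => s h; nra.
Qed.

Lemma zsq_eq0 p : zsq p = 0 -> p.1 = 0.
Proof.
move=> h; have k a : xlin a p = 0 /\ ylin a p = 0.
  have : xlin a p ^+ 2 + ylin a p ^+ 2 <= 0.
    rewrite -h /zsq (bigD1 a) //= lerDl; apply: sumr_ge0 => b _.
    by rewrite addr_ge0 // sqr_ge0.
  have := sqr_ge0 (xlin a p); have := sqr_ge0 (ylin a p) => h1 h2 h3.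
  by split; apply/eqP; rewrite -sqrf_eq0 eq_le sqr_ge0 andbT; lra.
move: k; case: p {h} => -[x y] t k; congr (_, _); apply/matrixP => i a; rewrite ord1 mxE.
  by case: (k a).
by case: (k a).
Qed.

(** For [x = (|z|^2 + |t|) / L ^ 2] the [n]-th power of the cutoff is at most 1 and at most
    [x ^ (2 n)], hence at most [x ^ (d / 2)]. This cancels the singularity of the decay bound and
    leaves [L ^ (- d)]. *)
Lemma bubble_decay : exists2 C : R, 0 <= C & forall L p, 1 <= L ->
  (bump (@sg R n) L p * vr p) ^+ n <= C * L^-1 ^+ d.
Proof.
case: u_decay => C C0 hC; exists (2 ^- n * C) => [|L p L1].
  by rewrite mulr_ge0 // ?ltW // invr_ge0 exprn_ge0.
have L0 : 0 < L by lra.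
have b0 : 0 <= bump (@sg R n) L p by exact: bump_ge0.
have eV : vr p ^+ n = 2 ^- n * u p.
  by rewrite (u_vR (isT : 0 < n)%N u_pos) exprMn mulrA mulVf ?mul1r // expf_neq0.
rewrite exprMn eV (mulrCA (bump _ L p ^+ n) (2 ^- n)) -(mulrA (2 ^- n)) ler_pM2l ?invr_gt0 ?exprn_gt0 //.
(* The decay hypothesis excludes the origin; there the cutoff vanishes. *)
have [p0|p0] := eqVneq p 0.
  have s0 : sg L p = 0.
    rewrite /sg /gauge4 (_ : zsq p = 0) ?p0 ?expr0n ?addr0 ?mul0r //=.
    by apply: big1 => a _; rewrite /xlin /ylin !mxE expr0n addr0.
  have -> : bump (@sg R n) L p = 0 by rewrite /bump s0 mul0r posn0.
  rewrite expr0n mul0r; apply: mulr_ge0; first exact: ltW.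
  by apply: exprn_ge0; rewrite invr_ge0; exact: ltW.
have := hC p p0; rewrite csqnorm_zsq /tcoord.
set nu := zsq p + `|p.2|; have nu0 : 0 < nu.
  rewrite lt_neqAle eq_sym addr_ge0 ?zsq_ge0 // andbT; apply: contra p0 => /eqP h.
  have z0 := zsq_ge0 p; have t0 := normr_ge0 p.2.
  have /zsq_eq0 e1 : zsq p = 0 by move: h; rewrite /nu; lra.
  have /eqP : `|p.2| = 0 by move: h; rewrite /nu; lra.
  by rewrite normr_eq0 => /eqP e2; rewrite [p]surjective_pairing e1 e2.
have -> : (n%:R - 2) / 2 = d%:R / 2 :> R by rewrite -[d.+2]addn2 natrD; field.
set e := d%:R / 2; have e0 : 0 <= e by rewrite divr_ge0.
move=> hu; apply: (@le_trans _ _ (bump (@sg R n) L p ^+ n * (C * nu `^ (- e)))).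
  by apply: ler_wpM2l => //; rewrite exprn_ge0.
rewrite (mulrCA (bump _ L p ^+ n) C) ler_pM2l //.
pose x := nu / L ^+ 2; have L2 : 0 < L ^+ 2 by rewrite exprn_gt0.
have x0 : 0 < x by rewrite divr_gt0.
have sx : sg L p <= x ^+ 2.
  rewrite /sg /x expr_div_n -exprM exprVn ler_pM2r ?invr_gt0 ?exprn_gt0 // /gauge4 /nu.
  have := zsq_ge0 p; have := normr_ge0 p.2; rewrite -(real_normK (num_real p.2)).
  move: (zsq p) `|p.2| => y z; nra.
have key : bump (@sg R n) L p ^+ n <= x `^ e.
  have [x1|x1] := leP 1 x.
    apply: (@le_trans _ _ 1); first by rewrite exprn_ile1 // bump_le1.
    by rewrite -(powRr0 x) ler_powR.
  apply: (@le_trans _ _ ((x ^+ 2) ^+ n)).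
    by apply: lerXn2r; rewrite ?nnegrE ?sqr_ge0 // (le_trans (bump_le_sg _ _)).
  rewrite -exprM -powR_mulrn; last exact: ltW.
  apply: ger_powR; first by rewrite x0 ltW.
  by rewrite /e natrM -[d.+2]addn2 natrD; have : (0 : R) <= d%:R by []; lra.
apply: (le_trans (ler_wpM2r (powR_ge0 _ _) key)).
have nx : nu = x * L ^+ 2 by rewrite /x mulfVK // gt_eqF.
rewrite nx powRM; [|exact: ltW|exact: ltW].
rewrite mulrA -powRD; last by rewrite (gt_eqF x0) implybT.
rewrite addrN powRr0 mul1r powRN exprVn.
rewrite -powR_mulrn; last exact: ltW.
rewrite -powRrM /e mulrCA mulfV // mulr1 powR_mulrn //; exact: ltW.
Qed.

(** * Fluxes through the cutoffs and the integrations by parts *)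

Local Notation D := (d + d)%N.
Local Notation s := (@sg R n).
Definition Fl (Y : 'I_n -> A) L : A := \sum_a Y a * ZbA a (Sc n L).
(** The factor [1 - 2 s] is the derivative of [s (1 - s)]. The indicator [chi] makes the flux bounds
    hold at every point, and a positive power of the cutoff absorbs it. The minus sign in [T2f] is
    that of the product of imaginary parts in the real part of [gb * Fl]. *)
Definition T1f L p : R := chi s L p * ((1 - 2 * s L p) * cRe (Fl fa L) p).
Definition T2f L p : R := chi s L p * ((1 - 2 * s L p) * - cIm (Fl fa L) p).
Definition TJf L p : R := chi s L p * cRe (Fl Xc L) p.

Lemma Fl_bound (Y : 'I_n -> A) L p (c : R) : 1 <= L -> c ^+ 2 <= (\sum_a nsq (Y a) p) * (\sum_a nsq (ZbA a (Sc n L)) p) ->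
  (chi s L p * c) ^+ 2 <= (\sum_a nsq (Y a) p) * (4 * Yc s L p ^+ 2).
Proof.
move=> L1 hc; rewrite /Yc /chi.
have Y0 : 0 <= \sum_a nsq (Y a) p by apply: sumr_ge0 => a _; exact: nsq_ge0.
case: (ltP (s L p) 1) => h; last by rewrite mul0r mulr0 expr0n !mulr0.
rewrite mul1r mulr1; apply: (le_trans hc); apply: ler_wpM2l => //.
exact: sum_nsq_Sc_le.
Qed.

Lemma sq12 (x c b : R) : 0 <= x -> x < 1 -> c ^+ 2 <= b -> ((1 - 2 * x) * c) ^+ 2 <= b.
Proof.
move=> x0 x1 h; apply: le_trans h; rewrite exprMn -[X in _ <= X]mul1r.
by apply: ler_wpM2r; [exact: sqr_ge0|nra].
Qed.

Lemma chi_sq12 L p (c b : R) : 0 <= b -> (chi s L p * c) ^+ 2 <= b ->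
  (chi s L p * ((1 - 2 * s L p) * c)) ^+ 2 <= b.
Proof.
move=> b0; rewrite /chi; case: (ltP (s L p) 1) => h; last by rewrite !mul0r.
by rewrite !mul1r; apply: sq12 => //; exact: sg_ge0.
Qed.

Lemma T1f_bound L p : 1 <= L -> T1f L p ^+ 2 <= qr p * (4 * Yc s L p ^+ 2).
Proof.
move=> L1; rewrite /T1f; apply: chi_sq12.
  by apply: mulr_ge0; [exact: qr_ge0|rewrite mulr_ge0 // sqr_ge0].
rewrite qrE; apply: Fl_bound => //; exact: cRe_cs.
Qed.

Lemma T2f_bound L p : 1 <= L -> T2f L p ^+ 2 <= qr p * (4 * Yc s L p ^+ 2).
Proof.
move=> L1; rewrite /T2f; apply: chi_sq12.
  by apply: mulr_ge0; [exact: qr_ge0|rewrite mulr_ge0 // sqr_ge0].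
rewrite qrE; apply: Fl_bound => //; rewrite sqrrN; exact: cIm_cs.
Qed.

Lemma TJf_bound L p : 1 <= L -> TJf L p ^+ 2 <=
  (135 * 4) * (((qr p + vr p ^+ 2) ^+ 2 + f0r p ^+ 2) * Mr p * Yc s L p ^+ 2).
Proof.
move=> L1; rewrite /TJf; apply: (@le_trans _ _ ((\sum_a nsq (Xc a) p) * (4 * Yc s L p ^+ 2))).
  by apply: Fl_bound => //; exact: cRe_cs.
have Y0 : 0 <= 4 * Yc s L p ^+ 2 by rewrite mulr_ge0 // sqr_ge0.
apply: (le_trans (ler_wpM2r Y0 (Xc_le p))).
by rewrite le_eqVlt; apply/orP; left; apply/eqP; ring.
Qed.

Lemma bump_chi L p k (c : R) : bump s L p ^+ k.+1 * (chi s L p * c) = bump s L p ^+ k.+1 * c.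
Proof.
rewrite /chi; case: (ltP (s L p) 1) => h; first by rewrite mul1r.
have -> : bump s L p = 0.
  by apply/max_idPr; have := sg_ge0 L p; move: (sg L p) h => x h h'; nra.
by rewrite expr0n !mul0r.
Qed.

Lemma eta_chi L p k (c : R) : eta s L p ^+ k.+1 * (chi s L p * c) = eta s L p ^+ k.+1 * c.
Proof.
rewrite /chi; case: (ltP (s L p) 1) => h; first by rewrite mul1r.
have -> : eta s L p = 0.
  by apply/max_idPr; rewrite subr_le0 exprn_ege1.
by rewrite expr0n !mul0r.
Qed.

Lemma flux_pull (F G : A) (Y : 'I_n -> A) L : cconj F = F ->
  forall p, cRe (\sum_a F * G * Y a * ((1 - 2 * Sc n L) * ZbA a (Sc n L))) p =
   cRe F p * ((1 - 2 * s L p) * cRe (G * Fl Y L) p).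
Proof.
move=> cF p.
have -> : \sum_a F * G * Y a * ((1 - 2 * Sc n L) * ZbA a (Sc n L)) =
  F * ((1 - 2 * Sc n L) * (G * Fl Y L)).
  rewrite /Fl !mulr_sumr; apply: eq_bigr => a _; ring.
have c12 : cconj (1 - 2 * Sc n L) = 1 - 2 * Sc n L.
  by rewrite cconjB cconjM (cj_nat _ 1) (cj_nat _ 2) cj_Sc.
rewrite (cRe_mulr _ _ cF) (cRe_mulr _ _ c12).
by rewrite cRe_sub (cRe_mulr _ _ (cj_nat _ 2)) (cRe_nat 1) (cRe_nat 2) cRe_Sc.
Qed.

Lemma bubble_ibp_f j k L (eps : R) : 1 <= L -> 0 < eps ->
  \forall m \near \oo, `|Int m (ibp_f vr qr s T1f j k L)| <= eps.
Proof.
move=> L1 e0; have r0 : 0 <= L ^+ 2 by exact: sqr_ge0.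
have := ibp_div (smth_bcut n L) r0 (fun p => @bcut_supp R n L p L1)
   (fun a => v ^+ j * fa a) k e0.
apply: filterS => m.
suff -> : ibpf (bcut L) k (cRe (\sum_a ZbA a (v ^+ j * fa a)))
   (cRe (\sum_a v ^+ j * fa a * ZbA a (creal (smth_bcut n L)))) = ibp_f vr qr s T1f j k L by [].
apply/funext => p; rewrite /ibpf /ibp_f -cRe_div1; congr (_ + _ * _).
rewrite -[pb _ p]/(bump s L p) /T1f.
have -> : \sum_a v ^+ j * fa a * ZbA a (creal (smth_bcut n L)) =
  \sum_a v ^+ j * 1 * fa a * ((1 - 2 * Sc n L) * ZbA a (Sc n L)).
  by apply: eq_bigr => a _; rewrite ZbA_bcut mulr1.
rewrite (flux_pull _ _ _ (cj_vX j)) cRe_vX mul1r.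
move: (1 - 2 * s L p) (cRe _ p) => x y.
rewrite [in RHS]mulrCA bump_chi; ring.
Qed.

Lemma bubble_ibp_qf L (eps : R) : 1 <= L -> 0 < eps ->
  \forall m \near \oo, `|Int m (ibp_qf vr qr ar s T1f L)| <= eps.
Proof.
move=> L1 e0; have r0 : 0 <= L ^+ 2 by exact: sqr_ge0.
have := ibp_div (smth_bcut n L) r0 (fun p => @bcut_supp R n L p L1)
   (fun a => v ^+ D.+2 * q * fa a) D.+4 e0.
apply: filterS => m.
suff -> : ibpf (bcut L) D.+4 (cRe (\sum_a ZbA a (v ^+ D.+2 * q * fa a)))
   (cRe (\sum_a v ^+ D.+2 * q * fa a * ZbA a (creal (smth_bcut n L)))) =
   ibp_qf vr qr ar s T1f L by [].
apply/funext => p; rewrite /ibpf /ibp_qf -cRe_div2; congr (_ + _ * _).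
rewrite -[pb _ p]/(bump s L p) /T1f.
have -> : \sum_a v ^+ D.+2 * q * fa a * ZbA a (creal (smth_bcut n L)) =
  \sum_a v ^+ D.+2 * q * fa a * ((1 - 2 * Sc n L) * ZbA a (Sc n L)).
  by apply: eq_bigr => a _; rewrite ZbA_bcut.
rewrite (flux_pull _ _ _ (cj_vX D.+2)) cRe_vX.
rewrite (cRe_mulr _ _ cj_qc) -[cRe q p]/(qr p).
move: (1 - 2 * s L p) (cRe _ p) (qr p) (vr p ^+ D.+2) => x y z t.
have -> : t * (z * (chi s L p * (x * y))) = chi s L p * (t * (z * (x * y))) by ring.
rewrite bump_chi; ring.
Qed.

Lemma bubble_ibp_gf L (eps : R) : 1 <= L -> 0 < eps ->
  \forall m \near \oo, `|Int m (ibp_gf vr qr f0r a'r s T1f T2f L)| <= eps.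
Proof.
move=> L1 e0; have r0 : 0 <= L ^+ 2 by exact: sqr_ge0.
have := ibp_div (smth_bcut n L) r0 (fun p => @bcut_supp R n L p L1)
   (fun a => v ^+ D.+2 * gb * fa a) D.+4 e0.
apply: filterS => m.
suff -> : ibpf (bcut L) D.+4 (cRe (\sum_a ZbA a (v ^+ D.+2 * gb * fa a)))
   (cRe (\sum_a v ^+ D.+2 * gb * fa a * ZbA a (creal (smth_bcut n L)))) =
   ibp_gf vr qr f0r a'r s T1f T2f L by [].
apply/funext => p; rewrite /ibpf /ibp_gf -cRe_div3; congr (_ + _ * _).
rewrite -[pb _ p]/(bump s L p) /T1f /T2f.
have -> : \sum_a v ^+ D.+2 * gb * fa a * ZbA a (creal (smth_bcut n L)) =
  \sum_a v ^+ D.+2 * gb * fa a * ((1 - 2 * Sc n L) * ZbA a (Sc n L)).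
  by apply: eq_bigr => a _; rewrite ZbA_bcut.
rewrite (flux_pull _ _ _ (cj_vX D.+2)) cRe_vX.
rewrite cRe_mul cRe_gb cIm_gb.
move: (1 - 2 * s L p) (cRe _ p) (cIm _ p) (qr p + _) (f0r p) (vr p ^+ D.+2) => x y y' z z' t.
have -> : t * (z * (chi s L p * (x * y)) + z' * (chi s L p * (x * - y'))) =
  chi s L p * (t * (z * (x * y) - z' * (x * y'))) by ring.
rewrite bump_chi; ring.
Qed.

Lemma bubble_ibp_X L (eps : R) : 1 <= L -> 0 < eps ->
  \forall m \near \oo, `|Int m (ibp_X vr Mr s TJf L)| <= eps.
Proof.
move=> L1 e0; have r0 : 0 <= L ^+ 2 by exact: sqr_ge0.
have := ibp_div (smth_ecut n D.+4.+4 L) r0 (fun p => @ecut_supp R n D.+4.+4 L p L1)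
   (fun a => v ^+ D.+2 * Xc a) D.+4.+2 e0.
apply: filterS => m.
suff -> : ibpf (ecut D.+4.+4 L) D.+4.+2 (cRe (\sum_a ZbA a (v ^+ D.+2 * Xc a)))
   (cRe (\sum_a v ^+ D.+2 * Xc a * ZbA a (creal (smth_ecut n D.+4.+4 L)))) =
   ibp_X vr Mr s TJf L by [].
apply/funext => p; rewrite /ibpf /ibp_X -cRe_div4; congr (_ + _ * _).
rewrite -[pb _ p]/(eta s L p) /TJf.
have -> : \sum_a v ^+ D.+2 * Xc a * ZbA a (creal (smth_ecut n D.+4.+4 L)) =
  - (D.+4.+4%:R * (Sc n L ^+ D.+4.+3 * (v ^+ D.+2 * Fl Xc L))).
  rewrite /Fl !mulr_sumr -sumrN; apply: eq_bigr => a _; rewrite ZbA_ecut.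
  move: (v ^+ _) (Sc n L ^+ _) (Xc a) (ZbA a _) (D.+4.+4%:R) => x1 x2 x3 x4 x5; ring.
rewrite cRe_opp (cRe_mulr _ _ (cj_nat _ _)) (cRe_mulr _ _ (cj_exp _ (cj_Sc n L))).
rewrite (cRe_mulr _ _ (cj_vX D.+2)) cRe_vX cRe_nat.
rewrite (cRe_exp _ _ (cj_Sc n L)) cRe_Sc.
move: (cRe _ p) (vr p ^+ _) (s L p ^+ _) (D.+4.+4%:R) => x y z t.
have -> : - (t * (z * (y * (chi s L p * x)))) = chi s L p * - (t * (z * (y * x))) by ring.
by rewrite eta_chi.
Qed.

Lemma gauge_vol : exists2 K : R, 0 <= K &
  forall L m, 1 <= L -> Int m (chi s L) <= K * L ^+ D.+4.+2.
Proof.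
exists (3 ^+ (n + n) * 3) => [|L m L1]; first by rewrite mulr_ge0 // exprn_ge0.
have L0 : 0 < L by lra.
apply: (@le_trans _ _ (Int m (fun p : V => (inbox L (L ^+ 2) 0 p)%:R))).
  apply: Int_le => p; rewrite /chi; case: (ltP (s L p) 1) => h; last exact: ler0n.
  by rewrite sg_inbox.
apply: (le_trans (vol_le _ _ (ltW L0) (sqr_ge0 L))).
apply: (@le_trans _ _ ((3 * L) ^+ (n + n) * (3 * L ^+ 2))).
  apply: ler_pM.
  - by apply: exprn_ge0; lra.
  - by have := sqr_ge0 L; lra.
  - by apply: lerXn2r; rewrite ?nnegrE; lra.
  - by nra.
rewrite exprMn le_eqVlt; apply/orP; left; apply/eqP.
have -> : D.+4.+2 = (n + n + 2)%N by rewrite !addnS !addSn addn0.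
rewrite (exprD L (n + n) 2); move: (3 ^+ (n + n)) (L ^+ (n + n)) => x y; ring.
Qed.

Lemma mass_zero p0 : Mr p0 = 0.
Proof.
apply/eqP; rewrite eq_le Mr_ge0 andbT leNgt; apply/negP => M0.
(* This puts [p0] inside the ball: [gauge4 p0 < L0 <= L0 ^ 4]. *)
pose L0 : R := 1 + gauge4 p0.
have g0 := gauge4_ge0 p0.
have L1 : 1 <= L0 by rewrite /L0; lra.
have s1 : s L0 p0 < 1.
  have L00 : 0 < L0 by rewrite /L0; lra.
  rewrite /sg exprVn ltr_pdivrMr ?mul1r; last exact: exprn_gt0.
  apply: (@lt_le_trans _ _ L0); first by rewrite /L0; lra.
  by rewrite -[X in X <= _]expr1; apply: ler_weXn2l.
pose F p := vr p ^+ D.+2 * Mr p * eta s L0 p ^+ D.+4.+4.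
have F0 p : 0 <= F p.
  apply: mulr_ge0; last by apply: exprn_ge0; exact: posn_ge0.
  by apply: mulr_ge0; [apply: exprn_ge0; exact/ltW/vR_gt0|exact: Mr_ge0].
have Fp0 : 0 < F p0.
  apply: mulr_gt0; first by apply: mulr_gt0 => //; apply: exprn_gt0; exact: vR_gt0.
  apply: exprn_gt0; rewrite /eta /posn lt_max subr_gt0 exprn_ilt1 //.
  exact: sg_ge0.
have cF : continuous F.
  pose G := cRe (v ^+ D.+2 * Qc).
  pose H p := pb (ecut D.+4.+4 L0) p ^+ D.+4.+4.
  have cG : continuous G by apply: smth_continuous; exact: smth_cRe.
  have cH : continuous H by apply: pbX_continuous; exact: (smth_ecut n).
  have -> : F = (fun p => G p * H p).
    apply/funext => p; congr (_ * _).
    by rewrite /G (cRe_mulr _ _ (cj_vX D.+2)) cRe_vX.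
  move=> p; exact: (cvgM (cG p) (cH p)).
have : \forall p \near p0, F p0 / 2 <= F p.
  have h2 : F p0 / 2 < F p0 by lra.
  exact: (cvgr_ge _ (cF p0) _ h2).
move=> /nbhs_ballP [e /= e0 he].
have e2 : 0 < e / 2 by rewrite divr_gt0.
have hb p : inbox (e / 2) (e / 2) p0 p -> F p0 / 2 <= F p.
  move=> /and3P[/forallP h1 /forallP h2 h3]; apply: he.
  have elt : e / 2 < e by lra.
  split; last by rewrite /= /ball /= distrC (le_lt_trans h3).
  split; split=> // i a; rewrite ord1 /ball /= distrC.
    exact: le_lt_trans (h1 a) elt.
  exact: le_lt_trans (h2 a) elt.
have c0 : 0 < F p0 / 2 by rewrite divr_gt0.
case: (Int_pos e2 c0 F0 hb) => c' c'0 hc'.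
have J0 : (0 : R) <= 135 * 4 by apply: mulr_ge0.
exact: (@no_mass R d vr qr f0r Mr ar a'r s T1f T2f TJf
  (vR_gt0 u) qr_ge0 Mr_ge0 (@sg_ge0 R n) (@sg_scale R n)
  gauge_vol bubble_decay T1f_bound T2f_bound _ J0 TJf_bound
  ar_le a'r_le bubble_ibp_f bubble_ibp_qf bubble_ibp_gf bubble_ibp_X L0 c' L1 c'0 hc').
Qed.

(** * Rigidity and identification of the bubble *)

Lemma tensors0 : [/\ forall a b, Dm a b = 0, forall a b, Em a b = 0 & forall a, Gc a = 0].
Proof. by apply: Mr_eq0 => p; exact: mass_zero. Qed.
Let Dm0 a b : Dm a b = 0. Proof. by case: tensors0 => h _ _; exact: h. Qed.
Let Em0 a b : Em a b = 0. Proof. by case: tensors0 => _ h _; exact: h. Qed.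
Let Gv0 a : Gc a = 0. Proof. by case: tensors0 => _ _ h; exact: h. Qed.

Lemma nsq_g_gt0 p : 0 < nsq g p.
Proof.
rewrite /nsq cRe_g; apply: ltr_wpDr; first exact: sqr_ge0.
rewrite exprn_gt0 // ltr_wpDl ?exprn_gt0 ?vR_gt0 //; exact: qr_ge0.
Qed.

Lemma smth_nsq_g : smth (nsq g).
Proof.
by rewrite -(_ : cRe (g * cj g) = nsq g); [exact: smth_cRe|apply/funext => p; exact: nsqEs].
Qed.
Lemma smth_nsq_gV : smth (fun p => (nsq g p)^-1).
Proof. by apply: smth_inv smth_nsq_g _ => p; rewrite gt_eqF // nsq_g_gt0. Qed.
Lemma smth_vR2V : smth (fun p => (vr p ^+ 2)^-1).
Proof.
apply: smth_inv => [|p]; last by rewrite gt_eqF // exprn_gt0 // vR_gt0.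
by rewrite -(_ : vr * vr = (fun p => vr p ^+ 2)) //; apply: smth_mul; exact: smth_vR.
Qed.

Definition gi : A := cj g * creal smth_nsq_gV.
Definition Pi : A := creal smth_vR2V.

Lemma ggi : g * gi = 1.
Proof.
rewrite /gi mulrA; apply: csm_real_eq => [||p].
- by rewrite cconjM [cconj (g * _)]cconjM (cjsK g) cconj_creal; congr (_ * _); exact: mulrC.
- exact: (cj_nat _ 1).
have c : cconj (g * cj g) = g * cj g by rewrite cconjM (cjsK g); exact: mulrC.
by rewrite (cRe_mulr _ _ c) nsqEs cRe_creal (cRe_nat 1) mulfV // gt_eqF // nsq_g_gt0.
Qed.

Lemma PPi : JL.P v * Pi = 1.
Proof.
rewrite JL.PE; apply: csm_real_eq => [||p].
- by rewrite cconjM cj_vv cconj_creal.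
- exact: (cj_nat _ 1).
rewrite (cRe_mulr _ _ cj_vv) cRe_vv cRe_creal (cRe_nat 1) mulfV // gt_eqF //.
by rewrite exprn_gt0 // vR_gt0.
Qed.

Local Notation F := (JL.Fr ii gi).
Local Notation kap := (JL.kap Z Zb T ii f v Pi).

Lemma half_cancel (x y : A) : 2 * x = 2 * y -> x = y.
Proof.
move=> e; have h : half R n * (2 * x) = half R n * (2 * y) by rewrite e.
have k z : half R n * (2 * z) = z :> A by rewrite mulrA [half R n * 2]mulrC half2 mul1r.
by rewrite -(k x) -(k y).
Qed.

Lemma T_F : T F = 1.
Proof.
apply: half_cancel; rewrite mulr1.
exact (@JL.T_Fr A n Z Zb T cj ii ZsM ZbsM TsM cjs_ii Zs_ii cjsK cjs_Zs cjs_Ts Zs_Zs Zs_Ts Zs_Zbs f v cjs_f cjs_v Zs_v Dm0 Em0 Gv0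
  gi ggi ord0 (Ts_ii)).
Qed.
Lemma Zb_F a : Zb a F = 0.
Proof.
exact (@JL.Zb_Fr A n Z Zb T cj ii ZsM ZbsM cjs_ii Zs_ii Zbs_ii cjsK cjs_Zs cjs_Ts Zs_Zs Zs_Ts Zs_Zbs f v cjs_f cjs_v Zs_v Dm0 Em0 Gv0
  gi ggi a).
Qed.
Lemma ZZ_F a b : Z b (Z a F) = 0.
Proof.
exact (@JL.ZZ_Fr A n Z Zb T ii ZsM Zs_ii Zs_Zs Zs_Ts Zs_Zbs f v Zs_v Dm0 Em0 Gv0 gi ggi a b).
Qed.
Lemma sqnorm_ZF : \sum_a Z a F * cj (Z a F) = 4 * q * gi * cj gi.
Proof.
exact (@JL.sqnorm_ZFr A n Z Zb T cj ii ZsM iis2 cjs_ii Zs_ii cjs_Zs Zs_Zs Zs_Ts Zs_Zbs f v cjs_f Zs_v Dm0 Em0 Gv0 gi ggi).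
Qed.
Lemma Z_kap a : Z a kap = 0.
Proof.
exact (@JL.Z_kap A n Z Zb T ii ZsM Zs_ii Zs_Zs Zs_Ts Zs_Zbs f v Zs_v Dm0 Em0 Gv0 Pi PPi a).
Qed.
Lemma Zb_kap a : Zb a kap = 0.
Proof.
exact (@JL.Zb_kap A n Z Zb T cj ii ZsM cjs_ii Zs_ii cjsK cjs_Zs cjs_Ts Zs_Zs Zs_Ts Zs_Zbs f v cjs_f cjs_v Zs_v Dm0 Em0 Gv0 Pi PPi a).
Qed.
Lemma T_kap : T kap = 0.
Proof.
have h : 2 * (ii * T kap) = 0.
  exact (@JL.iT_kap A n Z Zb T cj ii ZsM cjs_ii Zs_ii cjsK cjs_Zs cjs_Ts Zs_Zs Zs_Ts Zs_Zbs f v cjs_f cjs_v Zs_v Dm0 Em0 Gv0 Pi PPi ord0).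
have {}h : ii * T kap = 0 by apply: half_cancel; rewrite mulr0.
have -> : T kap = - (ii * (ii * T kap)) by rewrite mulrA iis2 mulN1r opprK.
by rewrite h mulr0 oppr0.
Qed.

Lemma cRe_kap p : cRe kap p = nsq g p / vr p ^+ 2.
Proof.
rewrite /JL.kap -cj_gc.
have c : cconj (g * cj g) = g * cj g by rewrite cconjM (cjsK g); exact: mulrC.
by rewrite (cRe_mulr _ _ c) nsqEs cRe_creal.
Qed.

Definition kap0 : R := nsq g 0 / vr 0 ^+ 2.
Lemma kap0_gt0 : 0 < kap0.
Proof. by rewrite divr_gt0 ?nsq_g_gt0 // exprn_gt0 // vR_gt0. Qed.

Lemma nsq_gE p : nsq g p = kap0 * vr p ^+ 2.
Proof.
have e : cRe kap p = cRe kap 0.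
  by rewrite {1}(@csm_const R n kap Z_kap Zb_kap T_kap).
rewrite cRe_kap cRe_kap -/kap0 in e.
by rewrite -e mulfVK // gt_eqF // exprn_gt0 // vR_gt0.
Qed.

Lemma nsq_gi p : nsq gi p = (nsq g p)^-1.
Proof.
rewrite /gi (nsq_mul (cj g)) nsq_cjs [nsq (creal _) p]/nsq cRe_creal (cIm_real p (cconj_creal _)).
by have := nsq_g_gt0 p; move: (nsq g p) => x x0; field; rewrite gt_eqF.
Qed.
Lemma nsq_F p : nsq F p = (nsq g p)^-1.
Proof.
rewrite /JL.Fr (nsq_mul ii) nsq_gi [nsq ii p]/nsq cRe_ci cIm_ci; ring.
Qed.
Lemma cIm_F p : cIm F p = cRe g p / nsq g p.
Proof.
rewrite /JL.Fr cIm_mul cRe_ci cIm_ci mul0r add0r mul1r /gi mulrC.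
by rewrite (cRe_mulr _ _ (cconj_creal _)) cRe_cjs cRe_creal mulrC.
Qed.

Lemma zc0 a : (zc R a : A) 0 = 0.
Proof. by rewrite zcE mxE /= !mxE. Qed.

Lemma csm_addE (x y : A) p : (x + y) p = x p + y p. Proof. by []. Qed.
Lemma csm_mulE (x y : A) p : (x * y) p = x p * y p. Proof. by []. Qed.
Lemma ccstE c p : ccst V c p = c. Proof. by case: c. Qed.
Lemma ctE p : ct R n p = (p.2)%:C%C. Proof. by []. Qed.
Lemma ZqE p : Zq R n p = (zsq p)%:C%C.
Proof.
apply/eqP; rewrite eq_complex -[complex.Re (Zq R n p)]/(cRe (Zq R n) p) -[complex.Im (Zq R n p)]/(cIm (Zq R n) p).
by rewrite cRe_Zq (cIm_real p (cj_Zq R n)) /= !eqxx.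
Qed.

Lemma normc_nsq (G : A) p : Normc.normc (G p) = Num.sqrt (nsq G p).
Proof. by rewrite /nsq /cRe /cIm; case: (G p). Qed.

Lemma bubble_form : exists (mu : 'rV[R[i]]_n) (lambda : R[i]),
    csqnorm mu < 4 * complex.Im lambda /\
    forall p : heis R n,
      u p = (4 * complex.Im lambda - csqnorm mu) `^ (n%:R / 2)
            / Normc.normc ((tcoord p)%:C%C + 'i%C * (csqnorm (zcoord p))%:C%C
                           + cpairing mu (zcoord p) + lambda) ^+ n.
Proof.
have [mu [lambda [eF eZ]]] := @cr_affine R n F T_F Zb_F ZZ_F.
exists mu, lambda.
have Fp p : F p = (tcoord p)%:C%C + 'i%C * (csqnorm (zcoord p))%:C%C
                           + cpairing mu (zcoord p) + lambda.
  rewrite eF 3!csm_addE csm_mulE ctE ZqE ccstE ccstE csm_sumE csqnorm_zsq.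
  congr (_ + _ + _ + _); apply: eq_bigr => a _; by rewrite csm_mulE ccstE zcE.
(* At the origin [F] equals [lambda] and [Z a F] equals [mu_a], so both parameters are read off
   there. *)
have eIm : complex.Im lambda = cIm F 0.
  rewrite /cIm Fp csqnorm_zsq /tcoord.
  have -> : zsq (0 : V) = 0 by apply: big1 => a _; rewrite /xlin /ylin !mxE expr0n addr0.
  have -> : cpairing mu (zcoord (0 : V)) = 0.
    by apply: big1 => a _; rewrite -zcE zc0 mulr0.
  by rewrite mulr0 !add0r.
have emu : csqnorm mu = 4 * qr 0 / nsq g 0.
  have -> : csqnorm mu = cRe (\sum_a Z a F * cj (Z a F)) 0.
    rewrite cRe_sum; apply: eq_bigr => a _; rewrite nsqEs.
    have -> : mu 0 a = Z a F 0.
      rewrite [Z a F]eZ csm_addE csm_mulE ccstE.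
      have -> : cconj (zc R a) (0 : V) = 0 by rewrite -[LHS]/((zc R a 0)^*%C) zc0 conjc0.
      by rewrite mulr0 addr0.
    by rewrite normc_nsq sqr_sqrtr // nsq_ge0.
  rewrite sqnorm_ZF -(mulrA (4 * q) gi) -(mulrA 4 q) (cRe_mulr _ _ (cj_nat _ 4)) (cRe_mulr _ _ cj_qc).
  rewrite nsqEs nsq_gi (cRe_nat 4); exact: mulrA.
(* The difference is [4 (Re g - q) / |g|^2], that is [4 P / |g|^2], taken at the origin; its
   positivity is the strict inequality on the parameters. *)
have c4 : 4 * complex.Im lambda - csqnorm mu = 4 / kap0.
  rewrite eIm emu cIm_F cRe_g.
  have := nsq_gE 0; have := nsq_g_gt0 0; have := kap0_gt0.
  have : 0 < vr 0 ^+ 2 by rewrite exprn_gt0 // vR_gt0.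
  move: (vr 0 ^+ 2) (nsq g 0) kap0 (qr 0) => x y k z x0 y0 k0 ->.
  by field; rewrite !gt_eqF.
have c0 : 0 < 4 / kap0 by rewrite divr_gt0 // kap0_gt0.
split=> [|p]; first by rewrite -subr_gt0 c4.
rewrite c4 -Fp normc_nsq nsq_F.
have s0 : 0 <= 4 / kap0 by exact: ltW.
have -> : (4 / kap0) `^ (n%:R / 2) = Num.sqrt (4 / kap0) ^+ n.
  by rewrite [n%:R / 2]mulrC powRrM powR12_sqrt // powR_mulrn // sqrtr_ge0.
(* Both sides are [n]-th powers of [2 v], because [|F| = 1 / |g|] and [|g|^2 = kap0 v ^ 2]. *)
rewrite (u_vR (isT : 0 < n)%N u_pos) -expr_div_n; congr (_ ^+ _).
have v0 := vR_gt0 u p; have k0 := kap0_gt0.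
rewrite nsq_gE sqrtrV; last by rewrite mulr_ge0 ?sqr_ge0 // ltW.
rewrite invrK -sqrtrM // mulrA mulfVK ?gt_eqF //.
by rewrite -(_ : (2 * vr p) ^+ 2 = 4 * vr p ^+ 2) ?sqrtr_sqr ?ger0_norm ?mulr_ge0 ?ltW //; ring.
Qed.
End Bubble.

Theorem theorem1p1 (R : realType) (n : nat) (u : heis R n -> R)
  (n_ge2 : (2 <= n)%N)
  (u_smooth : smooth u)
  (u_pos : forall p : heis R n, 0 < u p)
  (u_eq : forall p : heis R n,
     4 * subLaplacian u p = n%:R ^+ 2 * u p `^ ((n%:R + 2) / n%:R))
  (u_decay : exists2 C : R, 0 < C &
     forall p : heis R n, p != 0 ->
       u p <= C * (csqnorm (zcoord p) + `|tcoord p|) `^ (- ((n%:R - 2) / 2))) :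
  exists (mu : 'rV[R[i]]_n) (lambda : R[i]),
    csqnorm mu < 4 * complex.Im lambda /\
    forall p : heis R n,
      u p = (4 * complex.Im lambda - csqnorm mu) `^ (n%:R / 2)
            / Normc.normc ((tcoord p)%:C%C + 'i%C * (csqnorm (zcoord p))%:C%C
                           + cpairing mu (zcoord p) + lambda) ^+ n.
Proof.
case: n n_ge2 u u_smooth u_pos u_eq u_decay => [|[|d]] // _ u u_smooth u_pos u_eq u_decay.
exact: bubble_form u_smooth u_pos u_eq u_decay.
Qed.
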